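(* Let $\mathcal{K}$ be the class of convex functions on the unit disk, and for $n\ge 1$ set $$U_n=\sup_{f\in\mathcal{K}}\big(|a_{n+1}(f)|-|a_n(f)|\big),\qquad V_n=\sup_{f\in\mathcal{K}}\big(|a_n(f)|-|a_{n+1}(f)|\big).$$ Then: (i) $U_n=1/(n+1)$ for every $n\ge 2$, and the supremum is attained by $L_{\pi/n}$, i.e. $|a_{n+1}(L_{\pi/n})|-|a_n(L_{\pi/n})|=1/(n+1)$; (ii) $V_2=1/2$, attained by $L_{\pi/3}$; (iii) $V_3=1/3$, attained by $L_{\pi/4}$.
   Context: $\mathbb{D}=\{z\in\mathbb{C}:|z|<1\}$. $\mathcal{S}$ denotes the class of analytic univalent functions $f(z)=z+\sum_{n\ge2}a_nz^n$ on $\mathbb{D}$, and $a_n(f)$ denotes the $n$-th Taylor coefficient of $f$ (with $a_1=1$). $\mathcal{K}\subset\mathcal{S}$ is the class of convex functions, i.e. those $f\in\mathcal{S}$ with $f(\mathbb{D})$ convex. For $\phi\in\mathbb{R}$, $$L_\phi(z)=\frac{1}{e^{i\phi}-e^{-i\phi}}\log\frac{1-e^{-i\phi}z}{1-e^{i\phi}z}=\sum_{n=1}^\infty\frac{\sin n\phi}{n\sin\phi}z^n,$$ interpreted by continuity when $\sin\phi=0$ (e.g. $L_0(z)=z/(1-z)$); each $L_\phi$ belongs to $\mathcal{K}$. *)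

(* Defs.v *)
From Stdlib Require Import Reals.
Open Scope R_scope.

Definition C := (R * R)%type.
Definition Cre (z : C) : R := fst z.
Definition Cim (z : C) : R := snd z.
Definition RtoC (x : R) : C := (x, 0).
Definition Cadd (z w : C) : C := (fst z + fst w, snd z + snd w).
Definition Cmul (z w : C) : C :=
  (fst z * fst w - snd z * snd w, fst z * snd w + snd z * fst w).
Definition Cscal (t : R) (z : C) : C := (t * fst z, t * snd z).
Fixpoint Cpow (z : C) (n : nat) : C :=
  match n with O => (1, 0) | S k => Cmul z (Cpow z k) end.
Definition Cmod (z : C) : R := sqrt (fst z ^ 2 + snd z ^ 2).

Definition inD (z : C) : Prop := Cmod z < 1.

Fixpoint psum (a : nat -> C) (z : C) (N : nat) : C :=
  match N with
  | O => Cmul (a O) (Cpow z O)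
  | S M => Cadd (psum a z M) (Cmul (a (S M)) (Cpow z (S M)))
  end.

Definition has_sum (a : nat -> C) (z : C) (w : C) : Prop :=
  Un_cv (fun N => fst (psum a z N)) (fst w) /\
  Un_cv (fun N => snd (psum a z N)) (snd w).

(* An analytic function on D is identified with its Taylor series at 0,
   which converges on all of D.  f(z) = w  iff  has_sum a z w. *)
Definition analytic_on_D (a : nat -> C) : Prop :=
  forall z, inD z -> exists w, has_sum a z w.

Definition inS (a : nat -> C) : Prop :=
  a O = (0, 0) /\ a 1%nat = (1, 0) /\ analytic_on_D a /\
  (forall z1 z2 w, inD z1 -> inD z2 -> has_sum a z1 w -> has_sum a z2 w ->
     z1 = z2).

Definition inK (a : nat -> C) : Prop :=
  inS a /\
  (forall z1 z2 w1 w2 t, inD z1 -> inD z2 -> has_sum a z1 w1 -> has_sum a z2 w2 ->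
     0 <= t <= 1 ->
     exists z3, inD z3 /\ has_sum a z3 (Cadd (Cscal (1 - t) w1) (Cscal t w2))).

(* Taylor coefficients of L_phi: a_n = sin(n phi) / (n sin phi)
   (only used with sin phi <> 0; a_0 = 0). *)
Definition L_coef (phi : R) (n : nat) : C :=
  RtoC (sin (INR n * phi) / (INR n * sin phi)).

Definition Uset (n : nat) (x : R) : Prop :=
  exists a, inK a /\ x = Cmod (a (S n)) - Cmod (a n).
Definition Vset (n : nat) (x : R) : Prop :=
  exists a, inK a /\ x = Cmod (a n) - Cmod (a (S n)).

(* Main.v *)
(* For f in K put h = f' and p = 1 + z f''/f' = sum p_k z^k.  By convexity
   (f(e^{it}z) + f(e^{-it}z))/2 is subordinate to f; the Schwarz lemma and t -> 0 give Re p >= 0,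
   so the p_k / 2 are Fourier coefficients of a probability measure.  Since
   k h_k = sum_{j=1}^k p_j h_{k-j}, the third Lebedev-Milin inequality bounds the coefficient
   h_n - zeta h_{n-1} of (1 - zeta z) h in terms of the p_j - zeta^j, and averaging over the
   measure gives a unimodular zeta (Leung) for which the bound is 1.  As h_n = (n+1) a_{n+1},
   this is (n+1)|a_{n+1}| - n|a_n| <= 1, hence U_n.  For V_2 and V_3 the orthogonal polynomials
   of the measure parametrise p_1, p_2, p_3.  L_phi maps the disk onto a vertical strip, because
   exp(i phi + 2 i sin(phi) L_phi(z)) is a Moebius map onto the upper half-plane. *)

From Pilot Require Import Defs.
From Stdlib Require Import Reals Ranalysis5 Lra Lia Psatz.
From Stdlib Require Import Classical ClassicalEpsilon.
From Coquelicot Require Import Coquelicot.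
Open Scope R_scope.

(** The representing measure of p is never built. Positivity is kept in dual form
    ([positive_coefs]): pairing the p_k with any nonnegative trigonometric polynomial gives a
    nonnegative number, so each integration against the measure becomes the choice of such a
    polynomial. Averaging gives the bound 1 because the j-th moment is p_j / 2: the mean of |p_j -
    zeta^j|^2 is |p_j|^2 - |p_j|^2 + 1 = 1, so the Lebedev-Milin exponent has mean 0. Only
    near-optimal directions zeta are produced; if d = |h_n| - |h_{n-1}| > 1, a slack of ln d yields
    d^2 <= d, which is absurd. The other obstacle is the subordinating map, the inverse of f
    composed with the cosine mean. It is a pointwise choice, not a power series, so the Schwarz
    lemma rests on a maximum principle for functions having two complex derivatives. That the lift
    has them requires f' never to vanish, and this is extracted from injectivity: where f - f(z0)
    vanishes to order K >= 2, nearby values have several branches of preimages. *)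

(** * Moduli, real and imaginary parts *)

Lemma Cmod_sub_triangle (x y : C) : Cmod (x - y)%C <= Cmod x + Cmod y.
Proof. rewrite <- (Cmod_opp y). apply Cmod_triangle. Qed.

Lemma Cmod_sub_sym (x y : C) : Cmod (x - y)%C = Cmod (y - x)%C.
Proof. rewrite <- Cmod_opp. f_equal. ring. Qed.

Lemma Cmod_ge_sub (x y : C) : Cmod x - Cmod y <= Cmod (x - y)%C.
Proof.
  pose proof (Cmod_triangle (x - y)%C y) as H.
  replace (x - y + y)%C with x in H by ring. lra.
Qed.

Lemma Cmod_sqr (z : C) : Cmod z ^ 2 = fst z ^ 2 + snd z ^ 2.
Proof. unfold Cmod. rewrite pow2_sqrt; [reflexivity | nra]. Qed.

Lemma Cmod_sqr_sum (z w : C) :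
  Cmod (z + w)%C ^ 2 = Cmod z ^ 2 + 2 * Re (Cconj z * w)%C + Cmod w ^ 2.
Proof. rewrite !Cmod_sqr. destruct z, w; simpl. ring. Qed.

Lemma Re_le_Cmod (z : C) : Re z <= Cmod z.
Proof. pose proof (re_le_Cmod z). pose proof (Rle_abs (Re z)). lra. Qed.

Lemma Im_le_Cmod (z : C) : Rabs (Im z) <= Cmod z.
Proof.
  eapply Rle_trans; [apply Rmax_r | apply Rmax_Cmod].
Qed.

Lemma Cmod_le_Re_Im (z : C) : Cmod z <= Rabs (Re z) + Rabs (Im z).
Proof.
  apply Rsqr_incr_0; [|apply Cmod_ge_0|].
  - rewrite !Rsqr_pow2, Cmod_sqr. unfold Re, Im.
    pose proof (Rabs_pos (fst z)). pose proof (Rabs_pos (snd z)).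
    rewrite <- (pow2_abs (fst z)), <- (pow2_abs (snd z)). nra.
  - pose proof (Rabs_pos (Re z)). pose proof (Rabs_pos (Im z)). lra.
Qed.

Lemma Cmod_Rpos (x : R) : 0 <= x -> Cmod (RtoC x) = x.
Proof. intros H. rewrite Cmod_R. now apply Rabs_pos_eq. Qed.

Lemma RtoC_INR_S (n : nat) : RtoC (INR (S n)) = (RtoC (INR n) + 1)%C.
Proof. rewrite S_INR, RtoC_plus. reflexivity. Qed.

(** * Absolutely convergent complex series *)

Lemma ex_series_Rmult (c : R) (a : nat -> R) :
  ex_series a -> ex_series (fun n => c * a n).
Proof. exact (ex_series_scal (K := R_AbsRing) (V := R_NormedModule) c a). Qed.

Lemma ex_series_Rle (a b : nat -> R) :
  (forall n, Rabs (a n) <= b n) -> ex_series b -> ex_series a.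
Proof. exact (ex_series_le (K := R_AbsRing) (V := R_CompleteNormedModule) a b). Qed.

Definition Csummable (u : nat -> C) : Prop := ex_series (fun n => Cmod (u n)).

Definition Csum (u : nat -> C) : C :=
  (Series (fun n => Re (u n)), Series (fun n => Im (u n))).

Lemma Csummable_le (u : nat -> C) (b : nat -> R) :
  (forall n, Cmod (u n) <= b n) -> ex_series b -> Csummable u.
Proof.
  intros H Hb. apply ex_series_Rle with (b := b); [|exact Hb].
  intros n. rewrite Rabs_pos_eq; [apply H | apply Cmod_ge_0].
Qed.

Lemma Csummable_Re (u : nat -> C) : Csummable u -> ex_series (fun n => Re (u n)).
Proof.
  intros H. apply ex_series_Rle with (b := fun n => Cmod (u n)); [|exact H].
  intros n. apply re_le_Cmod.
Qed.

Lemma Csummable_Im (u : nat -> C) : Csummable u -> ex_series (fun n => Im (u n)).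
Proof.
  intros H. apply ex_series_Rle with (b := fun n => Cmod (u n)); [|exact H].
  intros n. apply Im_le_Cmod.
Qed.

Lemma Csummable_ext (u v : nat -> C) :
  (forall n, u n = v n) -> Csummable u -> Csummable v.
Proof. intros H. apply ex_series_ext. intros n. now rewrite H. Qed.

Lemma Csum_ext (u v : nat -> C) : (forall n, u n = v n) -> Csum u = Csum v.
Proof.
  intros H. unfold Csum. f_equal; apply Series_ext; intros n; now rewrite H.
Qed.

Lemma Csummable_plus (u v : nat -> C) :
  Csummable u -> Csummable v -> Csummable (fun n => u n + v n)%C.
Proof.
  intros Hu Hv. apply Csummable_le with (b := fun n => Cmod (u n) + Cmod (v n)).
  - intros n. apply Cmod_triangle.
  - exact (ex_series_plus _ _ Hu Hv).
Qed.

Lemma Csummable_scal (c : C) (u : nat -> C) :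
  Csummable u -> Csummable (fun n => c * u n)%C.
Proof.
  intros Hu. apply Csummable_le with (b := fun n => Cmod c * Cmod (u n)).
  - intros n. rewrite Cmod_mult. lra.
  - exact (ex_series_Rmult (Cmod c) _ Hu).
Qed.

Lemma Csum_plus (u v : nat -> C) :
  Csummable u -> Csummable v -> Csum (fun n => u n + v n)%C = (Csum u + Csum v)%C.
Proof.
  intros Hu Hv. unfold Csum, Cplus; simpl. f_equal.
  - rewrite <- Series_plus by now apply Csummable_Re. reflexivity.
  - rewrite <- Series_plus by now apply Csummable_Im. reflexivity.
Qed.

Lemma Csum_scal (c : C) (u : nat -> C) :
  Csummable u -> Csum (fun n => c * u n)%C = (c * Csum u)%C.
Proof.
  intros Hu. pose proof (Csummable_Re _ Hu) as H1. pose proof (Csummable_Im _ Hu) as H2.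
  unfold Csum, Cmult; simpl. f_equal.
  - rewrite <- !Series_scal_l, <- Series_minus; [reflexivity| |];
      apply ex_series_Rmult; assumption.
  - rewrite <- !Series_scal_l, <- Series_plus; [reflexivity| |];
      apply ex_series_Rmult; assumption.
Qed.

Lemma Csum_minus (u v : nat -> C) :
  Csummable u -> Csummable v -> Csum (fun n => u n - v n)%C = (Csum u - Csum v)%C.
Proof.
  intros Hu Hv.
  rewrite (Csum_ext _ (fun n => u n + (-1) * v n)%C) by (intros; ring).
  rewrite Csum_plus, Csum_scal; auto using Csummable_scal. ring.
Qed.

Lemma Csummable_minus (u v : nat -> C) :
  Csummable u -> Csummable v -> Csummable (fun n => u n - v n)%C.
Proof.
  intros Hu Hv. apply (Csummable_ext (fun n => u n + (-1) * v n)%C); [intros; ring|].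
  auto using Csummable_plus, Csummable_scal.
Qed.

Lemma Csummable_incr_1 (u : nat -> C) :
  Csummable u -> Csummable (fun n => u (S n)).
Proof. intros H. now apply (ex_series_incr_1 (K := R_AbsRing)) in H. Qed.

Lemma Csum_incr_1 (u : nat -> C) :
  Csummable u -> Csum u = (u O + Csum (fun n => u (S n)))%C.
Proof.
  intros Hu. unfold Csum, Cplus; simpl. f_equal.
  - now rewrite Series_incr_1 by now apply Csummable_Re.
  - now rewrite Series_incr_1 by now apply Csummable_Im.
Qed.

Lemma Series_nonneg (a : nat -> R) : (forall n, 0 <= a n) -> ex_series a -> 0 <= Series a.
Proof.
  intros H Ha. rewrite <- (Rmult_0_l (Series a)), <- Series_scal_l.
  apply Series_le; [|exact Ha]. intros n. specialize (H n). lra.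
Qed.

(* Pairing the sum with its own conjugate reduces the claim to real series. *)
Lemma Cmod_Csum_le (u : nat -> C) :
  Csummable u -> Cmod (Csum u) <= Series (fun n => Cmod (u n)).
Proof.
  intros Hu. set (w := Csum u).
  destruct (Req_dec (Cmod w) 0) as [H0|H0].
  - rewrite H0. apply Series_nonneg; [intros; apply Cmod_ge_0|exact Hu].
  - pose proof (Cmod_ge_0 w).
    assert (Hs : Cmod w ^ 2 = Series (fun n => Re (Cconj w * u n)%C)).
    { assert (E : (Cconj w * w)%C = Csum (fun n => Cconj w * u n)%C)
        by (now rewrite Csum_scal).
      transitivity (Re (Cconj w * w)%C).
      - rewrite Cmod_sqr. destruct w; simpl. ring.
      - now rewrite E. }
    assert (Hle : Cmod w ^ 2 <= Cmod w * Series (fun n => Cmod (u n))).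
    { rewrite Hs at 1. rewrite <- Series_scal_l.
      eapply Rle_trans; [apply Rle_abs|].
      eapply Rle_trans; [apply Series_Rabs|apply Series_le].
      - apply ex_series_Rle with (b := fun n => Cmod (Cconj w * u n)%C).
        + intros n. rewrite Rabs_Rabsolu. apply re_le_Cmod.
        + now apply Csummable_scal.
      - intros n. split; [apply Rabs_pos|].
        rewrite <- (Cmod_conj w), <- Cmod_mult. apply re_le_Cmod.
      - exact (ex_series_Rmult (Cmod w) _ Hu). }
    nra.
Qed.

Lemma Cmod_Csum_bound (u : nat -> C) (b : nat -> R) :
  (forall n, Cmod (u n) <= b n) -> ex_series b -> Cmod (Csum u) <= Series b.
Proof.
  intros H Hb. eapply Rle_trans; [apply Cmod_Csum_le; eapply Csummable_le; eauto|].
  apply Series_le; [|exact Hb]. intros n. split; [apply Cmod_ge_0|apply H].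
Qed.

(** * Power series on the unit disk *)

(** Radius of convergence at least 1, stated as boundedness of |a_n| rho^n: this form survives
    shifts, differentiation and division by z - z0. *)
Definition disk_coef (a : nat -> C) : Prop :=
  forall rho, 0 <= rho < 1 -> exists M, forall n, Cmod (a n) * rho ^ n <= M.

Definition psf (a : nat -> C) (z : C) : C := Csum (fun n => a n * z ^ n)%C.

Definition dcoef (a : nat -> C) (n : nat) : C := (RtoC (INR (S n)) * a (S n))%C.

(** Boundedness at the larger radius (1 + r) / 2 dominates the terms at radius r by a geometric
    series of ratio 2 r / (1 + r) < 1. *)
Lemma disk_coef_ex_series (a : nat -> C) (r : R) :
  disk_coef a -> 0 <= r < 1 -> ex_series (fun n => Cmod (a n) * r ^ n).
Proof.
  intros Ha Hr. destruct (Ha ((1 + r) / 2)) as [M HM]; [lra|].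
  apply ex_series_Rle with (b := fun n => M * (2 * r / (1 + r)) ^ n).
  - intros n. rewrite Rabs_pos_eq by (apply Rmult_le_pos; [apply Cmod_ge_0|apply pow_le; lra]).
    replace (Cmod (a n) * r ^ n)
      with (Cmod (a n) * ((1 + r) / 2) ^ n * (2 * r / (1 + r)) ^ n).
    + apply Rmult_le_compat_r; [|apply HM]. apply pow_le.
      apply Rdiv_le_0_compat; lra.
    + rewrite Rmult_assoc, <- Rpow_mult_distr. f_equal. f_equal. field. lra.
  - apply ex_series_Rmult. apply ex_series_geom.
    rewrite Rabs_pos_eq by (apply Rdiv_le_0_compat; lra).
    apply Rmult_lt_reg_r with (1 + r); [lra|]. field_simplify; lra.
Qed.

Lemma Cmod_term_le (a : nat -> C) (z : C) (r : R) (n : nat) :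
  Cmod z <= r -> Cmod (a n * z ^ n)%C <= Cmod (a n) * r ^ n.
Proof.
  intros H. rewrite Cmod_mult, Cmod_pow. apply Rmult_le_compat_l; [apply Cmod_ge_0|].
  apply pow_incr. split; [apply Cmod_ge_0|exact H].
Qed.

Lemma psf_summable (a : nat -> C) (z : C) :
  disk_coef a -> Cmod z < 1 -> Csummable (fun n => a n * z ^ n)%C.
Proof.
  intros Ha Hz. apply Csummable_le with (b := fun n => Cmod (a n) * Cmod z ^ n).
  - intros n. apply Cmod_term_le. lra.
  - apply disk_coef_ex_series; [exact Ha|]. split; [apply Cmod_ge_0|exact Hz].
Qed.

Lemma psf_bounded (a : nat -> C) (r : R) :
  disk_coef a -> 0 <= r < 1 ->
  exists B, 0 <= B /\ forall z, Cmod z <= r -> Cmod (psf a z) <= B.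
Proof.
  intros Ha Hr. exists (Series (fun n => Cmod (a n) * r ^ n)).
  assert (H : forall z, Cmod z <= r ->
    Cmod (psf a z) <= Series (fun n => Cmod (a n) * r ^ n)).
  { intros z Hz. apply Cmod_Csum_bound; [|now apply disk_coef_ex_series].
    intros n. now apply Cmod_term_le. }
  split; [|exact H].
  eapply Rle_trans; [apply Cmod_ge_0|apply (H (RtoC 0))].
  rewrite Cmod_0. lra.
Qed.

Lemma psf_plus (a b : nat -> C) (z : C) :
  disk_coef a -> disk_coef b -> Cmod z < 1 ->
  psf (fun n => a n + b n)%C z = (psf a z + psf b z)%C.
Proof.
  intros Ha Hb Hz. unfold psf. rewrite <- Csum_plus; auto using psf_summable.
  apply Csum_ext. intros n. ring.
Qed.

Lemma psf_scal (c : C) (a : nat -> C) (z : C) :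
  disk_coef a -> Cmod z < 1 -> psf (fun n => c * a n)%C z = (c * psf a z)%C.
Proof.
  intros Ha Hz. unfold psf. rewrite <- Csum_scal; auto using psf_summable.
  apply Csum_ext. intros n. ring.
Qed.

Lemma psf_ext (a b : nat -> C) (z : C) :
  (forall n, a n = b n) -> psf a z = psf b z.
Proof. intros H. apply Csum_ext. intros n. now rewrite H. Qed.

Lemma psf_incr (a : nat -> C) (z : C) :
  disk_coef a -> Cmod z < 1 ->
  psf a z = (a O + z * psf (fun n => a (S n)) z)%C.
Proof.
  intros Ha Hz. unfold psf. pose proof (psf_summable a z Ha Hz) as Hs.
  rewrite Csum_incr_1 by assumption. simpl. rewrite Cmult_1_r. f_equal.
  (* Away from 0, summability of the tail comes from dividing the original series by z; at z = 0
     both sides vanish. *)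
  destruct (Ceq_dec z 0) as [->|Hz0].
  - rewrite Cmult_0_l. rewrite (Csum_ext _ (fun n => 0 * (a n * 0 ^ n))%C)
      by (intros; ring).
    rewrite Csum_scal by assumption. ring.
  - assert (Hs' : Csummable (fun n => a (S n) * z ^ n)%C).
    { apply (Csummable_ext (fun n => / z * (a (S n) * z ^ (S n)))%C).
      - intros n. simpl. field. exact Hz0.
      - apply Csummable_scal. exact (Csummable_incr_1 _ Hs). }
    rewrite <- Csum_scal by assumption. apply Csum_ext. intros n. ring.
Qed.

Lemma psf_0 (a : nat -> C) : disk_coef a -> psf a 0 = a O.
Proof.
  intros Ha. rewrite psf_incr; [ring|assumption|]. rewrite Cmod_0. lra.
Qed.

Lemma disk_coef_plus (a b : nat -> C) :
  disk_coef a -> disk_coef b -> disk_coef (fun n => a n + b n)%C.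
Proof.
  intros Ha Hb rho Hr. destruct (Ha rho Hr) as [M HM], (Hb rho Hr) as [N HN].
  exists (M + N). intros n. pose proof (Cmod_triangle (a n) (b n)).
  assert (0 <= rho ^ n) by (apply pow_le; lra). specialize (HM n). specialize (HN n).
  nra.
Qed.

Lemma disk_coef_le (a b : nat -> C) (K : R) :
  (forall n, Cmod (b n) <= K * Cmod (a n)) -> 0 <= K -> disk_coef a -> disk_coef b.
Proof.
  intros H HK Ha rho Hr. destruct (Ha rho Hr) as [M HM]. exists (K * M). intros n.
  assert (0 <= rho ^ n) by (apply pow_le; lra). specialize (HM n). specialize (H n).
  apply Rle_trans with (K * (Cmod (a n) * rho ^ n)); nra.
Qed.

Lemma disk_coef_scal (c : C) (a : nat -> C) :
  disk_coef a -> disk_coef (fun n => c * a n)%C.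
Proof.
  apply (disk_coef_le _ _ (Cmod c)); [|apply Cmod_ge_0].
  intros n. rewrite Cmod_mult. lra.
Qed.

Lemma disk_coef_incr (a : nat -> C) : disk_coef a -> disk_coef (fun n => a (S n)).
Proof.
  intros Ha rho Hr. destruct (Ha ((1 + rho) / 2)) as [M HM]; [lra|].
  exists (M * / ((1 + rho) / 2)). intros n.
  apply Rle_trans with (Cmod (a (S n)) * ((1 + rho) / 2) ^ n).
  - apply Rmult_le_compat_l; [apply Cmod_ge_0|]. apply pow_incr. lra.
  - specialize (HM (S n)). simpl in HM.
    apply Rmult_le_reg_r with ((1 + rho) / 2); [lra|].
    rewrite (Rmult_assoc M), Rinv_l by lra. nra.
Qed.

(** There are n + 1 terms, each at least x^n, in 1 + x + ... + x^n = (1 - x^(n+1)) / (1 - x). *)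
Lemma mult_pow_bounded (x : R) (n : nat) : 0 <= x < 1 -> INR (S n) * x ^ n <= / (1 - x).
Proof.
  intros Hx. assert (H : INR (S n) * x ^ n * (1 - x) <= 1 - x ^ (S n)).
  { induction n as [|n IH]; [simpl; lra|].
    rewrite S_INR. simpl pow in *.
    assert (0 <= x ^ n) by (apply pow_le; lra).
    assert (0 <= INR (S n)) by apply pos_INR.
    assert (x * (INR (S n) * x ^ n * (1 - x)) <= x * (1 - x * x ^ n))
      by (apply Rmult_le_compat_l; lra).
    assert (x * x ^ n <= 1).
    { rewrite <- (pow1 (S n)). apply (pow_incr x 1 (S n)). lra. }
    nra. }
  assert (0 <= x ^ S n) by (apply pow_le; lra).
  apply Rmult_le_reg_r with (1 - x); [lra|]. rewrite Rinv_l by lra. lra.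
Qed.

(** Write rho = r x with r = (1 + rho) / 2: the bound for [a] absorbs r^n, and x^n with x < 1
    absorbs the new factor n + 1. *)
Lemma disk_coef_dcoef (a : nat -> C) : disk_coef a -> disk_coef (dcoef a).
Proof.
  intros Ha rho Hr. destruct (disk_coef_incr a Ha ((1 + rho) / 2)) as [M HM]; [lra|].
  exists (M * / (1 - rho / ((1 + rho) / 2))). intros n. unfold dcoef.
  rewrite Cmod_mult, Cmod_Rpos by apply pos_INR.
  assert (Hx : 0 <= rho / ((1 + rho) / 2) < 1).
  { split; [apply Rdiv_le_0_compat; lra|].
    apply Rlt_div_l; lra. }
  pose proof (mult_pow_bounded _ n Hx) as H. specialize (HM n).
  set (x := rho / ((1 + rho) / 2)) in *.
  replace rho with (((1 + rho) / 2) * x) at 1 by (unfold x; field; lra).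
  rewrite Rpow_mult_distr.
  replace (INR (S n) * Cmod (a (S n)) * (((1 + rho) / 2) ^ n * x ^ n))
    with ((Cmod (a (S n)) * ((1 + rho) / 2) ^ n) * (INR (S n) * x ^ n)) by ring.
  apply Rmult_le_compat; [| |exact HM|exact H].
  - apply Rmult_le_pos; [apply Cmod_ge_0|apply pow_le; lra].
  - apply Rmult_le_pos; [apply pos_INR|apply pow_le; lra].
Qed.

(** The remainder t_n at exponent n + 2 satisfies t_{n+1} = (z + h) t_n + (n + 2) z^(n+1) h^2. The
    constant is twice the sharp one, but it is exactly the factor produced by two differentiations,
    which makes it summable against [a]. *)
Lemma Cpow_taylor2 (z h : C) (r : R) (n : nat) :
  Cmod z <= r -> Cmod (z + h)%C <= r ->
  Cmod ((z + h) ^ S (S n) - z ^ S (S n) - RtoC (INR (S (S n))) * z ^ S n * h)%C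
    <= INR (S (S n)) * INR (S n) * r ^ n * Cmod h ^ 2.
Proof.
  intros Hz Hzh. pose proof (Cmod_ge_0 z).
  induction n as [|n IH].
  - replace ((z + h) ^ 2 - z ^ 2 - INR 2 * z ^ 1 * h)%C with (h ^ 2)%C
      by (rewrite !RtoC_INR_S; simpl; ring).
    rewrite Cmod_pow. simpl. pose proof (Cmod_ge_0 h). nra.
  - set (t := ((z + h) ^ S (S n) - z ^ S (S n) - RtoC (INR (S (S n))) * z ^ S n * h)%C) in *.
    replace ((z + h) ^ S (S (S n)) - z ^ S (S (S n)) - INR (S (S (S n))) * z ^ S (S n) * h)%C
      with ((z + h) * t + RtoC (INR (S (S n))) * z ^ S n * (h * h))%C.
    2:{ unfold t. rewrite (RtoC_INR_S (S (S n))). rewrite !(Cpow_S (z + h)), !(Cpow_S z). ring. }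
    eapply Rle_trans; [apply Cmod_triangle|].
    rewrite !Cmod_mult, Cmod_pow, Cmod_Rpos by apply pos_INR.
    assert (Hp : Cmod z ^ S n <= r ^ S n) by (apply pow_incr; lra).
    pose proof (Cmod_ge_0 t). pose proof (Cmod_ge_0 (z + h)%C).
    pose proof (pos_INR n). rewrite !S_INR in *.
    assert (0 <= r ^ n) by (apply pow_le; lra).
    assert (H5 : Cmod (z + h)%C * Cmod t <= r * ((INR n + 1 + 1) * (INR n + 1) * r ^ n * Cmod h ^ 2))
      by (apply Rmult_le_compat; auto).
    assert (H6 : (INR n + 1 + 1) * Cmod z ^ S n * (Cmod h * Cmod h)
       <= (INR n + 1 + 1) * r ^ S n * (Cmod h * Cmod h)).
    { apply Rmult_le_compat_r; [nra|]. apply Rmult_le_compat_l; lra. }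
    simpl pow in *.
    assert (0 <= r * r ^ n * (Cmod h * Cmod h)) by (apply Rmult_le_pos; nra).
    nra.
Qed.

Lemma psf_taylor2 (a : nat -> C) (r : R) :
  disk_coef a -> 0 <= r < 1 ->
  exists K, 0 <= K /\ forall z h, Cmod z <= r -> Cmod (z + h)%C <= r ->
    Cmod (psf a (z + h) - psf a z - psf (dcoef a) z * h)%C <= K * Cmod h ^ 2.
Proof.
  intros Ha Hr.
  pose proof (disk_coef_ex_series _ r
    (disk_coef_dcoef _ (disk_coef_dcoef _ Ha)) Hr) as Hex.
  exists (Series (fun n => Cmod (dcoef (dcoef a) n) * r ^ n)).
  split.
  { apply Series_nonneg; [|exact Hex]. intros n.
    apply Rmult_le_pos; [apply Cmod_ge_0|apply pow_le; lra]. }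
  intros z h Hz Hzh.
  assert (Hz1 : Cmod z < 1) by lra. assert (Hzh1 : Cmod (z + h)%C < 1) by lra.
  pose proof (psf_summable a z Ha Hz1) as S1.
  pose proof (psf_summable a _ Ha Hzh1) as S2.
  pose proof (psf_summable _ z (disk_coef_dcoef _ Ha) Hz1) as S3.
  (* The orders 0 and 1 contribute nothing to the remainder, so the sum starts at exponent 2. *)
  assert (E : (psf a (z + h) - psf a z - psf (dcoef a) z * h)%C
    = Csum (fun n => a (S (S n)) * ((z + h) ^ S (S n) - z ^ S (S n)
          - RtoC (INR (S (S n))) * z ^ S n * h))%C).
  { unfold psf.
    rewrite (Csum_incr_1 _ S1), (Csum_incr_1 _ S2), (Csum_incr_1 _ S3).
    rewrite (Csum_incr_1 _ (Csummable_incr_1 _ S1)), (Csum_incr_1 _ (Csummable_incr_1 _ S2)).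
    apply Csummable_incr_1 in S1. apply Csummable_incr_1 in S1.
    apply Csummable_incr_1 in S2. apply Csummable_incr_1 in S2.
    apply Csummable_incr_1 in S3.
    symmetry. rewrite (Csum_ext _ (fun n => (a (S (S n)) * (z + h) ^ S (S n)
       - a (S (S n)) * z ^ S (S n)) - h * (dcoef a (S n) * z ^ S n))%C)
      by (intros n; unfold dcoef; ring).
    rewrite Csum_minus, Csum_minus, Csum_scal; auto using Csummable_minus, Csummable_scal.
    unfold dcoef. simpl. ring. }
  rewrite E, Rmult_comm, <- Series_scal_l.
  apply Cmod_Csum_bound; [|exact (ex_series_Rmult (Cmod h ^ 2) _ Hex)].
  intros n. unfold dcoef. rewrite !Cmod_mult, !Cmod_Rpos by apply pos_INR.
  pose proof (Cpow_taylor2 z h r n Hz Hzh) as H.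
  pose proof (Cmod_ge_0 (a (S (S n)))).
  eapply Rle_trans; [apply Rmult_le_compat_l; [assumption|exact H]|].
  right. ring.
Qed.

Lemma psf_lipschitz (a : nat -> C) (r : R) :
  disk_coef a -> 0 <= r < 1 ->
  exists L, 0 <= L /\ forall z w, Cmod z <= r -> Cmod w <= r ->
    Cmod (psf a z - psf a w)%C <= L * Cmod (z - w)%C.
Proof.
  intros Ha Hr. destruct (psf_taylor2 a r Ha Hr) as [K [HK0 HK]].
  destruct (psf_bounded _ r (disk_coef_dcoef _ Ha) Hr) as [B [HB0 HB]].
  exists (B + K * 2). split; [lra|]. intros z w Hz Hw.
  specialize (HK w (z - w)%C Hw). specialize (HB w Hw).
  replace (w + (z - w))%C with z in HK by ring. specialize (HK Hz).
  replace (psf a z - psf a w)%C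
    with ((psf a z - psf a w - psf (dcoef a) w * (z - w)) + psf (dcoef a) w * (z - w))%C
    by ring.
  eapply Rle_trans; [apply Cmod_triangle|]. rewrite (Cmod_mult (psf _ _)).
  pose proof (Cmod_sub_triangle z w). pose proof (Cmod_ge_0 (z - w)%C).
  assert (K * Cmod (z - w)%C ^ 2 <= K * (2 * Cmod (z - w)%C)) by
    (apply Rmult_le_compat_l; nra).
  nra.
Qed.

(** * Complex derivatives *)

(** Division-free, so that h = 0 needs no exclusion; [f] is an arbitrary total function because the
    subordinating map is only a pointwise choice. *)
Definition cderiv (f : C -> C) (z l : C) : Prop :=
  forall eps, 0 < eps -> exists del, 0 < del /\ forall h, Cmod h < del ->
    Cmod (f (z + h) - f z - l * h)%C <= eps * Cmod h.

Lemma psf_cderiv (a : nat -> C) (z : C) :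
  disk_coef a -> Cmod z < 1 -> cderiv (psf a) z (psf (dcoef a) z).
Proof.
  intros Ha Hz eps He. pose proof (Cmod_ge_0 z).
  destruct (psf_taylor2 a ((1 + Cmod z) / 2) Ha) as [K [HK0 HK]]; [lra|].
  exists (Rmin ((1 - Cmod z) / 2) (eps / (K + 1))). split.
  - apply Rmin_pos; [lra|]. apply Rdiv_lt_0_compat; lra.
  - intros h Hh. pose proof (Rmin_l ((1 - Cmod z) / 2) (eps / (K + 1))).
    pose proof (Rmin_r ((1 - Cmod z) / 2) (eps / (K + 1))).
    pose proof (Cmod_triangle z h). pose proof (Cmod_ge_0 h).
    eapply Rle_trans; [apply HK; lra|].
    assert (K * Cmod h <= eps).
    { apply Rle_trans with ((K + 1) * (eps / (K + 1))); [nra|].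
      right. field. lra. }
    nra.
Qed.

Lemma cderiv_local_lipschitz (f : C -> C) (z l : C) :
  cderiv f z l -> exists del, 0 < del /\ forall h, Cmod h < del ->
    Cmod (f (z + h) - f z)%C <= (Cmod l + 1) * Cmod h.
Proof.
  intros H. destruct (H 1 Rlt_0_1) as [d [Hd H1]]. exists d. split; [exact Hd|].
  intros h Hh. specialize (H1 h Hh).
  replace (f (z + h) - f z)%C with ((f (z + h) - f z - l * h) + l * h)%C by ring.
  eapply Rle_trans; [apply Cmod_triangle|]. rewrite (Cmod_mult l). lra.
Qed.

Definition ccont (f : C -> C) (z : C) : Prop :=
  forall eps, 0 < eps -> exists del, 0 < del /\ forall h, Cmod h < del ->
    Cmod (f (z + h) - f z)%C < eps.

Lemma cderiv_ccont (f : C -> C) (z l : C) : cderiv f z l -> ccont f z.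
Proof.
  intros H eps He. destruct (cderiv_local_lipschitz f z l H) as [d [Hd H1]].
  pose proof (Cmod_ge_0 l).
  exists (Rmin d (eps / (Cmod l + 2))). split.
  - apply Rmin_pos; [lra|]. apply Rdiv_lt_0_compat; lra.
  - intros h Hh. pose proof (Rmin_l d (eps / (Cmod l + 2))).
    pose proof (Rmin_r d (eps / (Cmod l + 2))).
    eapply Rle_lt_trans; [apply H1; lra|]. pose proof (Cmod_ge_0 h).
    assert ((Cmod l + 2) * Cmod h < eps).
    { apply Rlt_le_trans with ((Cmod l + 2) * (eps / (Cmod l + 2))); [nra|].
      right. field. lra. }
    nra.
Qed.

Lemma common_radius (d1 d2 : R) (P : C -> Prop) :
  0 < d1 -> 0 < d2 -> (forall h, Cmod h < d1 -> Cmod h < d2 -> P h) ->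
  exists del, 0 < del /\ forall h, Cmod h < del -> P h.
Proof.
  intros H1 H2 H. exists (Rmin d1 d2). split; [now apply Rmin_pos|]. intros h Hh.
  pose proof (Rmin_l d1 d2). pose proof (Rmin_r d1 d2). apply H; lra.
Qed.

Lemma ccont_plus (f g : C -> C) (z : C) :
  ccont f z -> ccont g z -> ccont (fun w => f w + g w)%C z.
Proof.
  intros Hf Hg eps He. destruct (Hf (eps / 2)) as [d1 [Hd1 H1]]; [lra|].
  destruct (Hg (eps / 2)) as [d2 [Hd2 H2]]; [lra|].
  apply (common_radius d1 d2); [assumption|assumption|]. intros h Hh1 Hh2.
  replace (f (z + h) + g (z + h) - (f z + g z))%C
    with ((f (z + h) - f z) + (g (z + h) - g z))%C by ring.
  eapply Rle_lt_trans; [apply Cmod_triangle|].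
  specialize (H1 h ltac:(lra)). specialize (H2 h ltac:(lra)). lra.
Qed.

Lemma ccont_mult (f g : C -> C) (z : C) :
  ccont f z -> ccont g z -> ccont (fun w => f w * g w)%C z.
Proof.
  intros Hf Hg eps He. pose proof (Cmod_ge_0 (f z)). pose proof (Cmod_ge_0 (g z)).
  set (K := Cmod (f z) + Cmod (g z) + 1).
  assert (Hq : 0 < Rmin 1 (eps / (2 * K))).
  { apply Rmin_pos; [lra|]. apply Rdiv_lt_0_compat; unfold K; lra. }
  destruct (Hf _ Hq) as [d1 [Hd1 H1]]. destruct (Hg _ Hq) as [d2 [Hd2 H2]].
  apply (common_radius d1 d2); [assumption|assumption|]. intros h Hh1 Hh2.
  specialize (H1 h ltac:(lra)). specialize (H2 h ltac:(lra)).
  set (q := Rmin 1 (eps / (2 * K))) in *.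
  assert (q <= 1) by apply Rmin_l. assert (Hq2 : q <= eps / (2 * K)) by apply Rmin_r.
  replace (f (z + h) * g (z + h) - f z * g z)%C
    with ((f (z + h) - f z) * (g (z + h) - g z)
          + ((f (z + h) - f z) * g z + f z * (g (z + h) - g z)))%C by ring.
  eapply Rle_lt_trans; [apply Cmod_triangle|].
  eapply Rle_lt_trans; [apply Rplus_le_compat_l, Cmod_triangle|].
  rewrite !Cmod_mult.
  pose proof (Cmod_ge_0 (f (z + h) - f z)%C). pose proof (Cmod_ge_0 (g (z + h) - g z)%C).
  assert (q * K <= eps / 2).
  { apply Rle_trans with (eps / (2 * K) * K); [unfold K in *; nra|]. right. field.
    unfold K; lra. }
  unfold K in *. nra.
Qed.

Lemma ccont_const (c z : C) : ccont (fun _ => c) z.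
Proof.
  intros eps He. exists 1. split; [lra|]. intros h _.
  replace (c - c)%C with (RtoC 0) by ring. rewrite Cmod_0. exact He.
Qed.

Lemma ccont_id (z : C) : ccont (fun w => w) z.
Proof.
  intros eps He. exists eps. split; [exact He|]. intros h Hh.
  now replace (z + h - z)%C with h by ring.
Qed.

(* Caratheodory's form of differentiability turns the rules into rules for [ccont]. *)
Definition cslope (f : C -> C) (z l : C) (h : C) : C :=
  if Ceq_dec h 0 then l else ((f (z + h) - f z) / h)%C.

Lemma cderiv_cslope (f : C -> C) (z l : C) :
  cderiv f z l <-> ccont (cslope f z l) 0.
Proof.
  unfold ccont, cslope. split; intros H eps He.
  - destruct (H (eps / 2)) as [d [Hd H1]]; [lra|]. exists d. split; [exact Hd|].
    intros h Hh. rewrite Cplus_0_l. destruct (Ceq_dec 0 0) as [_|]; [|congruence].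
    destruct (Ceq_dec h 0) as [|Hh0].
    + replace (l - l)%C with (RtoC 0) by ring. rewrite Cmod_0. exact He.
    + replace ((f (z + h) - f z) / h - l)%C with ((f (z + h) - f z - l * h) / h)%C
        by (field; exact Hh0).
      rewrite Cmod_div by exact Hh0. apply Cmod_gt_0 in Hh0. specialize (H1 h Hh).
      apply Rle_lt_trans with (eps / 2); [|lra].
      apply Rle_div_l; lra.
  - destruct (H eps He) as [d [Hd H1]]. exists d. split; [exact Hd|].
    intros h Hh. specialize (H1 h Hh). rewrite Cplus_0_l in H1.
    destruct (Ceq_dec 0 0) as [_|]; [|congruence].
    destruct (Ceq_dec h 0) as [->|Hh0].
    + rewrite Cplus_0_r. replace (f z - f z - l * 0)%C with (RtoC 0) by ring.
      rewrite Cmod_0. lra.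
    + replace (f (z + h) - f z - l * h)%C with (((f (z + h) - f z) / h - l) * h)%C
        by (field; exact Hh0).
      rewrite Cmod_mult. apply Rmult_le_compat_r; [apply Cmod_ge_0|lra].
Qed.

Lemma ccont_ext_loc (f g : C -> C) (z : C) (d : R) :
  0 < d -> (forall h, Cmod h < d -> f (z + h)%C = g (z + h)%C) ->
  ccont f z -> ccont g z.
Proof.
  intros Hd E Hf eps He. destruct (Hf eps He) as [d1 [Hd1 H1]].
  apply (common_radius d d1); [assumption|assumption|]. intros h Hh1 Hh2.
  rewrite <- E by lra. replace (g z) with (f z). { apply H1. lra. }
  rewrite <- (Cplus_0_r z). apply E. rewrite Cmod_0. lra.
Qed.

Lemma ccont_inv (f : C -> C) (z : C) :
  f z <> 0 -> ccont f z -> ccont (fun w => / f w)%C z.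
Proof.
  intros Hz Hf eps He. pose proof (proj1 (Cmod_gt_0 _) Hz) as Hm.
  assert (Hq : 0 < Rmin (Cmod (f z) / 2) (eps * (Cmod (f z)) ^ 2 / 2)).
  { apply Rmin_pos; [lra|]. apply Rdiv_lt_0_compat; [|lra].
    apply Rmult_lt_0_compat; [lra|]. apply pow_lt. lra. }
  destruct (Hf _ Hq) as [d [Hd H1]]. exists d. split; [exact Hd|]. intros h Hh.
  specialize (H1 h Hh).
  pose proof (Rmin_l (Cmod (f z) / 2) (eps * (Cmod (f z)) ^ 2 / 2)).
  pose proof (Rmin_r (Cmod (f z) / 2) (eps * (Cmod (f z)) ^ 2 / 2)).
  pose proof (Cmod_ge_sub (f z) (f (z + h)%C)) as H2. rewrite Cmod_sub_sym in H2.
  assert (Hh0 : f (z + h)%C <> 0) by (apply Cmod_gt_0; lra).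
  replace (/ f (z + h) - / f z)%C with ((f z - f (z + h)) / (f (z + h) * f z))%C
    by (field; auto).
  rewrite Cmod_div by (apply Cmult_neq_0; assumption). rewrite Cmod_mult, Cmod_sub_sym.
  apply Rmult_lt_reg_r with (Cmod (f (z + h)%C) * Cmod (f z)); [nra|].
  unfold Rdiv. rewrite Rmult_assoc, Rinv_l by nra.
  assert (Cmod (f z) / 2 <= Cmod (f (z + h)%C)) by lra.
  assert (eps * (Cmod (f z) / 2 * Cmod (f z)) <= eps * (Cmod (f (z + h)%C) * Cmod (f z)))
    by (apply Rmult_le_compat_l; nra).
  nra.
Qed.

Lemma ccont_shift (f : C -> C) (z : C) : ccont f z -> ccont (fun h => f (z + h)%C) 0.
Proof.
  intros H eps He. destruct (H eps He) as [d [Hd H1]]. exists d. split; [exact Hd|].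
  intros h Hh. rewrite Cplus_0_l, Cplus_0_r. now apply H1.
Qed.

Lemma cderiv_const (c z : C) : cderiv (fun _ => c) z 0.
Proof.
  intros eps He. exists 1. split; [lra|]. intros h _.
  replace (c - c - 0 * h)%C with (RtoC 0) by ring. rewrite Cmod_0.
  pose proof (Cmod_ge_0 h). nra.
Qed.

Lemma cderiv_id (z : C) : cderiv (fun w => w) z 1.
Proof.
  intros eps He. exists 1. split; [lra|]. intros h _.
  replace (z + h - z - 1 * h)%C with (RtoC 0) by ring. rewrite Cmod_0.
  pose proof (Cmod_ge_0 h). nra.
Qed.

Lemma cderiv_eq (f : C -> C) (z l l' : C) : cderiv f z l -> l = l' -> cderiv f z l'.
Proof. now intros H <-. Qed.

Lemma cderiv_ext_loc (f g : C -> C) (z l : C) (d : R) :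
  0 < d -> (forall h, Cmod h < d -> f (z + h)%C = g (z + h)%C) ->
  cderiv f z l -> cderiv g z l.
Proof.
  rewrite !cderiv_cslope. intros Hd E. apply (ccont_ext_loc _ _ _ d Hd). intros h Hh.
  unfold cslope. rewrite Cplus_0_l, E by exact Hh.
  replace (g z) with (f z); [reflexivity|].
  rewrite <- (Cplus_0_r z). apply E. rewrite Cmod_0. exact Hd.
Qed.

Lemma cderiv_mult (f g : C -> C) (z l m : C) :
  cderiv f z l -> cderiv g z m ->
  cderiv (fun w => f w * g w)%C z (l * g z + f z * m)%C.
Proof.
  intros Hf Hg. pose proof (ccont_shift _ _ (cderiv_ccont _ _ _ Hg)) as Cg.
  apply cderiv_cslope in Hf. apply cderiv_cslope in Hg. apply cderiv_cslope.
  pose proof (ccont_plus _ _ _ (ccont_mult _ _ _ Hf Cg)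
    (ccont_mult _ _ _ (ccont_const (f z) 0) Hg)) as H.
  eapply ccont_ext_loc; [apply Rlt_0_1| |exact H].
  intros h _. cbv beta. rewrite !Cplus_0_l.
  destruct (Ceq_dec h 0) as [->|Hh].
  - unfold cslope. destruct (Ceq_dec 0 0) as [_|]; [|congruence]. now rewrite Cplus_0_r.
  - unfold cslope. destruct (Ceq_dec h 0) as [|_]; [congruence|]. field. exact Hh.
Qed.

Lemma cderiv_plus (f g : C -> C) (z l m : C) :
  cderiv f z l -> cderiv g z m -> cderiv (fun w => f w + g w)%C z (l + m)%C.
Proof.
  rewrite !cderiv_cslope. intros Hf Hg.
  eapply ccont_ext_loc; [apply Rlt_0_1| |exact (ccont_plus _ _ _ Hf Hg)].
  intros h _. rewrite Cplus_0_l. unfold cslope. destruct (Ceq_dec h 0) as [|Hh]; [reflexivity|].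
  field. exact Hh.
Qed.

Lemma cderiv_scal (c : C) (f : C -> C) (z l : C) :
  cderiv f z l -> cderiv (fun w => c * f w)%C z (c * l)%C.
Proof.
  intros H. eapply cderiv_eq; [apply (cderiv_mult _ _ _ _ _ (cderiv_const c z) H)|]. ring.
Qed.

Lemma cderiv_minus (f g : C -> C) (z l m : C) :
  cderiv f z l -> cderiv g z m -> cderiv (fun w => f w - g w)%C z (l - m)%C.
Proof.
  intros Hf Hg. apply (cderiv_scal (-1)) in Hg.
  pose proof (cderiv_plus _ _ _ _ _ Hf Hg) as H.
  eapply cderiv_eq; [eapply cderiv_ext_loc; [apply Rlt_0_1| |exact H]|]; intros; simpl; ring.
Qed.

Lemma cderiv_inv (f : C -> C) (z l : C) :
  f z <> 0 -> cderiv f z l -> cderiv (fun w => / f w)%C z (- l / (f z * f z))%C.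
Proof.
  intros Hz Hf. pose proof (cderiv_ccont _ _ _ Hf) as Cf.
  destruct (Cf (Cmod (f z))) as [d [Hd Hne]]; [now apply Cmod_gt_0|].
  assert (Hnz : forall h, Cmod h < d -> f (z + h)%C <> 0).
  { intros h Hh E. specialize (Hne h Hh). rewrite E in Hne.
    replace (0 - f z)%C with (- f z)%C in Hne by ring. rewrite Cmod_opp in Hne. lra. }
  pose proof (ccont_shift _ _ (ccont_inv _ _ Hz Cf)) as Ci'.
  apply cderiv_cslope in Hf. apply cderiv_cslope.
  pose proof (ccont_mult _ _ _ (ccont_mult _ _ _ (ccont_const (- / f z)%C 0) Ci') Hf) as H.
  eapply ccont_ext_loc; [exact Hd| |exact H].
  intros h Hh. cbv beta. rewrite !Cplus_0_l. specialize (Hnz h Hh).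
  unfold cslope. destruct (Ceq_dec h 0) as [->|Hh0].
  - rewrite Cplus_0_r. field. exact Hz.
  - field. auto.
Qed.

Lemma cderiv_div (f g : C -> C) (z l m : C) :
  g z <> 0 -> cderiv f z l -> cderiv g z m ->
  cderiv (fun w => f w / g w)%C z ((l * g z - f z * m) / (g z * g z))%C.
Proof.
  intros Hz Hf Hg. eapply cderiv_eq;
    [apply (cderiv_mult _ _ _ _ _ Hf (cderiv_inv _ _ _ Hz Hg))|].
  field. exact Hz.
Qed.

Lemma ccont_comp (f g : C -> C) (z : C) :
  ccont g z -> ccont f (g z) -> ccont (fun w => f (g w)) z.
Proof.
  intros Hg Hf eps He. destruct (Hf eps He) as [d1 [Hd1 H1]].
  destruct (Hg d1 Hd1) as [d2 [Hd2 H2]]. exists d2. split; [exact Hd2|].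
  intros h Hh. specialize (H1 _ (H2 h Hh)).
  now replace (g z + (g (z + h) - g z))%C with (g (z + h)%C) in H1 by ring.
Qed.

Lemma cderiv_comp (f g : C -> C) (z l m : C) :
  cderiv g z m -> cderiv f (g z) l -> cderiv (fun w => f (g w)) z (l * m)%C.
Proof.
  intros Hg Hf. pose proof (ccont_shift _ _ (cderiv_ccont _ _ _ Hg)) as Cg.
  apply cderiv_cslope in Hg. apply cderiv_cslope in Hf. apply cderiv_cslope.
  set (k := fun h => (g (z + h) + -1 * g z)%C).
  assert (k0 : k 0%C = 0%C) by (unfold k; rewrite Cplus_0_r; ring).
  assert (Ck : ccont (fun h => cslope f (g z) l (k h)) 0).
  { apply (ccont_comp (cslope f (g z) l) k); [|now rewrite k0].
    apply ccont_plus; [exact Cg|apply ccont_const]. }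
  eapply ccont_ext_loc; [apply Rlt_0_1| |exact (ccont_mult _ _ _ Ck Hg)].
  intros h _. cbv beta. rewrite !Cplus_0_l. unfold cslope.
  destruct (Ceq_dec h 0) as [->|Hh].
  - rewrite k0. now destruct (Ceq_dec 0 0).
  - destruct (Ceq_dec (k h) 0) as [E|N].
    + assert (Eg : g (z + h)%C = g z).
      { transitivity (k h + g z)%C; [unfold k|rewrite E]; ring. }
      rewrite Eg. field. exact Hh.
    + replace (g z + k h)%C with (g (z + h)%C) by (unfold k; ring).
      replace (g (z + h) - g z)%C with (k h) by (unfold k; ring). field. auto.
Qed.

(** * Solving equations near a point by contraction *)

Lemma Rle_0_of_geom (x K : R) : (forall n, x <= K * (1 / 2) ^ n) -> x <= 0.
Proof.
  intros H. apply Rnot_lt_le. intros Hx.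
  assert (HK : 0 < K) by (specialize (H O); simpl in H; lra).
  destruct (pow_lt_1_zero (1 / 2)) with (y := x / K) as [N HN].
  - rewrite Rabs_pos_eq; lra.
  - apply Rdiv_lt_0_compat; lra.
  - specialize (HN N (le_n _)). specialize (H N).
    rewrite Rabs_pos_eq in HN by (apply pow_le; lra).
    apply (Rmult_lt_compat_l K) in HN; [|lra].
    replace (K * (x / K)) with x in HN by (field; lra). lra.
Qed.

(** Banach iteration with ratio 1/2. The limit is built as v0 plus the sum of the increments; a
    first increment of at most rho / 2 keeps every iterate in the ball, since rho / 2 + rho / 4 +
    ... <= rho. *)
Lemma contraction_fixpoint (Phi : C -> C) (v0 : C) (rho : R) :
  0 <= rho ->
  (forall v v', Cmod (v - v0)%C <= rho -> Cmod (v' - v0)%C <= rho ->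
     Cmod (Phi v - Phi v')%C <= / 2 * Cmod (v - v')%C) ->
  Cmod (Phi v0 - v0)%C <= rho / 2 ->
  exists v, Cmod (v - v0)%C <= rho /\ Phi v = v.
Proof.
  intros Hrho HL H0.
  set (x := fix x n := match n with O => v0 | S n => Phi (x n) end).
  assert (Hx : forall n, Cmod (x n - v0)%C <= rho * (1 - (1 / 2) ^ n) /\
     Cmod (x (S n) - x n)%C <= rho / 2 * (1 / 2) ^ n).
  { induction n as [|n [IH1 IH2]].
    - simpl. replace (v0 - v0)%C with (RtoC 0) by ring. rewrite Cmod_0. split; lra.
    - assert (Hp : 0 <= (1 / 2) ^ n) by (apply pow_le; lra).
      assert (H1 : Cmod (x (S n) - v0)%C <= rho * (1 - (1 / 2) ^ S n)).
      { replace (x (S n) - v0)%C with ((x (S n) - x n) + (x n - v0))%C by ring.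
        eapply Rle_trans; [apply Cmod_triangle|]. simpl pow. simpl pow in *. lra. }
      split; [exact H1|].
      change (x (S (S n))) with (Phi (x (S n))). change (x (S n)) with (Phi (x n)) at 2.
      eapply Rle_trans; [apply HL|].
      + simpl pow in *. nra.
      + nra.
      + simpl pow. lra. }
  set (d := fun n => (x (S n) - x n)%C).
  assert (Hgeom : forall n, ex_series (fun k => rho / 2 * (1 / 2) ^ n * (1 / 2) ^ k)).
  { intros n. apply ex_series_Rmult, ex_series_geom. rewrite Rabs_pos_eq; lra. }
  assert (Hd : forall n k, Cmod (d (n + k)%nat) <= rho / 2 * (1 / 2) ^ n * (1 / 2) ^ k).
  { intros n k. rewrite Rmult_assoc, <- pow_add. apply Hx. }
  (* T n is the tail of the increments, so x n + T n is the same point for every n and |T n| is the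
     distance from x n to the limit. *)
  set (T := fun n => Csum (fun k => d (n + k)%nat)).
  assert (HT : forall n, Cmod (T n) <= rho * (1 / 2) ^ n).
  { intros n. eapply Rle_trans; [apply Cmod_Csum_bound; [apply Hd|apply Hgeom]|].
    rewrite Series_scal_l, Series_geom by (rewrite Rabs_pos_eq; lra). lra. }
  assert (HxT : forall n, (x n + T n)%C = (v0 + T O)%C).
  { induction n as [|n IH]; [reflexivity|]. rewrite <- IH.
    unfold T at 2. rewrite Csum_incr_1.
    2:{ eapply Csummable_le; [apply Hd|apply Hgeom]. }
    rewrite Nat.add_0_r. rewrite (Csum_ext (fun k => d (n + S k)%nat) (fun k => d (S n + k)%nat))
      by (intros k; f_equal; lia).
    fold (T (S n)). unfold d. ring. }
  set (v := (v0 + T O)%C). exists v.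
  assert (Hv0 : Cmod (v - v0)%C <= rho).
  { unfold v. replace (v0 + T 0%nat - v0)%C with (T O) by ring.
    eapply Rle_trans; [apply HT|]. simpl. lra. }
  split; [exact Hv0|].
  apply Ceq_minus, Cmod_eq_0, Rle_antisym; [|apply Cmod_ge_0].
  apply Rle_0_of_geom with rho. intros n.
  replace (Phi v - v)%C with ((Phi v - Phi (x n)) - T (S n))%C.
  2:{ unfold v. rewrite <- (HxT (S n)). change (x (S n)) with (Phi (x n)). ring. }
  eapply Rle_trans; [apply Cmod_sub_triangle|].
  assert (Hp : 0 <= (1 / 2) ^ n) by (apply pow_le; lra).
  assert (Cmod (Phi v - Phi (x n))%C <= / 2 * Cmod (v - x n)%C).
  { apply HL; [exact Hv0|]. eapply Rle_trans; [apply Hx|]. nra. }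
  assert (Cmod (v - x n)%C <= rho * (1 / 2) ^ n).
  { unfold v. rewrite <- (HxT n). replace (x n + T n - x n)%C with (T n) by ring. apply HT. }
  pose proof (HT (S n)) as H3. simpl pow in H3. lra.
Qed.

(** Newton's iteration with the slope frozen at l: a fixed point of v - (F v - w) / l solves F v =
    w, and the hypothesis on F makes this map a contraction of ratio 1/2. *)
Lemma solve_near (F : C -> C) (v0 l w : C) (rho : R) :
  0 <= rho -> l <> 0 ->
  (forall v v', Cmod (v - v0)%C <= rho -> Cmod (v' - v0)%C <= rho ->
     Cmod (F v - F v' - l * (v - v'))%C <= Cmod l / 2 * Cmod (v - v')%C) ->
  Cmod (w - F v0)%C <= Cmod l * rho / 2 ->
  exists v, Cmod (v - v0)%C <= rho /\ F v = w.
Proof.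
  intros Hrho Hl HF Hw. pose proof (proj1 (Cmod_gt_0 _) Hl) as Hm.
  destruct (contraction_fixpoint (fun v => v - (F v - w) / l)%C v0 rho Hrho) as [v [Hv E]].
  - intros v v' H1 H2.
    replace (v - (F v - w) / l - (v' - (F v' - w) / l))%C
      with (- ((F v - F v' - l * (v - v')) / l))%C by (field; exact Hl).
    rewrite Cmod_opp, Cmod_div by exact Hl.
    apply Rle_div_l; [exact Hm|]. specialize (HF v v' H1 H2). lra.
  - replace (v0 - (F v0 - w) / l - v0)%C with ((w - F v0) / l)%C by (field; exact Hl).
    rewrite Cmod_div by exact Hl.
    apply Rle_div_l; lra.
  - exists v. split; [exact Hv|]. apply Ceq_minus.
    replace (F v - w)%C with (l * (v - (v - (F v - w) / l)))%C by (field; exact Hl).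
    rewrite E. ring.
Qed.

(** * Division of a power series by z - z0 *)

(** Coefficients of (a(z) - a(z0)) / (z - z0): the factor (z^m - z0^m) / (z - z0) contributes
    z0^(m-1-j) to the power z^j. *)
Definition divcoef (z0 : C) (a : nat -> C) (j : nat) : C :=
  psf (fun n => a (S j + n)%nat) z0.

Lemma disk_coef_shift (a : nat -> C) (k : nat) :
  disk_coef a -> disk_coef (fun n => a (k + n)%nat).
Proof.
  intros Ha. induction k as [|k IH]; [exact Ha|].
  apply disk_coef_incr in IH. intros rho Hr. destruct (IH rho Hr) as [M HM].
  exists M. intros n. specialize (HM n). now replace (S k + n)%nat with (k + S n)%nat by lia.
Qed.

Lemma divcoef_rec (z0 : C) (a : nat -> C) (j : nat) :
  disk_coef a -> Cmod z0 < 1 ->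
  divcoef z0 a j = (a (S j) + z0 * divcoef z0 a (S j))%C.
Proof.
  intros Ha Hz. unfold divcoef. rewrite psf_incr by auto using disk_coef_shift.
  rewrite Nat.add_0_r. do 2 f_equal. apply psf_ext. intros n. f_equal. lia.
Qed.

(** The loss is the explicit factor 1 / (rho - |z0|) at an unchanged radius, so that k successive
    divisions cost only its k-th power in [psf_factor]. *)
Lemma divcoef_bound (z0 : C) (a : nat -> C) (rho M : R) :
  Cmod z0 < rho -> rho < 1 -> (forall n, Cmod (a n) * rho ^ n <= M) ->
  forall j, Cmod (divcoef z0 a j) * rho ^ j <= M / (rho - Cmod z0).
Proof.
  intros Hz Hr HM j. pose proof (Cmod_ge_0 z0).
  assert (Hq : 0 <= Cmod z0 / rho < 1).
  { split; [apply Rdiv_le_0_compat; lra|].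
    apply Rlt_div_l; lra. }
  assert (Hrj : 0 < rho ^ j) by (apply pow_lt; lra).
  apply Rmult_le_reg_r with (/ rho ^ j); [now apply Rinv_0_lt_compat|].
  rewrite Rmult_assoc, Rinv_r, Rmult_1_r by lra.
  eapply Rle_trans.
  - apply Cmod_Csum_bound with (b := fun n => M * / rho ^ S j * (Cmod z0 / rho) ^ n).
    + intros n. rewrite Cmod_mult, Cmod_pow. specialize (HM (S j + n)%nat).
      assert (0 < rho ^ (S j + n)) by (apply pow_lt; lra).
      replace (M * / rho ^ S j * (Cmod z0 / rho) ^ n)
        with (M * / rho ^ (S j + n) * Cmod z0 ^ n).
      * apply Rmult_le_compat_r; [apply pow_le; lra|].
        apply Rmult_le_reg_r with (rho ^ (S j + n)); [assumption|].
        rewrite (Rmult_assoc M), Rinv_l; lra.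
      * rewrite pow_add. unfold Rdiv. rewrite Rpow_mult_distr, pow_inv.
        field. split; apply pow_nonzero; lra.
    + apply ex_series_Rmult, ex_series_geom. rewrite Rabs_pos_eq; lra.
  - rewrite Series_scal_l, Series_geom by (rewrite Rabs_pos_eq; lra).
    right. simpl. field. repeat split; lra.
Qed.

Lemma disk_coef_divcoef (z0 : C) (a : nat -> C) :
  disk_coef a -> Cmod z0 < 1 -> disk_coef (divcoef z0 a).
Proof.
  intros Ha Hz rho Hr. pose proof (Cmod_ge_0 z0).
  set (r := (1 + Rmax (Cmod z0) rho) / 2).
  pose proof (Rmax_l (Cmod z0) rho). pose proof (Rmax_r (Cmod z0) rho).
  assert (Rmax (Cmod z0) rho < 1) by (apply Rmax_lub_lt; lra).
  destruct (Ha r) as [M HM]; [unfold r; lra|].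
  exists (M / (r - Cmod z0)). intros n.
  eapply Rle_trans; [|apply (divcoef_bound z0 a r M); try exact HM; unfold r; lra].
  apply Rmult_le_compat_l; [apply Cmod_ge_0|]. apply pow_incr. unfold r. lra.
Qed.

Lemma psf_divcoef (z0 z : C) (a : nat -> C) :
  disk_coef a -> Cmod z0 < 1 -> Cmod z < 1 ->
  psf a z = (psf a z0 + (z - z0) * psf (divcoef z0 a) z)%C.
Proof.
  intros Ha Hz0 Hz. pose proof (disk_coef_divcoef z0 a Ha Hz0) as Hd.
  rewrite (psf_incr a z0), (psf_incr a z) by assumption.
  change (psf (fun n => a (S n)) z0) with (divcoef z0 a 0).
  rewrite (psf_ext (fun n => a (S n))
    (fun n => divcoef z0 a n + (- z0) * divcoef z0 a (S n))%C).
  2:{ intros n. rewrite (divcoef_rec z0 a n) by assumption. ring. }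
  rewrite psf_plus, psf_scal by
    auto using disk_coef_scal, (disk_coef_incr (divcoef z0 a)).
  rewrite (psf_incr (divcoef z0 a) z) by assumption. ring.
Qed.

Lemma cderiv_unique (f : C -> C) (z l m : C) : cderiv f z l -> cderiv f z m -> l = m.
Proof.
  intros Hl Hm. apply Ceq_minus, Cmod_eq_0, Rle_antisym; [|apply Cmod_ge_0].
  apply Rle_plus_epsilon. intros eps He.
  destruct (Hl (eps / 2)) as [d1 [Hd1 H1]]; [lra|].
  destruct (Hm (eps / 2)) as [d2 [Hd2 H2]]; [lra|].
  assert (Hd : 0 < Rmin d1 d2) by now apply Rmin_pos.
  pose proof (Rmin_l d1 d2). pose proof (Rmin_r d1 d2).
  set (h := RtoC (Rmin d1 d2 / 2)).
  assert (Hh : Cmod h = Rmin d1 d2 / 2) by (apply Cmod_Rpos; lra).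
  specialize (H1 h ltac:(lra)). specialize (H2 h ltac:(lra)).
  assert (Cmod ((l - m) * h)%C <= eps * Cmod h).
  { replace ((l - m) * h)%C
      with ((f (z + h) - f z - m * h) - (f (z + h) - f z - l * h))%C by ring.
    eapply Rle_trans; [apply Cmod_sub_triangle|]. lra. }
  rewrite Cmod_mult in *. nra.
Qed.

(** Both sides are the derivative at z0 of the function a(z0) + (z - z0) q(z), with q the divided
    series. *)
Lemma psf_dcoef_divcoef (z0 : C) (a : nat -> C) :
  disk_coef a -> Cmod z0 < 1 -> psf (dcoef a) z0 = psf (divcoef z0 a) z0.
Proof.
  intros Ha Hz. apply (cderiv_unique (psf a) z0); [now apply psf_cderiv|].
  pose proof (disk_coef_divcoef z0 a Ha Hz) as Hd.
  pose proof (cderiv_plus _ _ _ _ _ (cderiv_const (psf a z0) z0)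
    (cderiv_mult _ _ _ _ _
      (cderiv_minus _ _ _ _ _ (cderiv_id z0) (cderiv_const z0 z0))
      (psf_cderiv _ z0 Hd Hz))) as H.
  eapply cderiv_eq.
  - eapply cderiv_ext_loc; [| |exact H].
    + exact (Rlt_Rminus _ _ Hz).
    + intros h Hh. cbv beta. symmetry. apply psf_divcoef; auto.
      eapply Rle_lt_trans; [apply Cmod_triangle|]. lra.
  - cbv beta. ring.
Qed.

(** Divide by z - z0 until the quotient is nonzero at z0. If this never happened, [psf a] would take
    its value at z0 again at a nearby point. *)
Lemma psf_factor (a : nat -> C) (z0 : C) :
  disk_coef a -> Cmod z0 < 1 ->
  (forall z, Cmod z < 1 -> psf a z = psf a z0 -> z = z0) ->
  exists k g, disk_coef g /\ psf g z0 <> 0 /\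
    (forall z, Cmod z < 1 -> psf a z = (psf a z0 + (z - z0) ^ S k * psf g z)%C) /\
    (psf (dcoef a) z0 = 0 -> (0 < k)%nat).
Proof.
  intros Ha Hz Hinj. pose proof (Cmod_ge_0 z0) as Hz0.
  set (G := fun k => Nat.iter k (divcoef z0) (divcoef z0 a)).
  assert (HG : forall k, disk_coef (G k)).
  { induction k as [|k IH]; simpl; now apply disk_coef_divcoef. }
  assert (Hfac : forall k, (forall j, (j < k)%nat -> psf (G j) z0 = 0) ->
    forall z, Cmod z < 1 -> psf a z = (psf a z0 + (z - z0) ^ S k * psf (G k) z)%C).
  { induction k as [|k IH]; intros Hk z Hz1.
    - simpl. rewrite (psf_divcoef z0 z a) by assumption. ring.
    - rewrite IH by auto with arith.
      rewrite (psf_divcoef z0 z (G k)) by auto.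
      rewrite Hk by auto with arith. change (divcoef z0 (G k)) with (G (S k)).
      rewrite (Cpow_S _ (S k)). ring. }
  destruct (classic (exists k, psf (G k) z0 <> 0)) as [He|Hn].
  - destruct (Wf_nat.dec_inh_nat_subset_has_unique_least_element _
      (fun k => classic (psf (G k) z0 <> 0)) He) as [k [[Hk Hmin] _]].
    exists k, (G k). repeat split; auto.
    + apply Hfac. intros j Hj. apply NNPP. intros Hc.
      specialize (Hmin j Hc). lia.
    + intros Hd. destruct k as [|k]; [|lia]. exfalso. apply Hk.
      change (G O) with (divcoef z0 a). now rewrite <- psf_dcoef_divcoef.
  - exfalso. assert (Hall : forall k, psf (G k) z0 = 0).
    { intros k. apply NNPP. intros Hc. apply Hn. now exists k. }
    set (rho := (1 + Cmod z0) / 2). set (del := rho - Cmod z0).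
    assert (Hdel : 0 < del) by (unfold del, rho; lra).
    destruct (HG O rho) as [M HM]; [unfold rho; lra|].
    assert (HM' : forall k n, Cmod (G k n) * rho ^ n <= M / del ^ k).
    { induction k as [|k IH]; intros n.
      - simpl pow. unfold Rdiv. rewrite Rinv_1, Rmult_1_r. apply HM.
      - change (G (S k)) with (divcoef z0 (G k)).
        eapply Rle_trans; [apply (divcoef_bound z0 (G k) rho (M / del ^ k));
          unfold rho in *; try lra; exact IH|].
        fold rho del. right. simpl. field. split; solve [lra | apply pow_nonzero; lra]. }
    (* At distance del / 2 the factor (del / 2)^(k+1) beats the growth del^(-k) of the quotients:
       the difference of the values at z and z0 is O(2^(-k)) for every k, hence 0. *)
    set (z := (z0 + RtoC (del / 2))%C).
    assert (Hzr : Cmod z <= Cmod z0 + del / 2).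
    { eapply Rle_trans; [apply Cmod_triangle|].
      rewrite (Cmod_Rpos (del / 2)) by lra. lra. }
    assert (Hz1 : Cmod z < rho) by (unfold del, rho in *; lra).
    assert (E : z = z0).
    { apply Hinj; [unfold rho in *; lra|].
      apply Ceq_minus, Cmod_eq_0, Rle_antisym; [|apply Cmod_ge_0].
      apply Rle_0_of_geom with (del / 2 * M * Series (fun n => (Cmod z / rho) ^ n)).
      assert (Hq : 0 <= Cmod z / rho < 1).
      { pose proof (Cmod_ge_0 z). assert (0 < rho) by (unfold rho; lra).
        split; [apply Rdiv_le_0_compat; lra|].
        apply Rlt_div_l; lra. }
      assert (Hrp : forall n, 0 < rho ^ n) by (intros; apply pow_lt; unfold rho; lra).
      intros k. rewrite (Hfac k) by (auto; unfold rho in *; lra).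
      replace (psf a z0 + (z - z0) ^ S k * psf (G k) z - psf a z0)%C
        with ((z - z0) ^ S k * psf (G k) z)%C by ring.
      rewrite Cmod_mult, Cmod_pow.
      replace (Cmod (z - z0)%C) with (del / 2).
      2:{ unfold z. replace (z0 + RtoC (del / 2) - z0)%C with (RtoC (del / 2)) by ring.
          rewrite Cmod_Rpos; lra. }
      assert (HGk : Cmod (psf (G k) z) <= M / del ^ k * Series (fun n => (Cmod z / rho) ^ n)).
      { rewrite <- Series_scal_l. apply Cmod_Csum_bound.
        - intros n. rewrite Cmod_mult, Cmod_pow. specialize (HM' k n).
          unfold Rdiv. rewrite Rpow_mult_distr, pow_inv.
          apply Rle_trans with (Cmod (G k n) * rho ^ n * (Cmod z ^ n * / rho ^ n)).
          + right. field. specialize (Hrp n). lra.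
          + apply Rmult_le_compat_r; [|exact HM'].
            apply Rmult_le_pos; [apply pow_le, Cmod_ge_0|].
            left. apply Rinv_0_lt_compat, Hrp.
        - apply ex_series_Rmult, ex_series_geom. rewrite Rabs_pos_eq; lra. }
      apply Rle_trans with ((del / 2) ^ S k
        * (M / del ^ k * Series (fun n => (Cmod z / rho) ^ n))).
      - apply Rmult_le_compat_l; [apply pow_le; lra|exact HGk].
      - right. simpl pow. unfold Rdiv. rewrite !Rpow_mult_distr, pow1.
        field. apply pow_nonzero. lra. }
    unfold z in E. apply (f_equal fst) in E. simpl in E. lra.
Qed.

(** * The unit circle; injectivity excludes critical points *)

Definition cis (t : R) : C := (cos t, sin t).

Lemma Cmod_cis (t : R) : Cmod (cis t) = 1.
Proof.
  unfold Cmod, cis; simpl. pose proof (sin2_cos2 t) as H. unfold Rsqr in H.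
  transitivity (sqrt 1); [f_equal; lra|apply sqrt_1].
Qed.

Lemma Cmod_cis_mult (t : R) (z : C) : Cmod (cis t * z)%C = Cmod z.
Proof. now rewrite Cmod_mult, Cmod_cis, Rmult_1_l. Qed.

Lemma cis_plus (s t : R) : cis (s + t) = (cis s * cis t)%C.
Proof. unfold cis, Cmult; simpl. rewrite cos_plus, sin_plus. f_equal; ring. Qed.

Lemma cis_0 : cis 0 = 1%C.
Proof. unfold cis. now rewrite cos_0, sin_0. Qed.

Lemma cis_pow (t : R) (n : nat) : (cis t ^ n)%C = cis (INR n * t).
Proof.
  induction n as [|n IH].
  - simpl INR. rewrite Rmult_0_l, cis_0. reflexivity.
  - rewrite Cpow_S, IH, <- cis_plus, S_INR. f_equal. ring.
Qed.

Lemma Cpow_lipschitz (z w : C) (r : R) (n : nat) :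
  Cmod z <= r -> Cmod w <= r ->
  Cmod (z ^ S n - w ^ S n)%C <= INR (S n) * r ^ n * Cmod (z - w)%C.
Proof.
  intros Hz Hw. pose proof (Cmod_ge_0 z). induction n as [|n IH].
  - simpl. rewrite !Cmult_1_r. lra.
  - replace (z ^ S (S n) - w ^ S (S n))%C
      with (z * (z ^ S n - w ^ S n) + w ^ S n * (z - w))%C by (rewrite !(Cpow_S _ (S n)); ring).
    eapply Rle_trans; [apply Cmod_triangle|]. rewrite !Cmod_mult, Cmod_pow.
    assert (Hp : Cmod w ^ S n <= r ^ S n) by (apply pow_incr; split; [apply Cmod_ge_0|lra]).
    assert (H1 : Cmod z * Cmod (z ^ S n - w ^ S n)%C <= r * (INR (S n) * r ^ n * Cmod (z - w)%C))
      by (apply Rmult_le_compat; auto using Cmod_ge_0).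
    assert (H2 : Cmod w ^ S n * Cmod (z - w)%C <= r ^ S n * Cmod (z - w)%C)
      by (apply Rmult_le_compat_r; auto using Cmod_ge_0).
    rewrite (S_INR (S n)). simpl pow in *. lra.
Qed.

(** Used to pick one small parameter meeting up to three smallness conditions; dividing by B + 1
    allows B = 0. *)
Lemma exists_scaled_le (B1 B2 B3 D1 D2 D3 : R) :
  0 <= B1 -> 0 <= B2 -> 0 <= B3 -> 0 < D1 -> 0 < D2 -> 0 < D3 ->
  exists c, 0 < c /\ B1 * c <= D1 /\ B2 * c <= D2 /\ B3 * c <= D3.
Proof.
  intros HB1 HB2 HB3 HD1 HD2 HD3.
  assert (H : forall B D, 0 <= B -> 0 < D ->
    0 < D / (B + 1) /\ forall c, 0 < c -> c <= D / (B + 1) -> B * c <= D).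
  { intros B D HB HD. split; [apply Rdiv_lt_0_compat; lra|]. intros c Hc0 Hc.
    apply Rle_div_r in Hc; nra. }
  destruct (H B1 D1 HB1 HD1) as [P1 Q1], (H B2 D2 HB2 HD2) as [P2 Q2],
    (H B3 D3 HB3 HD3) as [P3 Q3].
  set (c := Rmin (D1 / (B1 + 1)) (Rmin (D2 / (B2 + 1)) (D3 / (B3 + 1)))).
  assert (Hc : 0 < c) by (repeat apply Rmin_pos; assumption).
  assert (Hc1 : c <= D1 / (B1 + 1)) by apply Rmin_l.
  assert (Hc2 : c <= Rmin (D2 / (B2 + 1)) (D3 / (B3 + 1))) by apply Rmin_r.
  pose proof (Rmin_l (D2 / (B2 + 1)) (D3 / (B3 + 1))).
  pose proof (Rmin_r (D2 / (B2 + 1)) (D3 / (B3 + 1))).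
  exists c. repeat split; [exact Hc|apply Q1|apply Q2|apply Q3]; lra.
Qed.

(* Near z0 the equation z ^ K * g z = c ^ K * g z0 has a solution close to c * omega for
   each K-th root of unity omega. *)
Lemma root_branch (g : nat -> C) (z0 : C) (n : nat) (rho : R) :
  disk_coef g -> Cmod z0 < 1 -> psf g z0 <> 0 ->
  0 < rho -> 12 * INR (S n) * 2 ^ n * rho <= 1 ->
  exists c, 0 < c /\ 2 * c < 1 - Cmod z0 /\
    forall om, Cmod om = 1 -> exists u, Cmod (u - 1)%C <= rho /\
      (u ^ S (S n) * psf g (z0 + c * om * u) = psf g z0)%C.
Proof.
  intros Hg Hz Hb Hrho Hrho1. pose proof (Cmod_ge_0 z0) as Hz0.
  set (r := (1 + Cmod z0) / 2).
  destruct (psf_lipschitz g r Hg) as [L [HL0 HL]]; [unfold r; lra|].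
  set (b := psf g z0) in *. pose proof (proj1 (Cmod_gt_0 _) Hb) as Hm.
  set (K := INR (S (S n))).
  assert (HK : 2 <= K) by (unfold K; rewrite !S_INR; pose proof (pos_INR n); lra).
  assert (Hp1 : 1 <= 2 ^ n) by (apply pow_R1_Rle; lra).
  assert (HSn : INR (S n) = K - 1) by (unfold K; rewrite (S_INR (S n)); ring).
  rewrite HSn in Hrho1.
  assert (Hr1 : rho <= 1) by (assert (1 <= 12 * (K - 1) * 2 ^ n) by nra; nra).
  assert (HL' : 0 <= L / Cmod b) by (apply Rdiv_le_0_compat; lra).
  destruct (exists_scaled_le 4 ((1 + K) * 2 ^ S (S n) * 4 * (L / Cmod b)) (2 * (L / Cmod b))
    (1 - Cmod z0) 1 rho) as [c [Hc0 [Hc1 [Hc2 Hc3]]]]; try lra.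
  { apply Rmult_le_pos; [simpl pow; nra|exact HL']. }
  set (eta := L / Cmod b * c).
  assert (He0 : 0 <= eta) by (apply Rmult_le_pos; lra).
  rewrite Rmult_assoc in Hc2, Hc3. fold eta in Hc2, Hc3.
  exists c. split; [exact Hc0|]. split; [lra|]. intros om Hom.
  (* In the unknown u the equation reads u^K Q(u) = 1. Here Q(0) = 1 and Q varies by at most eta =
     O(c), so u = 1 is nearly a solution. *)
  set (Q := fun u => (psf g (z0 + c * om * u) / b)%C).
  assert (Hdist : forall u : C, Cmod (c * om * u)%C = c * Cmod u).
  { intros u. rewrite !Cmod_mult, Hom, Cmod_Rpos by lra. ring. }
  assert (Hin : forall u, Cmod u <= 2 -> Cmod (z0 + c * om * u)%C <= r).
  { intros u Hu. eapply Rle_trans; [apply Cmod_triangle|]. rewrite Hdist.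
    unfold r. nra. }
  assert (Hlip : forall u u', Cmod u <= 2 -> Cmod u' <= 2 ->
    Cmod (Q u - Q u')%C <= eta * Cmod (u - u')%C).
  { intros u u' Hu Hu'. unfold Q.
    replace (psf g (z0 + c * om * u) / b - psf g (z0 + c * om * u') / b)%C
      with ((psf g (z0 + c * om * u) - psf g (z0 + c * om * u')) / b)%C by (field; exact Hb).
    rewrite Cmod_div by exact Hb. specialize (HL _ _ (Hin u Hu) (Hin u' Hu')).
    replace (z0 + c * om * u - (z0 + c * om * u'))%C with (c * om * (u - u'))%C in HL by ring.
    rewrite Hdist in HL. unfold eta.
    apply Rle_div_l; [lra|].
    replace (L / Cmod b * c * Cmod (u - u')%C * Cmod b) with (L * c * Cmod (u - u')%C)
      by (field; lra). lra. }
  assert (HQ0 : Q 0%C = 1%C).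
  { unfold Q. rewrite Cmult_0_r, Cplus_0_r. fold b. field. exact Hb. }
  assert (Hball : forall u, Cmod (u - 1)%C <= rho -> Cmod u <= 2).
  { intros u Hu. pose proof (Cmod_ge_sub u 1). rewrite Cmod_1 in *. lra. }
  assert (HQ1 : forall u, Cmod u <= 2 -> Cmod (Q u - 1)%C <= eta * Cmod u).
  { intros u Hu. rewrite <- HQ0. replace (Cmod u) with (Cmod (u - 0)%C) by (f_equal; ring).
    apply Hlip; [exact Hu|]. rewrite Cmod_0. lra. }
  assert (HKnz : RtoC K <> 0%C) by (intros E; apply RtoC_inj in E; lra).
  destruct (solve_near (fun u => u ^ S (S n) * Q u)%C 1%C (RtoC K) 1%C rho) as [u [Hu E]].
  - lra.
  - exact HKnz.
  - intros u u' Hu Hu'. pose proof (Hball u Hu) as Hu2. pose proof (Hball u' Hu') as Hu2'.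
    set (h := (u - u')%C).
    (* Four errors: the Taylor remainder of the power, the variation of its slope near 1, and twice
       the variation of Q. Their sum must stay below (K / 2) |h|; the constant 12 in the hypothesis
       and the smallness of eta serve this. *)
    replace (u ^ S (S n) * Q u - u' ^ S (S n) * Q u' - K * h)%C
      with (((u ^ S (S n) - u' ^ S (S n) - K * u' ^ S n * h) + K * h * (u' ^ S n - 1))
        + (u ^ S (S n) * (Q u - Q u') + (u ^ S (S n) - u' ^ S (S n)) * (Q u' - 1)))%C by ring.
    rewrite (Cmod_Rpos K) by lra.
    assert (B0 : Cmod h <= 2 * rho).
    { unfold h. replace (u - u')%C with ((u - 1) - (u' - 1))%C by ring.
      eapply Rle_trans; [apply Cmod_sub_triangle|]. lra. }
    pose proof (Cmod_ge_0 h) as Hh0.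
    assert (B1 : Cmod (u ^ S (S n) - u' ^ S (S n) - K * u' ^ S n * h)%C
       <= K * (K - 1) * 2 ^ n * (2 * rho) * Cmod h).
    { pose proof (Cpow_taylor2 u' h 2 n Hu2') as T.
      replace (u' + h)%C with u in T by (unfold h; ring).
      specialize (T Hu2). fold K in T. rewrite HSn in T.
      eapply Rle_trans; [exact T|]. simpl pow. rewrite Rmult_1_r.
      assert (0 <= K * (K - 1) * 2 ^ n * Cmod h) by (repeat apply Rmult_le_pos; nra).
      nra. }
    assert (B2 : Cmod (K * h * (u' ^ S n - 1))%C <= K * Cmod h * ((K - 1) * 2 ^ n * rho)).
    { rewrite !Cmod_mult, Cmod_Rpos by lra.
      apply Rmult_le_compat_l; [nra|].
      pose proof (Cpow_lipschitz u' 1 2 n Hu2') as T. rewrite Cmod_1 in T.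
      specialize (T ltac:(lra)). rewrite Cpow_1_l, HSn in T.
      eapply Rle_trans; [exact T|]. apply Rmult_le_compat_l; [nra|exact Hu']. }
    assert (B3 : Cmod (u ^ S (S n) * (Q u - Q u'))%C <= 2 ^ S (S n) * (eta * Cmod h)).
    { rewrite Cmod_mult, Cmod_pow. apply Rmult_le_compat; auto using Cmod_ge_0.
      - apply pow_le, Cmod_ge_0.
      - apply pow_incr. split; [apply Cmod_ge_0|exact Hu2]. }
    assert (B4 : Cmod ((u ^ S (S n) - u' ^ S (S n)) * (Q u' - 1))%C
       <= K * 2 ^ S n * Cmod h * (eta * 2)).
    { rewrite Cmod_mult. apply Rmult_le_compat; auto using Cmod_ge_0.
      - exact (Cpow_lipschitz u u' 2 (S n) Hu2 Hu2').
      - eapply Rle_trans; [apply (HQ1 _ Hu2')|]. apply Rmult_le_compat_l; lra. }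
    eapply Rle_trans; [apply Cmod_triangle|].
    eapply Rle_trans; [apply Rplus_le_compat; apply Cmod_triangle|].
    assert (C1 : K * Cmod h * (12 * (K - 1) * 2 ^ n * rho) <= K * Cmod h * 1)
      by (apply Rmult_le_compat_l; nra).
    assert (C2 : Cmod h * ((1 + K) * 2 ^ S (S n) * 4 * eta) <= Cmod h * 1)
      by (apply Rmult_le_compat_l; nra).
    simpl pow in *.
    assert (Cmod h * 2 <= Cmod h * K) by (apply Rmult_le_compat_l; lra).
    nra.
  - rewrite Cpow_1_l, Cmult_1_l, Cmod_sub_sym, (Cmod_Rpos K) by lra.
    pose proof (HQ1 1%C) as T. rewrite Cmod_1 in T. specialize (T ltac:(lra)). nra.
  - exists u. split; [exact Hu|]. unfold Q in E.
    replace (u ^ S (S n) * psf g (z0 + c * om * u))%C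
      with (u ^ S (S n) * (psf g (z0 + c * om * u) / b) * b)%C by (field; exact Hb).
    rewrite E. ring.
Qed.

(** At a zero of the derivative, a(z) = a(z0) + (z - z0)^K g(z) with K >= 2 and g(z0) nonzero. The
    branches for the K-th roots of unity 1 and [om] give two points with equal values; injectivity
    merges them, which forces |1 - om| <= 2 rho. *)
Lemma inj_deriv_neq_0 (a : nat -> C) (z0 : C) :
  disk_coef a ->
  (forall z w, Cmod z < 1 -> Cmod w < 1 -> psf a z = psf a w -> z = w) ->
  Cmod z0 < 1 -> psf (dcoef a) z0 <> 0.
Proof.
  intros Ha Hinj Hz0 Hd.
  destruct (psf_factor a z0 Ha Hz0) as [k [g [Hg [Hgz [Hfac Hk]]]]]; [auto|].
  specialize (Hk Hd). destruct k as [|n]; [lia|].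
  set (om := cis (2 * PI / INR (S (S n)))).
  assert (HK : 2 <= INR (S (S n))) by (rewrite !S_INR; pose proof (pos_INR n); lra).
  assert (Hom : (om ^ S (S n))%C = 1%C).
  { unfold om. rewrite cis_pow. replace (INR (S (S n)) * (2 * PI / INR (S (S n))))
      with (2 * PI) by (field; lra).
    unfold cis. rewrite cos_2PI, sin_2PI. reflexivity. }
  assert (Hom1 : 0 < Cmod (1 - om)%C).
  { apply Cmod_gt_0. intros E. apply (f_equal fst) in E.
    change (1 + - cos (2 * PI / INR (S (S n))) = 0) in E.
    assert (Ht : 0 < PI / INR (S (S n)) < PI).
    { pose proof PI_RGT_0. split; [apply Rdiv_lt_0_compat; lra|].
      apply Rlt_div_l; nra. }
    replace (2 * PI / INR (S (S n))) with (2 * (PI / INR (S (S n)))) in E by (field; lra).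
    rewrite cos_2a_sin in E. pose proof (sin_gt_0 _ (proj1 Ht) (proj2 Ht)). nra. }
  (* The condition 3 rho <= |1 - om| is what contradicts |1 - om| <= 2 rho at the end. *)
  destruct (exists_scaled_le 3 (12 * INR (S n) * 2 ^ n) 0 (Cmod (1 - om)%C) 1 1)
    as [rho [Hr0 [Hr3 [Hr2 _]]]]; try lra.
  { apply Rmult_le_pos; [|apply pow_le; lra]. pose proof (pos_INR (S n)). lra. }
  destruct (root_branch g z0 n rho Hg Hz0 Hgz Hr0 Hr2) as [c [Hc0 [Hc1 Hsol]]].
  assert (Hommod : Cmod om = 1) by apply Cmod_cis.
  destruct (Hsol 1%C Cmod_1) as [u1 [Hu1 E1]].
  destruct (Hsol om Hommod) as [u2 [Hu2 E2]].
  assert (Hr1 : rho <= 1).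
  { pose proof (Cmod_sub_triangle 1 om) as T. rewrite Cmod_1, Hommod in T. lra. }
  assert (Hin : forall om u, Cmod om = 1 -> Cmod (u - 1)%C <= rho ->
    Cmod (z0 + c * om * u)%C < 1).
  { intros o u Ho Hu. eapply Rle_lt_trans; [apply Cmod_triangle|].
    rewrite !Cmod_mult, Ho, Cmod_Rpos by lra.
    pose proof (Cmod_ge_sub u 1) as T. rewrite Cmod_1 in T. nra. }
  assert (E : (z0 + c * 1 * u1)%C = (z0 + c * om * u2)%C).
  { apply Hinj; [apply Hin; auto using Cmod_1|apply Hin; auto|].
    rewrite (Hfac _ (Hin _ _ Cmod_1 Hu1)), (Hfac _ (Hin _ _ Hommod Hu2)). f_equal.
    replace (z0 + c * 1 * u1 - z0)%C with (c * u1)%C by ring.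
    replace (z0 + c * om * u2 - z0)%C with (c * om * u2)%C by ring.
    transitivity (c ^ S (S n) * (u1 ^ S (S n) * psf g (z0 + c * 1 * u1)))%C.
    { rewrite Cpow_mult_l. ring. }
    rewrite E1, <- E2, !Cpow_mult_l, Hom. ring. }
  assert (Eu : u1 = (om * u2)%C).
  { assert (Hcn : RtoC c <> 0%C) by (intros X; apply RtoC_inj in X; lra).
    replace u1 with (((z0 + c * 1 * u1) - z0) / c)%C by (field; exact Hcn).
    rewrite E. field. exact Hcn. }
  assert (Cmod (1 - om)%C <= 2 * rho).
  { replace (1 - om)%C with (om * (u2 - 1) - (u1 - 1))%C by (rewrite Eu; ring).
    eapply Rle_trans; [apply Cmod_sub_triangle|]. rewrite Cmod_mult, Hommod. lra. }
  lra.
Qed.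

(** The radius of the ball in [solve_near] is taken proportional to |w - a(z0)|, whence the linear
    bound on v - z0. It gives the continuity of the lift and the O(t^2) displacement in
    [convex_Re_pos]. *)
Lemma local_inverse (a : nat -> C) (z0 : C) :
  disk_coef a -> Cmod z0 < 1 -> psf (dcoef a) z0 <> 0 ->
  exists del K, 0 < del /\ 0 <= K /\ forall w, Cmod (w - psf a z0)%C < del ->
    exists v, Cmod v < 1 /\ Cmod (v - z0)%C <= K * Cmod (w - psf a z0)%C /\ psf a v = w.
Proof.
  intros Ha Hz Hl. set (l := psf (dcoef a) z0) in *.
  pose proof (proj1 (Cmod_gt_0 _) Hl) as Hm. pose proof (Cmod_ge_0 z0).
  set (r := (1 + Cmod z0) / 2).
  destruct (psf_taylor2 a r Ha) as [K [HK0 HK]]; [unfold r; lra|].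
  destruct (psf_lipschitz _ r (disk_coef_dcoef a Ha)) as [L [HL0 HL]]; [unfold r; lra|].
  destruct (exists_scaled_le 4 (4 * K + 2 * L) 0 (1 - Cmod z0) (Cmod l) 1)
    as [rho0 [Hr0 [Hr1 [Hr2 _]]]]; try lra.
  exists (Cmod l * rho0 / 2), (2 / Cmod l).
  split; [apply Rdiv_lt_0_compat; nra|]. split; [apply Rdiv_le_0_compat; lra|].
  intros w Hw. set (rho := 2 / Cmod l * Cmod (w - psf a z0)%C).
  assert (Hrho0 : 0 <= rho).
  { apply Rmult_le_pos; [apply Rdiv_le_0_compat; lra|apply Cmod_ge_0]. }
  assert (Hrho : rho <= rho0).
  { unfold rho. apply Rle_trans with (2 / Cmod l * (Cmod l * rho0 / 2)).
    - apply Rmult_le_compat_l; [apply Rdiv_le_0_compat|]; lra.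
    - right. field. lra. }
  destruct (solve_near (psf a) z0 l w rho Hrho0 Hl) as [v [Hv E]].
  - intros v v' H1 H2.
    assert (Hin : forall v, Cmod (v - z0)%C <= rho -> Cmod v <= r).
    { intros x Hx. pose proof (Cmod_ge_sub x z0). unfold r. lra. }
    set (h := (v - v')%C).
    replace (psf a v - psf a v' - l * h)%C
      with ((psf a v - psf a v' - psf (dcoef a) v' * h) + (psf (dcoef a) v' - l) * h)%C by ring.
    eapply Rle_trans; [apply Cmod_triangle|]. rewrite (Cmod_mult (_ - _)%C).
    specialize (HK v' h (Hin _ H2)). replace (v' + h)%C with v in HK by (unfold h; ring).
    specialize (HK (Hin _ H1)).
    specialize (HL v' z0 (Hin _ H2) ltac:(unfold r; lra)). fold l in HL.
    assert (Hh : Cmod h <= 2 * rho).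
    { unfold h. replace (v - v')%C with ((v - z0) - (v' - z0))%C by ring.
      eapply Rle_trans; [apply Cmod_sub_triangle|]. lra. }
    pose proof (Cmod_ge_0 h).
    assert (D1 : K * Cmod h ^ 2 <= 2 * K * rho0 * Cmod h).
    { assert (0 <= K * Cmod h) by nra. simpl. nra. }
    assert (D2 : Cmod (psf (dcoef a) v' - l)%C * Cmod h <= L * rho0 * Cmod h).
    { apply Rmult_le_compat_r; [assumption|]. eapply Rle_trans; [exact HL|].
      apply Rmult_le_compat_l; lra. }
    assert ((4 * K + 2 * L) * rho0 * Cmod h <= Cmod l * Cmod h) by nra. lra.
  - right. unfold rho. field. lra.
  - exists v. split; [|split; assumption].
    pose proof (Cmod_ge_sub v z0). lra.
Qed.

(** * Maximum principle *)

(** A Lebesgue-number argument: by compactness the admissible radii used to cover the disk can be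
    kept above a common d0. *)
Lemma disk_cover (P : C -> R -> Prop) (r : R) :
  (forall z, Cmod z <= r -> exists d, 0 < d /\ P z d) ->
  exists d0, 0 < d0 /\ forall z, Cmod z <= r ->
    exists w d, Cmod w <= r /\ P w d /\ Cmod (z - w)%C < d /\ d0 <= d.
Proof.
  intros H.
  (* The gauge lives on a square containing the disk. Outside the disk it is at most half the
     distance to the disk, so such centres never cover a point of the disk. *)
  assert (Hdel : forall u v, exists d : posreal,
    (Cmod (u, v) <= r -> P (u, v) (2 * d)) /\
    (r < Cmod (u, v) -> 2 * d <= Cmod (u, v) - r)).
  { intros u v. destruct (Rle_lt_dec (Cmod (u, v)) r) as [Hle|Hlt].
    - destruct (H _ Hle) as [d [Hd HP]].
      assert (Hd2 : 0 < d / 2) by lra. exists (mkposreal _ Hd2). simpl. split.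
      + intros _. now replace (2 * (d / 2)) with d by field.
      + lra.
    - assert (Hd2 : 0 < (Cmod (u, v) - r) / 2) by lra.
      exists (mkposreal _ Hd2). simpl. split; lra. }
  set (del := fun u v => proj1_sig (constructive_indefinite_description _ (Hdel u v))).
  destruct (compactness_value_2d (- r) r (- r) r del) as [d0 Hd0].
  exists d0. split; [apply cond_pos|]. intros [x y] Hz.
  pose proof (re_le_Cmod (x, y)) as Hx. pose proof (Im_le_Cmod (x, y)) as Hy.
  unfold Re, Im in Hx, Hy; cbn [fst snd] in Hx, Hy.
  assert (Hx' : - r <= x <= r) by (apply Rabs_le_between; lra).
  assert (Hy' : - r <= y <= r) by (apply Rabs_le_between; lra).
  destruct (NNPP _ (Hd0 x y Hx' Hy')) as [u [v [_ [_ [Hu [Hv Hd]]]]]].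
  unfold del in Hu, Hv, Hd.
  destruct (constructive_indefinite_description _ (Hdel u v)) as [d [H1 H2]].
  cbn [proj1_sig] in *.
  assert (Hdist : Cmod ((x, y) - (u, v))%C < 2 * d).
  { eapply Rle_lt_trans; [apply Cmod_le_Re_Im|]. cbn. unfold Rminus in *. lra. }
  pose proof (Cmod_ge_sub (u, v) (x, y)) as H3. rewrite Cmod_sub_sym in H3.
  destruct (Rle_lt_dec (Cmod (u, v)) r) as [Hle|Hlt]; [|specialize (H2 Hlt); lra].
  exists (u, v), (2 * d). pose proof (cond_pos d0). repeat split; auto. lra.
Qed.

Lemma ccont_conj (f : C -> C) (z : C) : ccont f z -> ccont (fun w => Cconj (f w)) z.
Proof.
  intros H eps He. destruct (H eps He) as [d [Hd H1]]. exists d. split; [exact Hd|].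
  intros h Hh. rewrite <- Cminus_conj, Cmod_conj. now apply H1.
Qed.

Lemma disk_max (H : C -> R) (r : R) :
  0 <= r -> (forall z, Cmod z <= r -> ccont (fun w => RtoC (H w)) z) ->
  exists z0, Cmod z0 <= r /\ forall z, Cmod z <= r -> H z <= H z0.
Proof.
  intros Hr Hc'.
  assert (Hc : forall z, Cmod z <= r -> forall eps, 0 < eps -> exists del, 0 < del /\
    forall h, Cmod h < del -> Rabs (H (z + h)%C - H z) < eps).
  { intros z Hz eps He. destruct (Hc' z Hz eps He) as [d [Hd H1]]. exists d.
    split; [exact Hd|]. intros h Hh. rewrite <- Cmod_R, RtoC_minus. now apply H1. }
  set (E := fun y => exists z, Cmod z <= r /\ y = H z).
  assert (Hb : bound E).
  { destruct (disk_cover (fun z d => d * (1 + Rabs (H z)) <= 1 /\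
      forall h, Cmod h < d -> Rabs (H (z + h)%C - H z) < 1) r) as [d0 [Hd0 Hcov]].
    - intros z Hz. destruct (Hc z Hz 1 Rlt_0_1) as [d [Hd H1]].
      pose proof (Rabs_pos (H z)).
      assert (H2 : 0 < / (1 + Rabs (H z))) by (apply Rinv_0_lt_compat; lra).
      exists (Rmin d (/ (1 + Rabs (H z)))). split; [now apply Rmin_pos|]. split.
      + eapply Rle_trans; [apply Rmult_le_compat_r; [lra|apply Rmin_r]|].
        rewrite Rinv_l; lra.
      + intros h Hh. apply H1. eapply Rlt_le_trans; [exact Hh|apply Rmin_l].
    - exists (/ d0 + 1). intros y [z [Hz ->]].
      destruct (Hcov z Hz) as [w [d [Hw [[H1 H2] [H3 H4]]]]].
      specialize (H2 _ H3). replace (w + (z - w))%C with z in H2 by ring.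
      apply Rabs_def2 in H2. pose proof (Rle_abs (H w)).
      pose proof (Rabs_pos (H w)).
      assert (d0 * (1 + Rabs (H w)) <= 1) by nra.
      assert (Rabs (H w) <= / d0).
      { apply Rmult_le_reg_l with d0; [exact Hd0|]. rewrite Rinv_r by lra. nra. }
      lra. }
  destruct (completeness E Hb) as [m [Hub Hlub]].
  { exists (H 0%C), 0%C. split; [rewrite Cmod_0; exact Hr|reflexivity]. }
  destruct (classic (exists z, Cmod z <= r /\ m <= H z)) as [[z0 [Hz0 Hm]]|Hn].
  - exists z0. split; [exact Hz0|]. intros z Hz.
    apply Rle_trans with m; [|exact Hm]. apply Hub. now exists z.
  - exfalso. assert (Hlt : forall z, Cmod z <= r -> H z < m).
    { intros z Hz. apply Rnot_le_lt. intros Hle. apply Hn. now exists z. }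
    (* If m is not attained, each radius is at most half the gap m - H at its centre, which makes m
       - d0 an upper bound as well. *)
    destruct (disk_cover (fun z d => d <= (m - H z) / 2 /\
      forall h, Cmod h < d -> Rabs (H (z + h)%C - H z) < (m - H z) / 2) r)
      as [d0 [Hd0 Hcov]].
    + intros z Hz. specialize (Hlt z Hz).
      destruct (Hc z Hz ((m - H z) / 2)) as [d [Hd H1]]; [lra|].
      exists (Rmin d ((m - H z) / 2)). split; [apply Rmin_pos; lra|].
      split; [apply Rmin_r|].
      intros h Hh. apply H1. eapply Rlt_le_trans; [exact Hh|apply Rmin_l].
    + assert (m <= m - d0); [|lra].
      apply Hlub. intros y [z [Hz ->]].
      destruct (Hcov z Hz) as [w [d [Hw [[H1 H2] [H3 H4]]]]].
      specialize (H2 _ H3). replace (w + (z - w))%C with z in H2 by ring.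
      apply Rabs_def2 in H2. lra.
Qed.

(** * Derivatives along curves, second-order Taylor estimate, maximum principle *)

Definition rderiv (gam : R -> C) (t : R) (l : C) : Prop :=
  forall eps, 0 < eps -> exists del, 0 < del /\ forall s, Rabs s < del ->
    Cmod (gam (t + s)%R - gam t - l * s)%C <= eps * Rabs s.

Lemma rderiv_comp (f : C -> C) (gam : R -> C) (t : R) (l m : C) :
  rderiv gam t m -> cderiv f (gam t) l -> rderiv (fun s => f (gam s)) t (l * m)%C.
Proof.
  intros Hg Hf eps He. pose proof (Cmod_ge_0 m). pose proof (Cmod_ge_0 l).
  destruct (Hg 1 Rlt_0_1) as [d1 [Hd1 H1]].
  destruct (Hf (eps / (2 * (Cmod m + 1)))) as [d2 [Hd2 H2]].
  { apply Rdiv_lt_0_compat; lra. }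
  destruct (Hg (eps / (2 * (Cmod l + 1)))) as [d3 [Hd3 H3]].
  { apply Rdiv_lt_0_compat; lra. }
  exists (Rmin (Rmin d1 d3) (d2 / (Cmod m + 1))). split.
  { repeat apply Rmin_pos; auto. apply Rdiv_lt_0_compat; lra. }
  intros s Hs.
  pose proof (Rmin_l (Rmin d1 d3) (d2 / (Cmod m + 1))).
  pose proof (Rmin_r (Rmin d1 d3) (d2 / (Cmod m + 1))).
  pose proof (Rmin_l d1 d3). pose proof (Rmin_r d1 d3).
  specialize (H1 s ltac:(lra)). specialize (H3 s ltac:(lra)).
  set (k := (gam (t + s)%R - gam t)%C) in *. pose proof (Rabs_pos s).
  assert (Hkl : Cmod k <= (Cmod m + 1) * Rabs s).
  { replace k with ((k - m * s) + m * s)%C by ring.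
    eapply Rle_trans; [apply Cmod_triangle|]. rewrite Cmod_mult, Cmod_R. lra. }
  assert (Hk : Cmod k < d2).
  { eapply Rle_lt_trans; [exact Hkl|].
    apply Rlt_le_trans with ((Cmod m + 1) * (d2 / (Cmod m + 1))); [nra|].
    right. field. lra. }
  specialize (H2 k Hk).
  replace (gam (t + s)%R) with (gam t + k)%C by (unfold k; ring).
  replace (f (gam t + k) - f (gam t) - l * m * s)%C
    with ((f (gam t + k) - f (gam t) - l * k) + l * (k - m * s))%C by ring.
  eapply Rle_trans; [apply Cmod_triangle|]. rewrite Cmod_mult.
  assert (A1 : eps / (2 * (Cmod m + 1)) * Cmod k <= eps / 2 * Rabs s).
  { apply Rle_trans with (eps / (2 * (Cmod m + 1)) * ((Cmod m + 1) * Rabs s)).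
    - apply Rmult_le_compat_l; [|exact Hkl]. left. apply Rdiv_lt_0_compat; lra.
    - right. field. lra. }
  assert (A2 : Cmod l * Cmod (k - m * s)%C <= eps / 2 * Rabs s).
  { apply Rle_trans with ((Cmod l + 1) * (eps / (2 * (Cmod l + 1)) * Rabs s)).
    - apply Rmult_le_compat; [lra|apply Cmod_ge_0|lra|exact H3].
    - right. field. lra. }
  lra.
Qed.

Lemma is_derive_of_bound (f : R -> R) (t l : R) :
  (forall eps, 0 < eps -> exists del, 0 < del /\ forall s, Rabs s < del ->
     Rabs (f (t + s) - f t - l * s) <= eps * Rabs s) -> is_derive f t l.
Proof.
  intros H. apply is_derive_Reals. intros eps He.
  destruct (H (eps / 2)) as [d [Hd H1]]; [lra|].
  exists (mkposreal d Hd). intros s Hs Hsd. specialize (H1 s Hsd).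
  replace ((f (t + s) - f t) / s - l) with ((f (t + s) - f t - l * s) / s) by (field; exact Hs).
  unfold Rdiv. rewrite Rabs_mult, Rabs_inv. pose proof (Rabs_pos_lt s Hs).
  apply Rle_lt_trans with (eps / 2); [|lra].
  apply Rle_div_l; lra.
Qed.

Lemma rderiv_Re (gam : R -> C) (t : R) (l : C) :
  rderiv gam t l -> is_derive (fun s => Re (gam s)) t (Re l).
Proof.
  intros H. apply is_derive_of_bound. intros eps He.
  destruct (H eps He) as [d [Hd H1]]. exists d. split; [exact Hd|]. intros s Hs.
  eapply Rle_trans; [|apply (H1 s Hs)]. eapply Rle_trans; [|apply re_le_Cmod].
  right. f_equal. unfold Re, Cminus, Cplus, Copp, Cmult; simpl. ring.
Qed.

Lemma rderiv_Im (gam : R -> C) (t : R) (l : C) :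
  rderiv gam t l -> is_derive (fun s => Im (gam s)) t (Im l).
Proof.
  intros H. apply is_derive_of_bound. intros eps He.
  destruct (H eps He) as [d [Hd H1]]. exists d. split; [exact Hd|]. intros s Hs.
  eapply Rle_trans; [|apply (H1 s Hs)]. eapply Rle_trans; [|apply Im_le_Cmod].
  right. f_equal. unfold Im; simpl. ring.
Qed.

Lemma rderiv_intro (gam : R -> C) (t : R) (l : C) :
  is_derive (fun s => Re (gam s)) t (Re l) -> is_derive (fun s => Im (gam s)) t (Im l) ->
  rderiv gam t l.
Proof.
  intros H1 H2 eps He. apply is_derive_Reals in H1. apply is_derive_Reals in H2.
  destruct (H1 (eps / 2)) as [d1 D1]; [lra|]. destruct (H2 (eps / 2)) as [d2 D2]; [lra|].
  exists (Rmin d1 d2). split; [apply Rmin_pos; apply cond_pos|]. intros s Hs.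
  destruct (Req_dec s 0) as [->|Hs0].
  - rewrite Rplus_0_r. replace (gam t - gam t - l * 0)%C with (RtoC 0) by ring.
    rewrite Cmod_0, Rabs_R0. lra.
  - specialize (D1 s Hs0 (Rlt_le_trans _ _ _ Hs (Rmin_l _ _))).
    specialize (D2 s Hs0 (Rlt_le_trans _ _ _ Hs (Rmin_r _ _))).
    pose proof (Rabs_pos_lt s Hs0).
    eapply Rle_trans; [apply Cmod_le_Re_Im|].
    replace (Re (gam (t + s)%R - gam t - l * s)%C)
      with (((Re (gam (t + s)) - Re (gam t)) / s - Re l) * s).
    2:{ unfold Re, Cminus, Cplus, Copp, Cmult; simpl. field. exact Hs0. }
    replace (Im (gam (t + s)%R - gam t - l * s)%C)
      with (((Im (gam (t + s)) - Im (gam t)) / s - Im l) * s).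
    2:{ unfold Im, Cminus, Cplus, Copp, Cmult; simpl. field. exact Hs0. }
    rewrite !Rabs_mult. nra.
Qed.

Lemma rderiv_line (h : C) (t : R) : rderiv (fun s => RtoC s * h)%C t h.
Proof.
  intros eps He. exists 1. split; [lra|]. intros s _.
  replace ((t + s)%R * h - t * h - h * s)%C with (RtoC 0) by (rewrite RtoC_plus; ring).
  rewrite Cmod_0. pose proof (Rabs_pos s). nra.
Qed.

(** The mean value theorem is applied to the real and the imaginary part separately; their
    intermediate points differ, whence the factor 2. *)
Lemma segment_MVT_bound (D D1 : C -> C) (h : C) (B : R) :
  (forall t, 0 <= t <= 1 -> cderiv D (t * h)%C (D1 (t * h)%C)) ->
  (forall t, 0 <= t <= 1 -> Cmod (D1 (t * h)%C) <= B) ->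
  Cmod (D h - D 0)%C <= 2 * B * Cmod h.
Proof.
  intros HD HB.
  assert (Hp : forall t, 0 <= t <= 1 -> rderiv (fun s => D (s * h)%C) t (D1 (t * h) * h)%C).
  { intros t Ht. apply (rderiv_comp D (fun s => s * h)%C); [|now apply HD].
    apply rderiv_line. }
  assert (Hb : forall t, 0 <= t <= 1 -> Cmod (D1 (t * h) * h)%C <= B * Cmod h).
  { intros t Ht. rewrite Cmod_mult. apply Rmult_le_compat_r; [apply Cmod_ge_0|auto]. }
  eapply Rle_trans; [apply Cmod_le_Re_Im|].
  destruct (MVT_gen (fun s => Re (D (s * h)%C)) 0 1 (fun t => Re (D1 (t * h) * h)%C))
    as [c1 [Hc1 E1]].
  { intros t Ht. rewrite Rmin_left, Rmax_right in Ht by lra. apply (rderiv_Re (fun s => D (s * h)%C)), Hp. lra. }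
  { intros t Ht. rewrite Rmin_left, Rmax_right in Ht by lra.
    apply continuity_pt_filterlim, (ex_derive_continuous (V := R_NormedModule)).
    eexists. apply (rderiv_Re (fun s => D (s * h)%C)), Hp. lra. }
  destruct (MVT_gen (fun s => Im (D (s * h)%C)) 0 1 (fun t => Im (D1 (t * h) * h)%C))
    as [c2 [Hc2 E2]].
  { intros t Ht. rewrite Rmin_left, Rmax_right in Ht by lra. apply (rderiv_Im (fun s => D (s * h)%C)), Hp. lra. }
  { intros t Ht. rewrite Rmin_left, Rmax_right in Ht by lra.
    apply continuity_pt_filterlim, (ex_derive_continuous (V := R_NormedModule)).
    eexists. apply (rderiv_Im (fun s => D (s * h)%C)), Hp. lra. }
  rewrite Rmin_left, Rmax_right in Hc1, Hc2 by lra.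
  rewrite !Cmult_1_l, !Cmult_0_l, Rminus_0_r, Rmult_1_r in E1, E2.
  replace (Re (D h - D 0)%C) with (Re (D h) - Re (D 0%C))
    by (unfold Re, Cminus, Cplus, Copp; simpl; ring).
  replace (Im (D h - D 0)%C) with (Im (D h) - Im (D 0%C))
    by (unfold Im, Cminus, Cplus, Copp; simpl; ring).
  rewrite E1, E2.
  pose proof (re_le_Cmod (D1 (c1 * h) * h)%C). pose proof (Im_le_Cmod (D1 (c2 * h) * h)%C).
  pose proof (Hb c1 Hc1). pose proof (Hb c2 Hc2). lra.
Qed.

Lemma cderiv_shift (f : C -> C) (z0 h l : C) :
  cderiv f (z0 + h)%C l -> cderiv (fun x => f (z0 + x)%C) h l.
Proof.
  intros H eps He. destruct (H eps He) as [d [Hd H1]]. exists d. split; [exact Hd|].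
  intros k Hk. specialize (H1 k Hk). now rewrite <- Cplus_assoc in H1.
Qed.

(** U minus its quadratic polynomial has derivative U1(z + x) - U1(z) - l x = o(x), and the segment
    bound integrates this to o(h^2). *)
Lemma taylor2_peano (U U1 : C -> C) (z l : C) (d : R) :
  0 < d -> (forall h, Cmod h < d -> cderiv U (z + h)%C (U1 (z + h)%C)) ->
  cderiv U1 z l ->
  forall eps, 0 < eps -> exists del, 0 < del /\ forall h, Cmod h < del ->
    Cmod (U (z + h) - U z - U1 z * h - l / 2 * (h * h))%C <= eps * Cmod h ^ 2.
Proof.
  intros Hd HU HU1 eps He. destruct (HU1 (eps / 2)) as [d1 [Hd1 H1]]; [lra|].
  exists (Rmin d d1). split; [now apply Rmin_pos|]. intros h Hh.
  pose proof (Rmin_l d d1). pose proof (Rmin_r d d1). pose proof (Cmod_ge_0 h).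
  set (D := fun x => (U (z + x) - (U1 z * x + l / 2 * (x * x)))%C).
  assert (Hth : forall t, 0 <= t <= 1 -> Cmod (t * h)%C <= Cmod h).
  { intros t Ht. rewrite Cmod_mult, Cmod_Rpos by lra. nra. }
  pose proof (segment_MVT_bound D (fun x => U1 (z + x) - U1 z - l * x)%C h
    (eps / 2 * Cmod h)) as T.
  unfold D in T. rewrite Cplus_0_r in T.
  replace (U (z + h) - U z - U1 z * h - l / 2 * (h * h))%C with
    (U (z + h) - (U1 z * h + l / 2 * (h * h)) - (U z - (U1 z * 0 + l / 2 * (0 * 0))))%C by ring.
  eapply Rle_trans; [apply T|right; field].
  - intros t Ht. specialize (Hth t Ht). set (x := (t * h)%C) in *.
    eapply cderiv_eq.
    + apply cderiv_minus; [apply cderiv_shift, HU; lra|].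
      apply cderiv_plus; [apply cderiv_scal, cderiv_id|].
      apply cderiv_scal, cderiv_mult; apply cderiv_id.
    + cbv beta. field.
  - intros t Ht. specialize (Hth t Ht). eapply Rle_trans; [apply H1; lra|].
    apply Rmult_le_compat_l; lra.
Qed.

(* Averaging over h, ih, -h, -ih kills the first and second order terms of U, so
   |U|^2 + eps |z|^2 is strictly subharmonic. *)
Lemma no_interior_max (U U1 : C -> C) (z l : C) (d eps : R) :
  0 < d -> (forall h, Cmod h < d -> cderiv U (z + h)%C (U1 (z + h)%C)) ->
  cderiv U1 z l -> 0 < eps ->
  ~ (forall h, Cmod h < d ->
       Cmod (U (z + h)%C) ^ 2 + eps * Cmod (z + h)%C ^ 2 <= Cmod (U z) ^ 2 + eps * Cmod z ^ 2).
Proof.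
  intros Hd HU HU1 He Hmax.
  set (u0 := U z) in *. set (u1 := U1 z). set (u2 := (l / 2)%C).
  (* Chosen so that an error of eps t^2 / (2 S) in U costs less than eps t^2 in |U|^2. *)
  set (S := 2 * (Cmod u0 + Cmod u1 + Cmod u2) + 1).
  pose proof (Cmod_ge_0 u0) as P0. pose proof (Cmod_ge_0 u1) as P1. pose proof (Cmod_ge_0 u2) as P2.
  destruct (taylor2_peano U U1 z l d Hd HU HU1 (eps / (2 * S))) as [d1 [Hd1 H1]].
  { apply Rdiv_lt_0_compat; unfold S; lra. }
  set (t := Rmin (Rmin d d1) 1 / 2).
  assert (Ht : 0 < t /\ t < d /\ t < d1 /\ t < 1).
  { assert (0 < Rmin (Rmin d d1) 1) by (repeat apply Rmin_pos; lra).
    pose proof (Rmin_l (Rmin d d1) 1). pose proof (Rmin_r (Rmin d d1) 1).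
    pose proof (Rmin_l d d1). pose proof (Rmin_r d d1). unfold t. lra. }
  set (q := fun h => (u0 + u1 * h + u2 * (h * h))%C).
  set (e := eps / (2 * S) * t ^ 2).
  assert (HeS : 2 * S * e = eps * t ^ 2) by (unfold e; field; unfold S; lra).
  assert (He0 : 0 < e).
  { unfold e. apply Rmult_lt_0_compat; [|simpl; nra]. apply Rdiv_lt_0_compat; unfold S; lra. }
  set (E := 2 * e * (Cmod u0 + Cmod u1 + Cmod u2)).
  assert (Hneg : E < eps * t ^ 2).
  { rewrite <- HeS. unfold E, S. nra. }
  assert (Hq : forall h, Cmod h = t -> Cmod (q h) ^ 2 - E <= Cmod (U (z + h)%C) ^ 2).
  { intros h Hh. specialize (H1 h ltac:(lra)).
    replace (U (z + h) - U z - U1 z * h - l / 2 * (h * h))%C with (U (z + h) - q h)%C in H1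
      by (unfold q, u0, u1, u2; ring).
    rewrite Hh in H1. rewrite Cmod_sub_sym in H1. fold e in H1.
    pose proof (Cmod_ge_sub (q h) (U (z + h)%C)) as H2.
    assert (Hqb : Cmod (q h) <= Cmod u0 + Cmod u1 + Cmod u2).
    { unfold q. eapply Rle_trans; [apply Cmod_triangle|].
      eapply Rle_trans; [apply Rplus_le_compat_r, Cmod_triangle|].
      rewrite !Cmod_mult, Hh.
      assert (t * t <= 1) by nra.
      assert (Cmod u1 * t <= Cmod u1) by nra.
      assert (Cmod u2 * (t * t) <= Cmod u2) by nra. lra. }
    pose proof (Cmod_ge_0 (q h)) as Q0. pose proof (Cmod_ge_0 (U (z + h)%C)) as Q1.
    assert (HE : 2 * e * Cmod (q h) <= E) by (apply Rmult_le_compat_l; lra).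
    clearbody E e.
    destruct (Rle_lt_dec (Cmod (q h)) e) as [Hle|Hgt].
    - assert (Cmod (q h) * Cmod (q h) <= e * Cmod (q h)) by (apply Rmult_le_compat_r; lra).
      assert (0 <= e * Cmod (q h)) by nra.
      pose proof (pow2_ge_0 (Cmod (U (z + h)%C))). simpl in *. lra.
    - assert ((Cmod (q h) - e) ^ 2 <= Cmod (U (z + h)%C) ^ 2) by (apply pow_incr; lra).
      simpl in *. nra. }
  assert (Hm : forall h, Cmod h = t ->
    Cmod (q h) ^ 2 - E + eps * Cmod (z + h)%C ^ 2 <= Cmod u0 ^ 2 + eps * Cmod z ^ 2).
  { intros h Hh. specialize (Hq h Hh). specialize (Hmax h ltac:(lra)). lra. }
  clearbody E. clear e HeS He0.
  assert (Hr : forall h : C, h = (t, 0) \/ h = (0, t) \/ h = (- t, 0) \/ h = (0, - t) ->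
    Cmod h = t).
  { intros h Hh. apply Rsqr_inj; [apply Cmod_ge_0|lra|]. rewrite !Rsqr_pow2, Cmod_sqr.
    destruct Hh as [->|[->|[->| ->]]]; simpl; ring. }
  pose proof (Hm (t, 0) (Hr (t, 0) ltac:(auto))) as M1.
  pose proof (Hm (0, t) (Hr (0, t) ltac:(auto))) as M2.
  pose proof (Hm (- t, 0) (Hr (- t, 0) ltac:(auto))) as M3.
  pose proof (Hm (0, - t) (Hr (0, - t) ltac:(auto))) as M4.
  rewrite !Cmod_sqr in M1, M2, M3, M4.
  unfold q in *. clear Hq Hm Hr H1 Hmax HU HU1. clearbody u0 u1 u2 t.
  destruct u0 as [a0 b0], u1 as [a1 b1], u2 as [a2 b2], z as [x y].
  simpl in *.
  assert (0 <= (a1 * t) ^ 2 + (b1 * t) ^ 2 + (a2 * t * t) ^ 2 + (b2 * t * t) ^ 2)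
    by (repeat apply Rplus_le_le_0_compat; apply pow2_ge_0).
  nra.
Qed.

(** Derivatives are required only off 0, with a separate bound at 0, because the lemma is applied to
    the quotient of the lift by z, extended to 0 by the derivative of the lift. *)
Lemma disk_max_principle (U U1 : C -> C) (r B : R) :
  0 < r -> 0 <= B ->
  (forall z, Cmod z <= r -> ccont U z) ->
  (forall z, 0 < Cmod z < r -> cderiv U z (U1 z) /\ exists l, cderiv U1 z l) ->
  Cmod (U 0%C) <= B -> (forall z, Cmod z = r -> Cmod (U z) <= B) ->
  forall z, Cmod z <= r -> Cmod (U z) <= B.
Proof.
  intros Hr HB HU HU1 H0 HBd z Hz.
  assert (Hsq : Cmod (U z) ^ 2 <= B ^ 2).
  { apply Rle_plus_epsilon. intros eps He.
    (* Adding e |z|^2 changes the values on the disk by at most eps and excludes a maximum at an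
       interior point other than 0. *)
    set (e := eps / r ^ 2). assert (Hr2 : 0 < r ^ 2) by (apply pow_lt; lra).
    assert (He' : 0 < e) by now apply Rdiv_lt_0_compat.
    assert (Her : e * r ^ 2 = eps) by (unfold e; field; lra).
    destruct (disk_max (fun z => Cmod (U z) ^ 2 + e * Cmod z ^ 2) r) as [z0 [Hz0 Hmax]].
    - lra.
    - intros w Hw.
      apply (ccont_ext_loc (fun z => U z * Cconj (U z) + e * (z * Cconj z))%C _ w 1 Rlt_0_1).
      + intros h _. now rewrite RtoC_plus, RtoC_mult, !Cmod2_conj.
      + apply ccont_plus; [|apply ccont_mult; [apply ccont_const|]].
        * apply ccont_mult; [|apply ccont_conj]; auto.
        * apply ccont_mult; [|apply ccont_conj]; apply ccont_id.
    - pose proof (Hmax z Hz) as Hmz. cbv beta in Hmz.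
      assert (0 <= e * Cmod z ^ 2) by (apply Rmult_le_pos; [lra|apply pow2_ge_0]).
      assert (Hcase : Cmod (U z0) <= B).
      { pose proof (Cmod_ge_0 z0).
        destruct (Req_dec (Cmod z0) 0) as [E0|N0].
        - apply Cmod_eq_0 in E0. now rewrite E0.
        - destruct (Rle_lt_or_eq_dec _ _ Hz0) as [Hlt|Heq]; [|now apply HBd].
          exfalso. destruct (HU1 z0) as [_ [l Hl]]; [lra|].
          set (d := Rmin (Cmod z0) (r - Cmod z0)).
          assert (Hd : 0 < d) by (apply Rmin_pos; lra).
          assert (Hd1 : d <= Cmod z0) by apply Rmin_l.
          assert (Hd2 : d <= r - Cmod z0) by apply Rmin_r.
          apply (no_interior_max U U1 z0 l d e Hd); auto.
          + intros h Hh. apply HU1. split.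
            * pose proof (Cmod_ge_sub z0 (- h)%C) as A. rewrite Cmod_opp in A.
              replace (z0 - - h)%C with (z0 + h)%C in A by ring. lra.
            * eapply Rle_lt_trans; [apply Cmod_triangle|]. lra.
          + intros h Hh. apply Hmax. eapply Rle_trans; [apply Cmod_triangle|]. lra. }
      assert (Cmod z0 ^ 2 <= r ^ 2) by (apply pow_incr; split; [apply Cmod_ge_0|exact Hz0]).
      assert (Cmod (U z0) ^ 2 <= B ^ 2)
        by (apply pow_incr; split; [apply Cmod_ge_0|exact Hcase]).
      assert (e * Cmod z0 ^ 2 <= eps) by (rewrite <- Her; apply Rmult_le_compat_l; lra).
      lra. }
  apply Rsqr_incr_0; [|apply Cmod_ge_0|exact HB]. now rewrite !Rsqr_pow2.
Qed.

(** * Subordination *)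

Definition inj_psf (a : nat -> C) : Prop :=
  forall z w, Cmod z < 1 -> Cmod w < 1 -> psf a z = psf a w -> z = w.

(** By injectivity the preimage supplied by [local_inverse] is om (z + h) itself, so [om] inherits
    continuity from G. Its slope is then the slope of G divided by the slope of F at the increment
    of [om]. *)
Lemma lift_cderiv (F G : nat -> C) (om : C -> C) (z : C) :
  disk_coef F -> disk_coef G -> inj_psf F ->
  (forall z, Cmod z < 1 -> Cmod (om z) < 1 /\ psf F (om z) = psf G z) ->
  Cmod z < 1 ->
  cderiv om z (psf (dcoef G) z / psf (dcoef F) (om z))%C.
Proof.
  intros HF HG Hinj Hom Hz. destruct (Hom z Hz) as [Ho1 Ho2].
  pose proof (inj_deriv_neq_0 F (om z) HF Hinj Ho1) as Hl.
  pose proof (psf_cderiv G z HG Hz) as DG.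
  pose proof (psf_cderiv F (om z) HF Ho1) as DF.
  destruct (local_inverse F (om z) HF Ho1 Hl) as [del [K [Hdel [HK0 HK]]]].
  pose proof (cderiv_ccont _ _ _ DG) as CG.
  destruct (CG del Hdel) as [d1 [Hd1 H1]].
  set (d := Rmin d1 (1 - Cmod z)).
  assert (Hd : 0 < d) by (apply Rmin_pos; lra).
  assert (Hin : forall h, Cmod h < d -> Cmod (z + h)%C < 1).
  { intros h Hh. pose proof (Rmin_r d1 (1 - Cmod z)). fold d in H.
    eapply Rle_lt_trans; [apply Cmod_triangle|]. lra. }
  assert (Hlip : forall h, Cmod h < d ->
    Cmod (om (z + h) - om z)%C <= K * Cmod (psf G (z + h) - psf G z)%C).
  { intros h Hh. pose proof (Rmin_l d1 (1 - Cmod z)) as X. fold d in X.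
    specialize (H1 h ltac:(lra)). rewrite Ho2 in HK.
    destruct (HK _ H1) as [v [Hv1 [Hv2 Hv3]]].
    destruct (Hom _ (Hin h Hh)) as [Hv4 Hv5].
    replace (om (z + h)%C) with v; [exact Hv2|]. apply Hinj; congruence. }
  assert (Com : ccont om z).
  { intros eps He. destruct (exists_scaled_le K 0 0 (eps / 2) 1 1) as [c [Hc0 [Hc _]]]; try lra.
    destruct (CG c Hc0) as [d2 [Hd2 H2]].
    apply (common_radius d d2); [assumption|assumption|]. intros h Hh1 Hh2.
    specialize (H2 h ltac:(lra)). eapply Rle_lt_trans; [apply Hlip; lra|].
    apply Rle_lt_trans with (K * c); [apply Rmult_le_compat_l; lra|lra]. }
  apply cderiv_cslope in DG. apply cderiv_cslope in DF. apply cderiv_cslope.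
  set (k := fun h => (om (z + h) - om z)%C).
  assert (Ck : ccont k 0).
  { intros eps He. destruct (Com eps He) as [d2 [Hd2 H2]]. exists d2.
    split; [exact Hd2|]. intros h Hh. unfold k. rewrite Cplus_0_l, Cplus_0_r.
    replace (om (z + h) - om z - (om z - om z))%C with (om (z + h) - om z)%C by ring.
    now apply H2. }
  assert (k0 : k 0%C = 0%C) by (unfold k; rewrite Cplus_0_r; ring).
  set (sF := cslope (psf F) (om z) (psf (dcoef F) (om z))) in *.
  assert (sF0 : sF 0%C = psf (dcoef F) (om z)).
  { unfold sF, cslope. destruct (Ceq_dec 0 0); congruence. }
  assert (CsF : ccont (fun h => sF (k h)) 0).
  { apply ccont_comp; [exact Ck|]. now rewrite k0. }
  assert (HsF : sF (k 0%C) <> 0%C) by (rewrite k0, sF0; exact Hl).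
  destruct (CsF (Cmod (sF (k 0%C)))) as [d2 [Hd2 H2]]; [now apply Cmod_gt_0|].
  pose proof (ccont_mult _ _ _ DG (ccont_inv (fun h => sF (k h)) 0 HsF CsF)) as Cq.
  eapply ccont_ext_loc with (d := Rmin d d2); [now apply Rmin_pos| |exact Cq].
  intros h Hh. pose proof (Rmin_l d d2). pose proof (Rmin_r d d2).
  specialize (H2 h ltac:(lra)). cbv beta in H2 |- *. rewrite Cplus_0_l in H2. rewrite !Cplus_0_l.
  assert (Hnz : sF (k h) <> 0%C).
  { intros E. rewrite E in H2. replace (0 - sF (k 0%C))%C with (- sF (k 0%C))%C in H2 by ring.
    rewrite Cmod_opp in H2. lra. }
  unfold cslope. destruct (Ceq_dec h 0) as [->|Hh0].
  - now rewrite k0, sF0.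
  - destruct (Hom _ (Hin h ltac:(lra))) as [_ Ho3].
    revert Hnz. unfold sF, cslope. destruct (Ceq_dec (k h) 0) as [Ek|Nk]; intros Hnz.
    + assert (E : om (z + h)%C = om z) by (apply Ceq_minus; exact Ek).
      rewrite <- Ho3, <- Ho2, E. field. auto.
    + replace (om z + k h)%C with (om (z + h)%C) in * by (unfold k; ring).
      rewrite Ho3, Ho2 in *.
      assert (psf G (z + h) - psf G z <> 0)%C.
      { intros E. apply Hnz. rewrite E. field. exact Nk. }
      unfold k in *. field. auto.
Qed.

(** The lift sends 0 to 0, and the maximum principle for om(x) / x bounds it by 1 / r on |x| <= r;
    then r is taken close to 1. The condition on the first coefficients gives |om'(0)| <= 1, the
    bound needed at 0. *)
Lemma subordination_schwarz (F G : nat -> C) (z w : C) :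
  disk_coef F -> disk_coef G -> inj_psf F -> F O = G O -> Cmod (G 1%nat) <= Cmod (F 1%nat) ->
  (forall z, Cmod z < 1 -> exists w, Cmod w < 1 /\ psf F w = psf G z) ->
  Cmod z < 1 -> Cmod w < 1 -> psf F w = psf G z -> Cmod w <= Cmod z.
Proof.
  intros HF HG Hinj H00 H11 Hsub Hz Hw Hwz.
  set (om := fun z => epsilon (inhabits (RtoC 0))
    (fun w => Cmod z < 1 -> Cmod w < 1 /\ psf F w = psf G z)).
  assert (Hom : forall z, Cmod z < 1 -> Cmod (om z) < 1 /\ psf F (om z) = psf G z).
  { intros x Hx. apply (epsilon_spec (inhabits (RtoC 0))
      (fun w => Cmod x < 1 -> Cmod w < 1 /\ psf F w = psf G x)); [|exact Hx].
    destruct (Hsub x Hx) as [y Hy]. exists y. auto. }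
  assert (Ew : w = om z).
  { destruct (Hom z Hz). apply Hinj; congruence. }
  rewrite Ew. clear w Hw Hwz Ew.
  assert (C0 : Cmod 0 < 1) by (rewrite Cmod_0; lra).
  assert (om0 : om 0%C = 0%C).
  { destruct (Hom 0%C C0) as [A B]. apply Hinj; auto. rewrite B, !psf_0 by assumption; congruence. }
  pose proof (fun x => lift_cderiv F G om x HF HG Hinj Hom) as Dom.
  assert (Hnz : forall x, Cmod x < 1 -> psf (dcoef F) (om x) <> 0%C).
  { intros x Hx. apply inj_deriv_neq_0; auto. now apply Hom. }
  set (om1 := fun x => (psf (dcoef G) x / psf (dcoef F) (om x))%C) in *.
  assert (Dom1 : forall x, Cmod x < 1 -> exists l, cderiv om1 x l).
  { intros x Hx. eexists. unfold om1. apply cderiv_div; [now apply Hnz| |].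
    - apply psf_cderiv; auto using disk_coef_dcoef.
    - eapply cderiv_comp; [exact (Dom x Hx)|].
      apply psf_cderiv; [auto using disk_coef_dcoef|now apply Hom]. }
  set (U := cslope om 0 (om1 0%C)).
  assert (UE : forall x : C, x <> 0%C -> U x = (om x / x)%C).
  { intros x Hx. unfold U, cslope. destruct (Ceq_dec x 0); [congruence|].
    rewrite Cplus_0_l, om0. f_equal. ring. }
  set (U1 := fun x => ((om1 x * x - om x * 1) / (x * x))%C).
  assert (HU : forall r, 0 < r < 1 -> Cmod z <= r -> Cmod (U z) <= / r).
  { intros r Hr Hzr. apply (disk_max_principle U U1 r (/ r)).
    - lra.
    - left. apply Rinv_0_lt_compat. lra.
    - intros x Hx. destruct (Ceq_dec x 0) as [->|Hx0].
      + apply cderiv_cslope, Dom, C0.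
      + eapply ccont_ext_loc with (f := fun x => (om x * / x)%C) (d := Cmod x).
        * now apply Cmod_gt_0.
        * intros h Hh. rewrite UE; [reflexivity|]. intros E.
          replace h with (- x)%C in Hh by (rewrite <- (Cplus_0_l (- x)), <- E; ring).
          rewrite Cmod_opp in Hh. lra.
        * apply ccont_mult; [eapply cderiv_ccont, Dom; lra|].
          apply (ccont_inv (fun x => x)); [exact Hx0|apply ccont_id].
    - intros x Hx. assert (Hx0 : x <> 0%C) by (now apply Cmod_gt_0). split.
      + eapply cderiv_ext_loc with (f := fun x => (om x / x)%C) (d := Cmod x); [lra| |].
        * intros h Hh. rewrite UE; [reflexivity|]. intros E.
          replace h with (- x)%C in Hh by (rewrite <- (Cplus_0_l (- x)), <- E; ring).
          rewrite Cmod_opp in Hh. lra.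
        * apply cderiv_div; [exact Hx0|apply Dom; lra|apply cderiv_id].
      + destruct (Dom1 x) as [l Hl]; [lra|]. eexists. unfold U1.
        apply cderiv_div; [now apply Cmult_neq_0| |apply cderiv_mult; apply cderiv_id].
        apply cderiv_minus.
        * apply cderiv_mult; [exact Hl|apply cderiv_id].
        * apply cderiv_mult; [apply Dom; lra|apply cderiv_const].
    - assert (HF1 : F 1%nat <> 0%C).
      { pose proof (Hnz 0%C C0) as A. rewrite om0, psf_0 in A by auto using disk_coef_dcoef.
        unfold dcoef in A. intros E. apply A. rewrite E. ring. }
      unfold U, cslope. destruct (Ceq_dec 0 0); [|congruence].
      unfold om1. rewrite om0, !psf_0 by auto using disk_coef_dcoef. unfold dcoef.
      simpl INR. rewrite !Cmult_1_l, Cmod_div by exact HF1.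
      apply Cmod_gt_0 in HF1. apply Rle_trans with 1.
      + apply Rle_div_l; lra.
      + rewrite <- Rinv_1. apply Rinv_le_contravar; lra.
    - intros x Hx. assert (Hx0 : x <> 0%C) by (apply Cmod_gt_0; lra).
      rewrite UE, Cmod_div, Hx by exact Hx0. destruct (Hom x) as [A _]; [lra|].
      unfold Rdiv. rewrite <- (Rmult_1_l (/ r)) at 2.
      apply Rmult_le_compat_r; [|lra]. left. apply Rinv_0_lt_compat. lra.
    - exact Hzr. }
  destruct (Ceq_dec z 0) as [->|Hz0].
  { rewrite om0. lra. }
  pose proof (proj1 (Cmod_gt_0 _) Hz0) as Hzp.
  apply Rnot_lt_le. intros Hlt.
  (* This r is below 1 but above |z| / |om z|, which contradicts |om z| r <= |z|. *)
  set (r := Rmax (Cmod z) ((Cmod z / Cmod (om z) + 1) / 2)).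
  assert (Hq : Cmod z / Cmod (om z) < 1).
  { apply Rlt_div_l; lra. }
  assert (Hr : Cmod z <= r) by apply Rmax_l.
  assert (Hr2 : (Cmod z / Cmod (om z) + 1) / 2 <= r) by apply Rmax_r.
  assert (Hr3 : r < 1) by (apply Rmax_lub_lt; lra).
  specialize (HU r ltac:(lra) Hr). rewrite UE, Cmod_div in HU by exact Hz0.
  assert (Cmod (om z) * r <= Cmod z).
  { apply (Rmult_le_compat_r (Cmod z * r)) in HU; [|nra].
    replace (Cmod (om z) / Cmod z * (Cmod z * r)) with (Cmod (om z) * r) in HU by (field; lra).
    replace (/ r * (Cmod z * r)) with (Cmod z) in HU by (field; lra). exact HU. }
  assert (Cmod z / Cmod (om z) * Cmod (om z) = Cmod z) by (field; lra).
  nra.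
Qed.

(** * The positive real part of 1 + z f'' / f' *)

Lemma disk_coef_decr (a : nat -> C) : disk_coef (fun n => a (S n)) -> disk_coef a.
Proof.
  intros Ha rho Hr. destruct (Ha rho Hr) as [M HM].
  exists (Rmax (Cmod (a O)) M). intros [|n].
  - simpl. rewrite Rmult_1_r. apply Rmax_l.
  - eapply Rle_trans; [|apply Rmax_r]. eapply Rle_trans; [|apply (HM n)].
    apply Rmult_le_compat_l; [apply Cmod_ge_0|]. simpl.
    assert (0 <= rho ^ n) by (apply pow_le; lra). nra.
Qed.

Lemma disk_coef_INR (a : nat -> C) : disk_coef a -> disk_coef (fun n => RtoC (INR n) * a n)%C.
Proof. intros Ha. apply disk_coef_decr. exact (disk_coef_dcoef a Ha). Qed.

(** * Estimates for cosine and the cosine means of a power series *)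

Lemma cos_lipschitz (s t : R) : Rabs (cos s - cos t) <= Rabs (s - t).
Proof.
  destruct (MVT_gen cos t s (fun y => - sin y)) as [c [_ E]].
  - intros y _. auto_derive; [trivial|ring].
  - intros y _. apply continuity_cos.
  - rewrite E, Rabs_mult, Rabs_Ropp.
    assert (Rabs (sin c) <= 1) by (apply Rabs_le; pose proof (SIN_bound c); lra).
    pose proof (Rabs_pos (s - t)). nra.
Qed.

Lemma sin_lipschitz (s t : R) : Rabs (sin s - sin t) <= Rabs (s - t).
Proof.
  rewrite <- !cos_shift. replace (Rabs (s - t)) with (Rabs (PI / 2 - s - (PI / 2 - t))).
  - apply cos_lipschitz.
  - rewrite <- Rabs_Ropp. f_equal. ring.
Qed.

Lemma Rabs_le_between_0 (c x : R) : Rmin 0 x <= c <= Rmax 0 x -> Rabs c <= Rabs x.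
Proof.
  unfold Rmin, Rmax. destruct (Rle_dec 0 x); unfold Rabs; repeat destruct Rcase_abs; lra.
Qed.

(** The derivative 1 - cos c = 2 sin(c/2)^2 is at most c^2. Crude constants suffice here and in
    [cos_taylor2], because only the order of the error matters later. *)
Lemma sin_sub_le (x : R) : Rabs (x - sin x) <= Rabs x ^ 3.
Proof.
  destruct (MVT_gen (fun y => y - sin y) 0 x (fun y => 1 - cos y)) as [c [Hc E]].
  - intros y _. auto_derive; [trivial|ring].
  - intros y _. apply continuity_pt_minus; [apply continuity_pt_id|apply continuity_sin].
  - rewrite sin_0, !Rminus_0_r in E. rewrite E, Rabs_mult.
    apply Rabs_le_between_0 in Hc.
    assert (H : Rabs (1 - cos c) <= Rabs c ^ 2).
    { replace c with (2 * (c / 2)) at 1 by field. rewrite cos_2a_sin.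
      replace (1 - (1 - 2 * sin (c / 2) * sin (c / 2))) with (2 * sin (c / 2) ^ 2) by ring.
      pose proof (sin_lipschitz (c / 2) 0) as Hs. rewrite sin_0, !Rminus_0_r in Hs.
      apply (conj (Rabs_pos _)), (fun H => pow_incr _ _ 2 H) in Hs.
      rewrite Rabs_pos_eq by (pose proof (pow2_ge_0 (sin (c / 2))); lra).
      rewrite !pow2_abs in *. nra. }
    pose proof (Rabs_pos c). pose proof (Rabs_pos x).
    assert (Rabs c ^ 2 <= Rabs x ^ 2) by (apply pow_incr; lra).
    simpl pow in *. nra.
Qed.

Lemma cos_taylor2 (x : R) : Rabs (cos x - 1 + x ^ 2 / 2) <= x ^ 4.
Proof.
  destruct (MVT_gen (fun y => cos y - 1 + y ^ 2 / 2) 0 x (fun y => y - sin y)) as [c [Hc E]].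
  - intros y _. auto_derive; [trivial|field].
  - intros y _. apply continuity_pt_filterlim,
      (ex_derive_continuous (V := R_NormedModule) (fun y => cos y - 1 + y ^ 2 / 2)).
    auto_derive. trivial.
  - rewrite cos_0 in E.
    replace (cos x - 1 + x ^ 2 / 2) with ((c - sin c) * (x - 0)) by (rewrite <- E; field).
    rewrite Rminus_0_r, Rabs_mult.
    apply Rabs_le_between_0 in Hc.
    pose proof (sin_sub_le c). pose proof (Rabs_pos c). pose proof (Rabs_pos x).
    assert (Rabs c ^ 3 <= Rabs x ^ 3) by (apply pow_incr; lra).
    replace (x ^ 4) with (Rabs x ^ 3 * Rabs x).
    + apply Rmult_le_compat_r; lra.
    + replace (Rabs x ^ 3 * Rabs x) with ((Rabs x ^ 2) * (Rabs x ^ 2)) by ring.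
      rewrite pow2_abs. ring.
Qed.

Definition coscoef (t : R) (a : nat -> C) (n : nat) : C := (RtoC (cos (INR n * t)) * a n)%C.

Lemma disk_coef_coscoef (t : R) (a : nat -> C) : disk_coef a -> disk_coef (coscoef t a).
Proof.
  apply (disk_coef_le _ _ 1); [|lra]. intros n. unfold coscoef.
  rewrite Cmod_mult, Cmod_R. apply Rmult_le_compat_r; [apply Cmod_ge_0|].
  apply Rabs_le. pose proof (COS_bound (INR n * t)). lra.
Qed.

Lemma psf_coscoef (t : R) (a : nat -> C) (z : C) :
  disk_coef a -> Cmod z < 1 ->
  psf (coscoef t a) z = (/ 2 * (psf a (cis t * z) + psf a (cis (- t) * z)))%C.
Proof.
  intros Ha Hz. assert (Hc : forall s, Cmod (cis s * z)%C < 1)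
    by (intros s; now rewrite Cmod_cis_mult).
  unfold psf. rewrite <- Csum_plus by auto using psf_summable.
  rewrite <- Csum_scal by auto using Csummable_plus, psf_summable.
  apply Csum_ext. intros n. rewrite !Cpow_mult_l, !cis_pow.
  replace (/ 2 * (a n * (cis (INR n * t) * z ^ n) + a n * (cis (INR n * - t) * z ^ n)))%C
    with (/ 2 * (cis (INR n * t) + cis (INR n * - t)) * a n * z ^ n)%C by ring.
  unfold coscoef. do 2 f_equal.
  replace (INR n * - t) with (- (INR n * t)) by ring.
  unfold cis. rewrite cos_neg, sin_neg.
  rewrite <- RtoC_inv by lra. unfold RtoC, Cmult, Cplus; simpl. f_equal; field.
Qed.

(** Termwise, cos(n t) = 1 - (n t)^2 / 2 + O((n t)^4). The second-order series is (z d/dz)^2 applied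
    to [a], and the error is summable because n^4 a_n still satisfies [disk_coef]. *)
Lemma psf_coscoef_expansion (a : nat -> C) (z : C) :
  disk_coef a -> Cmod z < 1 ->
  exists K, 0 <= K /\ forall t,
    Cmod (psf (coscoef t a) z - psf a z
      + RtoC (t ^ 2 / 2) * psf (fun n => RtoC (INR n) * (RtoC (INR n) * a n)) z)%C <= K * t ^ 4.
Proof.
  intros Ha Hz. pose proof (Cmod_ge_0 z).
  set (b := (fun n => RtoC (INR n) * (RtoC (INR n) * a n))%C).
  assert (Hb : disk_coef b) by (apply disk_coef_INR, disk_coef_INR, Ha).
  set (c := (fun n => RtoC (INR n) * (RtoC (INR n) * b n))%C).
  assert (Hc : disk_coef c) by (apply disk_coef_INR, disk_coef_INR, Hb).
  pose proof (disk_coef_ex_series c (Cmod z) Hc ltac:(lra)) as Hex.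
  exists (Series (fun n => Cmod (c n) * Cmod z ^ n)). split.
  { apply Series_nonneg; [|exact Hex]. intros n.
    apply Rmult_le_pos; [apply Cmod_ge_0|apply pow_le; lra]. }
  intros t. rewrite Rmult_comm, <- Series_scal_l.
  pose proof (psf_summable (coscoef t a) z (disk_coef_coscoef t a Ha) Hz) as S1.
  pose proof (psf_summable a z Ha Hz) as S2.
  pose proof (psf_summable b z Hb Hz) as S3.
  unfold psf. rewrite <- (Csum_minus _ _ S1 S2), <- (Csum_scal (RtoC (t ^ 2 / 2)) _ S3).
  rewrite <- (Csum_plus _ _ (Csummable_minus _ _ S1 S2) (Csummable_scal _ _ S3)).
  apply Cmod_Csum_bound; [|exact (ex_series_Rmult (t ^ 4) _ Hex)].
  intros n. unfold coscoef.
  replace (RtoC (cos (INR n * t)) * a n * z ^ n - a n * z ^ n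
     + RtoC (t ^ 2 / 2) * (b n * z ^ n))%C
    with (RtoC (cos (INR n * t) - 1 + (INR n * t) ^ 2 / 2) * (a n * z ^ n))%C.
  2:{ unfold b. replace ((INR n * t) ^ 2 / 2) with (t ^ 2 / 2 * (INR n * INR n)) by field.
      rewrite RtoC_plus, RtoC_minus, !RtoC_mult. ring. }
  unfold c, b. rewrite !Cmod_mult, Cmod_pow, Cmod_R, (Cmod_Rpos (INR n)) by apply pos_INR.
  replace (t ^ 4 * (INR n * (INR n * (INR n * (INR n * Cmod (a n)))) * Cmod z ^ n))
    with ((INR n * t) ^ 4 * (Cmod (a n) * Cmod z ^ n)) by ring.
  apply Rmult_le_compat_r; [|apply cos_taylor2].
  apply Rmult_le_pos; [apply Cmod_ge_0|apply pow_le; lra].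
Qed.

(** The cosine mean of f at z is f(v) with |v| <= |z| by subordination, and v = z - (t^2 / 2) D2 /
    f'(z) + O(t^4), where D2 = (z d/dz)^2 f = z (z f')'. As t tends to 0, Re(conj z (v - z)) <= 0
    becomes |z|^2 Re((z f')' / f') >= 0, and (z f')' / f' = 1 + z f'' / f'. *)
Lemma convex_Re_pos (a : nat -> C) (z : C) :
  disk_coef a -> inj_psf a ->
  (forall z1 z2, Cmod z1 < 1 -> Cmod z2 < 1 ->
     exists z3, Cmod z3 < 1 /\ psf a z3 = (/ 2 * (psf a z1 + psf a z2))%C) ->
  Cmod z < 1 ->
  0 <= Re (psf (fun n => RtoC (INR (S n)) * dcoef a n)%C z / psf (dcoef a) z)%C.
Proof.
  intros Ha Hinj Hconv Hz.
  set (N := (fun n => RtoC (INR (S n)) * dcoef a n)%C).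
  assert (HN : disk_coef N) by exact (disk_coef_incr _ (disk_coef_INR _ (disk_coef_INR a Ha))).
  pose proof (inj_deriv_neq_0 a z Ha Hinj Hz) as Hl.
  destruct (Ceq_dec z 0) as [Hz0|Hz0].
  (* At 0 the quotient is 1; elsewhere the argument ends by cancelling |z|^2. *)
  { rewrite Hz0 in *. rewrite !psf_0 in * by auto using disk_coef_dcoef.
    unfold N. simpl INR. rewrite Cmult_1_l. unfold Cdiv. rewrite Cinv_r by exact Hl.
    simpl. lra. }
  pose proof (proj1 (Cmod_gt_0 _) Hz0) as Hzp.
  set (l := psf (dcoef a) z) in *. pose proof (proj1 (Cmod_gt_0 _) Hl) as Hlp.
  set (D2 := psf (fun n => RtoC (INR n) * (RtoC (INR n) * a n))%C z).
  assert (ED2 : D2 = (z * psf N z)%C).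
  { unfold D2. rewrite psf_incr by auto using disk_coef_INR. simpl INR.
    rewrite Cmult_0_l, Cplus_0_l. reflexivity. }
  destruct (psf_coscoef_expansion a z Ha Hz) as [K1 [HK10 HK1]]. fold D2 in HK1.
  destruct (local_inverse a z Ha Hz Hl) as [del [K2 [Hdel [HK20 HK2]]]].
  destruct (psf_taylor2 a (Cmod z) Ha) as [K3 [HK30 HK3]]; [lra|].
  set (A := Cmod D2 + K1). assert (HA : 0 <= A) by (unfold A; pose proof (Cmod_ge_0 D2); lra).
  set (B := K1 + K3 * (K2 * A) ^ 2).
  assert (HB : 0 <= B).
  { unfold B. apply Rplus_le_le_0_compat; [lra|]. apply Rmult_le_pos; [lra|apply pow2_ge_0]. }
  assert (Hkey : forall t, 0 < t <= 1 -> A * t ^ 2 < del ->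
    - Re (Cconj z * (D2 / l))%C <= 2 * Cmod z * B / Cmod l * t ^ 2).
  { intros t Ht Htd.
    assert (Ht2 : 0 < t ^ 2 <= 1) by (simpl; nra).
    assert (Ht4 : t ^ 4 = t ^ 2 * t ^ 2) by ring.
    specialize (HK1 t). set (w := psf (coscoef t a) z) in *.
    set (T := RtoC (t ^ 2 / 2)) in *.
    assert (HT : Cmod T = t ^ 2 / 2) by (apply Cmod_Rpos; lra).
    assert (Hw : Cmod (w - psf a z)%C <= A * t ^ 2).
    { replace (w - psf a z)%C with ((w - psf a z + T * D2) - T * D2)%C by ring.
      eapply Rle_trans; [apply Cmod_sub_triangle|]. rewrite (Cmod_mult T), HT. unfold A.
      pose proof (Cmod_ge_0 D2). rewrite Ht4 in HK1.
      assert (K1 * (t ^ 2 * t ^ 2) <= K1 * (t ^ 2 * 1)) by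
        (apply Rmult_le_compat_l; [lra|]; apply Rmult_le_compat_l; lra).
      nra. }
    destruct (HK2 w ltac:(lra)) as [v [Hv1 [Hv2 Hv3]]].
    assert (Hvz : Cmod v <= Cmod z).
    { apply (subordination_schwarz a (coscoef t a)); auto using disk_coef_coscoef.
      - unfold coscoef. simpl INR. rewrite Rmult_0_l, cos_0. ring.
      - unfold coscoef. rewrite Cmod_mult, Cmod_R.
        rewrite <- (Rmult_1_l (Cmod (a 1%nat))) at 2.
        apply Rmult_le_compat_r; [apply Cmod_ge_0|].
        apply Rabs_le. pose proof (COS_bound (INR 1 * t)). lra.
      - intros x Hx. assert (Hcx : forall s, Cmod (cis s * x)%C < 1)
          by (intros s; now rewrite Cmod_cis_mult).
        destruct (Hconv _ _ (Hcx t) (Hcx (- t))) as [y [Hy E]]. exists y.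
        split; [exact Hy|]. now rewrite psf_coscoef. }
    set (k := (v - z)%C) in *.
    assert (Hvk : v = (z + k)%C) by (unfold k; ring).
    assert (Hk : Cmod k <= K2 * A * t ^ 2).
    { eapply Rle_trans; [exact Hv2|]. rewrite Rmult_assoc. now apply Rmult_le_compat_l. }
    assert (Hlk : Cmod (l * k + T * D2)%C <= B * t ^ 4).
    { specialize (HK3 z k (Rle_refl _)). rewrite <- Hvk, Hv3 in HK3. specialize (HK3 Hvz).
      fold l in HK3.
      replace (l * k + T * D2)%C with ((w - psf a z + T * D2) - (w - psf a z - l * k))%C by ring.
      eapply Rle_trans; [apply Cmod_sub_triangle|]. unfold B.
      assert (Cmod k ^ 2 <= (K2 * A * t ^ 2) ^ 2)
        by (apply pow_incr; split; [apply Cmod_ge_0|exact Hk]).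
      assert (K3 * Cmod k ^ 2 <= K3 * (K2 * A * t ^ 2) ^ 2) by (apply Rmult_le_compat_l; lra).
      replace ((K1 + K3 * (K2 * A) ^ 2) * t ^ 4) with (K1 * t ^ 4 + K3 * (K2 * A * t ^ 2) ^ 2) by ring.
      lra. }
    (* Expanding |z + k|^2 <= |z|^2 bounds 2 Re(conj z k) by -|k|^2. *)
    assert (Hre : Re (Cconj z * k)%C <= 0).
    { assert (Cmod v ^ 2 <= Cmod z ^ 2) by (apply pow_incr; split; [apply Cmod_ge_0|exact Hvz]).
      rewrite Hvk, Cmod_sqr_sum in H. pose proof (pow2_ge_0 (Cmod k)). lra. }
    assert (HX : Cmod (Cconj z * ((l * k + T * D2) / l))%C <= Cmod z * (B * t ^ 4 / Cmod l)).
    { rewrite Cmod_mult, Cmod_conj, Cmod_div by exact Hl.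
      apply Rmult_le_compat_l; [lra|]. apply Rmult_le_compat_r; [|exact Hlk].
      left. now apply Rinv_0_lt_compat. }
    replace (Cconj z * ((l * k + T * D2) / l))%C
      with (Cconj z * k + T * (Cconj z * (D2 / l)))%C in HX by (field; exact Hl).
    pose proof (re_le_Cmod (Cconj z * k + T * (Cconj z * (D2 / l)))%C) as HY.
    rewrite re_plus in HY. unfold T in HY at 1. rewrite re_scal_l in HY.
    set (X := Re (Cconj z * (D2 / l))%C) in *.
    apply Rabs_le_between in HY.
    assert (Hfin : - (t ^ 2 / 2 * X) <= Cmod z * (B * t ^ 4 / Cmod l)) by lra.
    apply Rmult_le_reg_l with (t ^ 2 / 2); [lra|].
    replace (t ^ 2 / 2 * (2 * Cmod z * B / Cmod l * t ^ 2)) with (Cmod z * (B * t ^ 4 / Cmod l))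
      by (field; lra). lra. }
  assert (Hx : 0 <= Re (Cconj z * (D2 / l))%C).
  { set (X := Re (Cconj z * (D2 / l))%C) in *.
    assert (- X <= 0); [|lra]. apply Rle_plus_epsilon. intros eps He.
    set (E := 2 * Cmod z * B / Cmod l) in *.
    assert (HE : 0 <= E) by (apply Rdiv_le_0_compat; [|lra]; nra).
    destruct (exists_scaled_le E (2 * A) 1 eps del 1) as [t [Ht0 [Q1 [Q2 Q3]]]]; try lra.
    assert (t ^ 2 <= t) by (simpl; nra).
    assert (Hd : A * t ^ 2 < del).
    { assert (A * t ^ 2 <= A * t) by (apply Rmult_le_compat_l; lra). lra. }
    specialize (Hkey t ltac:(lra) Hd).
    assert (E * t ^ 2 <= E * t) by (apply Rmult_le_compat_l; lra). lra. }
  rewrite ED2 in Hx.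
  replace (Cconj z * (z * psf N z / l))%C with (RtoC (Cmod z ^ 2) * (psf N z / l))%C in Hx.
  2:{ rewrite Cmod2_conj. field. exact Hl. }
  rewrite re_scal_l in Hx.
  assert (0 < Cmod z ^ 2) by (apply pow_lt; lra). nra.
Qed.

(** * Circle means *)

Lemma rderiv_circle (r t : R) : rderiv (fun s => r * cis s)%C t (r * (Ci * cis t))%C.
Proof.
  apply rderiv_intro; unfold Re, Im, cis, Cmult, Ci, RtoC; simpl;
    auto_derive; try trivial; ring.
Qed.

Lemma cis_lipschitz (s t : R) : Cmod (cis s - cis t)%C <= 2 * Rabs (s - t).
Proof.
  eapply Rle_trans; [apply Cmod_le_Re_Im|].
  pose proof (cos_lipschitz s t). pose proof (sin_lipschitz s t).
  change (Rabs (cos s - cos t) + Rabs (sin s - sin t) <= 2 * Rabs (s - t)). lra.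
Qed.

Lemma ccont_polar (g : C -> C) (x y : R) :
  ccont g (x * cis y)%C -> forall eps : posreal,
  locally_2d (fun u v => Cmod (g (u * cis v) - g (x * cis y))%C < eps) x y.
Proof.
  intros Hg eps. destruct (Hg eps (cond_pos eps)) as [d [Hd H1]].
  assert (Hd' : 0 < d / (2 * Rabs x + 2)).
  { apply Rdiv_lt_0_compat; [exact Hd|]. pose proof (Rabs_pos x). lra. }
  exists (mkposreal _ Hd'). simpl. intros u v Hu Hv.
  replace (u * cis v)%C with (x * cis y + (u * cis v - x * cis y))%C by ring.
  apply H1.
  replace (u * cis v - x * cis y)%C with ((u - x) * cis v + x * (cis v - cis y))%C by ring.
  eapply Rle_lt_trans; [apply Cmod_triangle|].
  rewrite !Cmod_mult, Cmod_cis, <- RtoC_minus, !Cmod_R.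
  pose proof (cis_lipschitz v y). pose proof (Rabs_pos x).
  assert (Rabs x * Cmod (cis v - cis y)%C <= Rabs x * (2 * (d / (2 * Rabs x + 2)))).
  { apply Rmult_le_compat_l; lra. }
  assert (d / (2 * Rabs x + 2) * (2 * Rabs x + 2) = d) by (field; lra). lra.
Qed.

Lemma continuity_2d_Re_polar (g : C -> C) (x y : R) :
  ccont g (x * cis y)%C -> continuity_2d_pt (fun u v => Re (g (u * cis v)%C)) x y.
Proof.
  intros Hg eps. generalize (ccont_polar g x y Hg eps). apply locally_2d_impl, locally_2d_forall.
  intros u v H. eapply Rle_lt_trans; [|exact H]. eapply Rle_trans; [|apply re_le_Cmod].
  right. f_equal.
Qed.

Lemma ccont_Re_circle (g : C -> C) (x y : R) :
  ccont g (x * cis y)%C -> continuous (fun v => Re (g (x * cis v)%C)) y.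
Proof.
  intros Hg. apply continuity_pt_filterlim.
  intros eps He. destruct (ccont_polar g x y Hg (mkposreal eps He)) as [d Hd].
  exists d. split; [apply cond_pos|]. intros v [_ Hv].
  assert (H : Cmod (g (x * cis v) - g (x * cis y))%C < eps).
  { apply Hd; [|exact Hv]. replace (x - x) with 0 by ring. rewrite Rabs_R0. apply cond_pos. }
  eapply Rle_lt_trans; [|exact H]. eapply Rle_trans; [|apply re_le_Cmod].
  right. reflexivity.
Qed.

Lemma Cmod_polar (r t : R) : Cmod (r * cis t)%C = Rabs r.
Proof. now rewrite Cmod_mult, Cmod_cis, Cmod_R, Rmult_1_r. Qed.

(* d/dx Q (x cis t) = (1 / (i x)) d/dt Q (x cis t), so the circle mean does not depend on x. *)
Lemma circle_mean (Q Q1 : C -> C) (r : R) :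
  (forall z, Cmod z < 1 -> cderiv Q z (Q1 z)) -> (forall z, Cmod z < 1 -> ccont Q1 z) ->
  0 < r < 1 ->
  is_RInt (fun t => Re (Q (r * cis t)%C)) 0 (2 * PI) (2 * PI * Re (Q 0%C)).
Proof.
  intros HQ HQ1 Hr. pose proof PI_RGT_0 as Hpi.
  set (f := fun x t => Re (Q (RtoC x * cis t)%C)).
  assert (Hin : forall x t, Rabs x < 1 -> Cmod (RtoC x * cis t)%C < 1)
    by (intros; now rewrite Cmod_polar).
  assert (Hcont : forall x, Rabs x < 1 -> ex_RInt (fun t => f x t) 0 (2 * PI)).
  { intros x Hx. apply (ex_RInt_continuous (V := R_CompleteNormedModule)).
    intros t _. apply ccont_Re_circle. eapply cderiv_ccont, HQ. now apply Hin. }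
  set (f1 := fun x t => Re (Q1 (RtoC x * cis t) * cis t)%C).
  assert (Hf1 : forall x t, Rabs x < 1 -> is_derive (fun u => f u t) x (f1 x t)).
  { intros x t Hx. apply (rderiv_Re (fun u => Q (RtoC u * cis t)%C)).
    apply (rderiv_comp Q (fun u => RtoC u * cis t)%C); [apply rderiv_line|].
    now apply HQ, Hin. }
  assert (Hloc : forall x, Rabs x < 1 -> locally x (fun y => Rabs y < 1)).
  { intros x Hx. assert (Hd : 0 < 1 - Rabs x) by lra. exists (mkposreal _ Hd).
    intros y Hy. change (Rabs (y - x) < 1 - Rabs x) in Hy.
    pose proof (Rabs_triang_inv y x). lra. }
  (* The factor cis t is written as z / x, so that the integrand becomes a continuous function of
     the point z. *)
  assert (Cf1 : forall x t, Rabs x < 1 -> ccont (fun z => Q1 z * (z / RtoC x))%C (RtoC x * cis t)%C).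
  { intros x t Hx. apply ccont_mult; [now apply HQ1, Hin|].
    apply ccont_mult; [apply ccont_id|apply ccont_const]. }
  assert (HM : forall x, Rabs x < 1 ->
    is_derive (fun x => RInt (fun t => f x t) 0 (2 * PI)) x
      (RInt (fun t => Derive (fun u => f u t) x) 0 (2 * PI))).
  { intros x Hx. apply is_derive_RInt_param.
    - generalize (Hloc x Hx). apply filter_imp. intros y Hy t _. eexists. now apply Hf1.
    - intros t _. apply continuity_2d_pt_ext_loc with (f := f1).
      + destruct (Hloc x Hx) as [d Hd]. exists d. intros u v Hu _.
        symmetry. apply is_derive_unique, Hf1. now apply Hd.
      + apply continuity_2d_pt_ext with (f := fun u v =>
          Re (Q1 (RtoC u * cis v)%C) * cos v + Re (Ci * Q1 (RtoC u * cis v)%C) * sin v).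
        * intros u v. unfold f1, Re, cis, Cmult, Ci; simpl. ring.
        * assert (Hcont1 : ccont Q1 (RtoC x * cis t)%C) by now apply HQ1, Hin.
          assert (Hcs : forall g : R -> R, continuity g ->
            continuity_2d_pt (fun _ v => g v) x t).
          { intros g Hg. apply (continuity_1d_2d_pt_comp g (fun _ v => v)).
            - apply Hg.
            - apply continuity_2d_pt_id2. }
          apply continuity_2d_pt_plus; apply continuity_2d_pt_mult.
          -- now apply continuity_2d_Re_polar.
          -- apply Hcs, continuity_cos.
          -- apply (continuity_2d_Re_polar (fun z => Ci * Q1 z)%C).
             apply ccont_mult; [apply ccont_const|exact Hcont1].
          -- apply Hcs, continuity_sin.
    - generalize (Hloc x Hx). apply filter_imp. intros y Hy. now apply Hcont. }
  (* The angular antiderivative carries the factor 1 / x, so the derivative of the mean is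
     identified for x > 0 only; at the endpoint 0 the mean value theorem asks just for continuity,
     which [HM] gives. *)
  assert (HM0 : forall x, 0 < x < 1 ->
    is_derive (fun x => RInt (fun t => f x t) 0 (2 * PI)) x 0).
  { intros x Hx. assert (Hx1 : Rabs x < 1) by (rewrite Rabs_pos_eq; lra).
    assert (Hxn : RtoC x <> 0%C) by (intros E; apply RtoC_inj in E; lra).
    assert (E : RInt (fun t => Derive (fun u => f u t) x) 0 (2 * PI) = 0);
      [|pose proof (HM x Hx1) as D; rewrite E in D; exact D].
    apply is_RInt_unique.
    apply is_RInt_ext with (f := fun t => f1 x t).
    { intros t _. symmetry. now apply is_derive_unique, Hf1. }
    replace 0 with (minus (/ x * Im (Q (RtoC x * cis (2 * PI))%C))
                          (/ x * Im (Q (RtoC x * cis 0)%C))) at 2.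
    2:{ unfold cis. rewrite cos_2PI, sin_2PI, cos_0, sin_0. exact (Rminus_diag_eq _ _ eq_refl). }
    apply (is_RInt_derive (fun t => / x * Im (Q (RtoC x * cis t)%C))).
    - intros t _. unfold f1.
      replace (Re (Q1 (x * cis t) * cis t)%C)
        with (/ x * Im (Q1 (x * cis t) * (x * (Ci * cis t)))%C).
      + apply (is_derive_scal (fun t => Im (Q (RtoC x * cis t)%C))).
        apply (rderiv_Im (fun t => Q (RtoC x * cis t)%C)).
        apply (rderiv_comp Q (fun t => RtoC x * cis t)%C); [apply rderiv_circle|].
        now apply HQ, Hin.
      + unfold Re, Im, Cmult, Ci, RtoC; simpl. field. lra.
    - intros t _.
      apply continuous_ext with (f := fun t => Re (Q1 (x * cis t) * ((x * cis t) / x))%C).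
      { intros s. unfold f1. do 2 f_equal. field. exact Hxn. }
      apply (ccont_Re_circle (fun z => Q1 z * (z / x))%C). now apply Cf1. }
  destruct (MVT_gen (fun x => RInt (fun t => f x t) 0 (2 * PI)) 0 r (fun _ => 0)) as [c [_ E]].
  - intros x Hx. rewrite Rmin_left, Rmax_right in Hx by lra. apply HM0. lra.
  - intros x Hx. rewrite Rmin_left, Rmax_right in Hx by lra.
    apply continuity_pt_filterlim, (ex_derive_continuous (V := R_NormedModule)
      (fun x => RInt (fun t => f x t) 0 (2 * PI))).
    eexists. apply HM. rewrite Rabs_pos_eq; lra.
  - rewrite Rmult_0_l in E.
    assert (E0 : RInt (fun t => f 0 t) 0 (2 * PI) = 2 * PI * Re (Q 0%C)).
    { rewrite (RInt_ext _ (fun _ => Re (Q 0%C))).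
      - rewrite RInt_const. unfold scal; simpl. unfold mult; simpl. ring.
      - intros t _. unfold f. now rewrite Cmult_0_l. }
    rewrite <- E0. replace (RInt (fun t => f 0 t) 0 (2 * PI))
      with (RInt (fun t => f r t) 0 (2 * PI)) by lra.
    apply (RInt_correct (V := R_CompleteNormedModule)), Hcont. rewrite Rabs_pos_eq; lra.
Qed.

Lemma circle_mean_quot (N H : nat -> C) (c : C) (r : R) :
  disk_coef N -> disk_coef H -> (forall z, Cmod z < 1 -> psf H z <> 0) -> H O = 1%C ->
  0 < r < 1 ->
  is_RInt (fun t => Re (c * (psf N (r * cis t) / psf H (r * cis t)))%C) 0 (2 * PI)
    (2 * PI * Re (c * N O)%C).
Proof.
  intros HN HH Hnz H0 Hr.
  set (Q1 := fun z => (c * ((psf (dcoef N) z * psf H z - psf N z * psf (dcoef H) z)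
    / (psf H z * psf H z)))%C).
  replace (c * N O)%C with (c * (psf N 0 / psf H 0))%C.
  2:{ rewrite !psf_0, H0 by assumption. field. }
  apply (circle_mean (fun z => c * (psf N z / psf H z))%C Q1).
  - intros z Hz. apply cderiv_scal, cderiv_div; auto using psf_cderiv.
  - intros z Hz.
    assert (Hc : forall a, disk_coef a -> ccont (psf a) z)
      by (intros a Ha; eapply cderiv_ccont; apply psf_cderiv; assumption).
    unfold Q1. apply ccont_mult; [apply ccont_const|]. apply ccont_mult.
    + apply ccont_plus; [apply ccont_mult; auto using disk_coef_dcoef|].
      apply (ccont_ext_loc (fun z => (-1) * (psf N z * psf (dcoef H) z))%C _ _ 1 Rlt_0_1).
      * intros h _. ring.
      * apply ccont_mult; [apply ccont_const|apply ccont_mult; auto using disk_coef_dcoef].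
    + apply (ccont_inv (fun z => psf H z * psf H z)%C);
        [apply Cmult_neq_0; auto|apply ccont_mult; auto].
  - exact Hr.
Qed.

Lemma is_RInt_cis (c : C) (m : nat) :
  is_RInt (fun t => Re (c * cis (- (INR (S m) * t)))%C) 0 (2 * PI) 0.
Proof.
  set (k := INR (S m)). assert (Hk : k <> 0) by (apply not_0_INR; lia).
  assert (Hper : cis (k * (2 * PI)) = cis (k * 0)).
  { unfold k. rewrite <- !cis_pow. unfold cis at 1 2. now rewrite cos_2PI, sin_2PI, cos_0, sin_0. }
  set (F := fun t => (Re c * sin (k * t) - Im c * cos (k * t)) / k).
  replace 0 with (minus (F (2 * PI)) (F 0)) at 2.
  2:{ unfold F. injection Hper as -> ->. exact (Rminus_diag_eq _ _ eq_refl). }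
  apply (is_RInt_derive F).
  - intros t _. unfold F, Re, Im, cis, Cmult; simpl. rewrite cos_neg, sin_neg.
    auto_derive; [trivial|]. field. exact Hk.
  - intros t _. unfold Re, cis, Cmult; simpl.
    apply (ex_derive_continuous (V := R_NormedModule)
      (fun t => fst c * cos (- (k * t)) - snd c * sin (- (k * t)))).
    auto_derive. trivial.
Qed.

(** * Coefficients of a quotient and positivity *)

(** Remainders of the long division of N by h when h 0 = 1: N / h = p_0 + ... + p_{k-1} z^(k-1) +
    z^k R_k / h, where R_k is [divseq h N k] and p_k = R_k(0). The quotient thus gets coefficients
    without a power series for 1 / h. *)
Fixpoint divseq (h N : nat -> C) (k : nat) : nat -> C :=
  match k with
  | O => N
  | S k => fun j => (divseq h N k (S j) - divseq h N k O * h (S j))%C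
  end.

Lemma disk_coef_divseq (h N : nat -> C) (k : nat) :
  disk_coef h -> disk_coef N -> disk_coef (divseq h N k).
Proof.
  intros Hh HN. induction k as [|k IH]; [exact HN|]. simpl.
  pose proof (disk_coef_plus _ _ (disk_coef_incr _ IH)
    (disk_coef_scal (- divseq h N k O)%C _ (disk_coef_incr _ Hh))) as A.
  refine (disk_coef_le _ _ 1 _ _ A); [|lra]. intros n. right. rewrite Rmult_1_l.
  f_equal. ring.
Qed.

Lemma psf_divseq (h N : nat -> C) (k : nat) (z : C) :
  disk_coef h -> disk_coef N -> h O = 1%C -> Cmod z < 1 ->
  psf (divseq h N k) z
    = (divseq h N k O * psf h z + z * psf (divseq h N (S k)) z)%C.
Proof.
  intros Hh HN H0 Hz. pose proof (disk_coef_divseq h N k Hh HN) as Hk.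
  rewrite (psf_incr (divseq h N k) z), (psf_incr h z) by assumption. rewrite H0.
  rewrite (psf_ext (divseq h N (S k))
    (fun j => divseq h N k (S j) + (- divseq h N k O) * h (S j))%C)
    by (intros j; simpl; ring).
  rewrite psf_plus, psf_scal; auto using disk_coef_scal, (disk_coef_incr h), (disk_coef_incr (divseq h N k)).
  ring.
Qed.

(** Induction along the long division: the leading coefficient p_j integrates to 0 against exp(-i
    (k+1) t), and the factor z = r exp(i t) in front of the next remainder lowers the frequency by
    one. *)
Lemma is_RInt_neg_moment (h N : nat -> C) (r : R) (k j : nat) (tau : C) :
  disk_coef h -> disk_coef N -> (forall z, Cmod z < 1 -> psf h z <> 0) -> h O = 1%C ->
  0 < r < 1 ->
  is_RInt (fun t => Re (tau * cis (- (INR k * t))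
      * (psf (divseq h N j) (r * cis t) / psf h (r * cis t)))%C) 0 (2 * PI)
    (2 * PI * Re (tau * divseq h N (j + k) O * r ^ k)%C).
Proof.
  intros Hh HN Hnz H0 Hr. revert j tau.
  induction k as [|k IH]; intros j tau.
  - rewrite Nat.add_0_r. simpl Cpow. rewrite Cmult_1_r.
    eapply is_RInt_ext; [|apply (circle_mean_quot (divseq h N j) h tau r);
      auto using disk_coef_divseq].
    intros t _. simpl INR. rewrite Rmult_0_l, Ropp_0, cis_0. cbv beta. do 2 f_equal. now rewrite Cmult_1_r.
  - replace (2 * PI * Re (tau * divseq h N (j + S k) O * r ^ S k)%C)
      with (plus 0 (2 * PI * Re (tau * r * divseq h N (S j + k) O * r ^ k)%C)).
    2:{ etransitivity; [apply Rplus_0_l|]. do 2 f_equal.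
        replace (j + S k)%nat with (S j + k)%nat by lia. rewrite Cpow_S. ring. }
    eapply is_RInt_ext; [|apply (is_RInt_plus (V := R_NormedModule));
      [apply (is_RInt_cis (tau * divseq h N j O)%C k)|apply (IH (S j) (tau * r)%C)]].
    intros t _. cbv beta.
    assert (Hz : Cmod (r * cis t)%C < 1) by (rewrite Cmod_polar, Rabs_pos_eq; lra).
    change (Re (tau * divseq h N j 0 * cis (- (INR (S k) * t)))%C
      + Re (tau * r * cis (- (INR k * t)) * (psf (divseq h N (S j)) (r * cis t) / psf h (r * cis t)))%C
      = Re (tau * cis (- (INR (S k) * t)) * (psf (divseq h N j) (r * cis t) / psf h (r * cis t)))%C).
    rewrite <- re_plus. f_equal.
    rewrite (psf_divseq h N j) by assumption.
    replace (- (INR k * t)) with (- (INR (S k) * t) + t) by (rewrite S_INR; ring).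
    rewrite cis_plus. field. now apply Hnz.
Qed.

Definition mulz (a : nat -> C) (n : nat) : C := match n with O => 0%C | S m => a m end.

Lemma disk_coef_mulz (a : nat -> C) (k : nat) : disk_coef a -> disk_coef (Nat.iter k mulz a).
Proof. intros Ha. induction k as [|k IH]; [exact Ha|]. apply disk_coef_decr. exact IH. Qed.

Lemma psf_mulz (a : nat -> C) (k : nat) (z : C) :
  disk_coef a -> Cmod z < 1 -> psf (Nat.iter k mulz a) z = (z ^ k * psf a z)%C.
Proof.
  intros Ha Hz. induction k as [|k IH].
  - simpl. ring.
  - rewrite psf_incr by auto using disk_coef_mulz.
    change (fun n => Nat.iter (S k) mulz a (S n)) with (Nat.iter k mulz a).
    rewrite IH. change (Nat.iter (S k) mulz a O) with (RtoC 0). rewrite Cpow_S. ring.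
Qed.

(** On the circle exp(i (k+1) t) is (z / r)^(k+1), so the mean is that of a multiple of z^(k+1) N /
    h, which vanishes at 0. *)
Lemma is_RInt_pos_moment (h N : nat -> C) (r : R) (k : nat) (tau : C) :
  disk_coef h -> disk_coef N -> (forall z, Cmod z < 1 -> psf h z <> 0) -> h O = 1%C ->
  0 < r < 1 ->
  is_RInt (fun t => Re (tau * cis (INR (S k) * t)
      * (psf N (r * cis t) / psf h (r * cis t)))%C) 0 (2 * PI) 0.
Proof.
  intros Hh HN Hnz H0 Hr.
  assert (Hrn : RtoC r <> 0%C) by (intros E; apply RtoC_inj in E; lra).
  replace 0 with (2 * PI * Re (tau / r ^ S k * Nat.iter (S k) mulz N O)%C) at 2.
  2:{ simpl. ring. }
  eapply is_RInt_ext; [|apply (circle_mean_quot _ h (tau / r ^ S k)%C r);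
      auto using disk_coef_mulz].
  intros t _. cbv beta. f_equal.
  assert (Hz : Cmod (r * cis t)%C < 1) by (rewrite Cmod_polar, Rabs_pos_eq; lra).
  rewrite psf_mulz, Cpow_mult_l, cis_pow by assumption.
  field. split; [now apply Hnz|now apply Cpow_nz].
Qed.

(** * Trigonometric polynomials and positivity of the coefficients *)

Fixpoint Rsum (f : nat -> R) (n : nat) : R :=
  match n with O => 0 | S m => Rsum f m + f m end.

Lemma Rsum_ext (f g : nat -> R) (n : nat) :
  (forall k, (k < n)%nat -> f k = g k) -> Rsum f n = Rsum g n.
Proof.
  induction n as [|n IH]; intros H; [reflexivity|]. simpl. rewrite IH, H; auto.
Qed.

(** [tau k] belongs to the frequency k + 1; the real part supplies the conjugate frequencies. *)
Definition trigpoly (t0 : R) (tau : nat -> C) (n : nat) (t : R) : R :=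
  t0 + Rsum (fun k => Re (tau k * cis (- (INR (S k) * t)))%C) n.

(* That is, 1, p 1 / 2, p 2 / 2, ... are the Fourier coefficients of a probability measure. *)
Definition positive_coefs (p : nat -> C) : Prop :=
  forall t0 tau n, (forall t, 0 <= trigpoly t0 tau n t) ->
    0 <= t0 + / 2 * Rsum (fun k => Re (tau k * p (S k))%C) n.

(** Integrate Re P times the polynomial over |z| = r, with P = N / h, and let r tend to 1. The
    factor 1/2 comes from Re P Re w = (Re(P w) + Re(P conj w)) / 2, where only one of the two
    moments of P is nonzero. *)
Lemma positive_coefs_quotient (h N : nat -> C) :
  disk_coef h -> disk_coef N -> (forall z, Cmod z < 1 -> psf h z <> 0) ->
  h O = 1%C -> N O = 1%C ->
  (forall z, Cmod z < 1 -> 0 <= Re (psf N z / psf h z)%C) ->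
  positive_coefs (fun k => divseq h N k O).
Proof.
  intros Hh HN Hnz H0 HN0 Hpos t0 tau n HT. pose proof PI_RGT_0 as Hpi.
  set (p := fun k => divseq h N k O).
  assert (Hr : forall r, 0 < r < 1 ->
    0 <= t0 + / 2 * Rsum (fun k => Re (tau k * p (S k))%C * r ^ S k) n).
  { intros r Hr.
    set (P := fun t => (psf N (r * cis t) / psf h (r * cis t))%C).
    assert (HI : is_RInt (fun t => Re (P t) * trigpoly t0 tau n t) 0 (2 * PI)
      (2 * PI * t0 + PI * Rsum (fun k => Re (tau k * p (S k))%C * r ^ S k) n)).
    { clear HT. induction n as [|n IH].
      - simpl. rewrite Rmult_0_r, Rplus_0_r.
        pose proof (circle_mean_quot N h (RtoC t0) r HN Hh Hnz H0 Hr) as A.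
        rewrite HN0, Cmult_1_r, re_RtoC in A. eapply is_RInt_ext; [|exact A].
        intros t _. cbv beta. rewrite re_scal_l. unfold trigpoly, P; simpl. ring.
      - pose proof (is_RInt_neg_moment h N r (S n) 0 (tau n) Hh HN Hnz H0 Hr) as A1.
        pose proof (is_RInt_pos_moment h N r n (Cconj (tau n)) Hh HN Hnz H0 Hr) as A2.
        pose proof (is_RInt_plus (V := R_NormedModule) _ _ _ _ _ _ IH
          (is_RInt_scal (V := R_NormedModule) _ _ _ (/ 2) _
            (is_RInt_plus (V := R_NormedModule) _ _ _ _ _ _ A1 A2))) as A.
        replace (2 * PI * t0 + PI * Rsum (fun k => Re (tau k * p (S k))%C * r ^ S k) (S n))
          with (plus (2 * PI * t0 + PI * Rsum (fun k => Re (tau k * p (S k))%C * r ^ S k) n)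
            (scal (/ 2) (plus (2 * PI * Re (tau n * divseq h N (0 + S n) O * r ^ S n)%C) 0))).
        + eapply is_RInt_ext; [|exact A]. intros t _. cbv beta.
          cbn [divseq]. fold (P t).
          change (Re (P t) * trigpoly t0 tau n t + / 2 *
             (Re (tau n * cis (- (INR (S n) * t)) * P t)%C
               + Re (Cconj (tau n) * cis (INR (S n) * t) * P t)%C)
            = Re (P t) * trigpoly t0 tau (S n) t).
          unfold trigpoly; cbn [Rsum].
          generalize (P t) (INR (S n) * t). intros w s.
          unfold cis, Re, Cconj, Cmult; simpl. rewrite cos_neg, sin_neg. field.
        + rewrite <- RtoC_pow, re_scal_r.
          change (2 * PI * t0 + PI * Rsum (fun k => Re (tau k * p (S k))%C * r ^ S k) n
            + / 2 * (2 * PI * (Re (tau n * divseq h N (0 + S n) 0)%C * r ^ S n) + 0)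
            = 2 * PI * t0 + PI * Rsum (fun k => Re (tau k * p (S k))%C * r ^ S k) (S n)).
          cbn [Rsum]. unfold p. rewrite Nat.add_0_l. field. }
    assert (H2 : 0 <= 2 * PI * t0 + PI * Rsum (fun k => Re (tau k * p (S k))%C * r ^ S k) n).
    { apply (is_RInt_le (fun _ => 0) (fun t => Re (P t) * trigpoly t0 tau n t) 0 (2 * PI)).
      - lra.
      - pose proof (is_RInt_const (V := R_NormedModule) 0 (2 * PI) 0) as A.
        change (is_RInt (fun _ : R => 0) 0 (2 * PI) ((2 * PI - 0) * 0)) in A.
        now rewrite Rmult_0_r in A.
      - exact HI.
      - intros t _. apply Rmult_le_pos; [|apply HT].
        assert (Hz : Cmod (r * cis t)%C < 1) by (rewrite Cmod_polar, Rabs_pos_eq; lra).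
        exact (Hpos _ Hz). }
    apply Rmult_le_reg_l with (2 * PI); [lra|]. rewrite Rmult_0_r.
    replace (2 * PI * (t0 + / 2 * Rsum (fun k => Re (tau k * p (S k))%C * r ^ S k) n))
      with (2 * PI * t0 + PI * Rsum (fun k => Re (tau k * p (S k))%C * r ^ S k) n) by field.
    exact H2. }
  set (g := fun r => t0 + / 2 * Rsum (fun k => Re (tau k * p (S k))%C * r ^ S k) n).
  assert (Hg : continuous g 1).
  { assert (Hs : forall m, ex_derive (fun r => Rsum (fun k => Re (tau k * p (S k))%C * r ^ S k) m) 1).
    { induction m as [|m IHm]; cbn [Rsum].
      - auto_derive. trivial.
      - apply (ex_derive_plus (V := R_NormedModule)
          (fun r => Rsum (fun k => Re (tau k * p (S k))%C * r ^ S k) m)); [exact IHm|].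
        auto_derive. trivial. }
    apply (ex_derive_continuous (V := R_NormedModule)). unfold g.
    apply (ex_derive_plus (V := R_NormedModule) (fun _ => t0)).
    - auto_derive. trivial.
    - apply (ex_derive_scal (fun r => Rsum (fun k => Re (tau k * p (S k))%C * r ^ S k) n)), Hs. }
  change (0 <= t0 + / 2 * Rsum (fun k => Re (tau k * p (S k))%C) n).
  replace (t0 + / 2 * Rsum (fun k => Re (tau k * p (S k))%C) n) with (g 1).
  2:{ unfold g. do 2 f_equal. apply Rsum_ext. intros k _. rewrite pow1. ring. }
  (* By continuity a negative value of g at 1 would persist at some r < 1. *)
  apply Rnot_lt_le. intros Hneg.
  destruct (proj1 (filterlim_locally g (g 1)) Hg (mkposreal (- g 1) ltac:(lra))) as [d Hd].
  set (r := 1 - Rmin (d / 2) (1 / 2)). pose proof (cond_pos d).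
  assert (Hr1 : 0 < Rmin (d / 2) (1 / 2)) by (apply Rmin_pos; lra).
  pose proof (Rmin_l (d / 2) (1 / 2)). pose proof (Rmin_r (d / 2) (1 / 2)).
  specialize (Hr r ltac:(unfold r; lra)). fold (g r) in Hr.
  assert (Hlt : Rabs (g r - g 1) < - g 1).
  { apply (Hd r). change (Rabs (r - 1) < d). unfold r. rewrite Rabs_left; lra. }
  apply Rabs_def2 in Hlt. lra.
Qed.

(** * The third Lebedev-Milin inequality *)

Fixpoint Csumn (f : nat -> C) (n : nat) : C :=
  match n with O => 0%C | S m => (Csumn f m + f m)%C end.

Lemma Csumn_S (f : nat -> C) (n : nat) : Csumn f (S n) = (Csumn f n + f n)%C.
Proof. reflexivity. Qed.

Lemma Csumn_ext (f g : nat -> C) (n : nat) :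
  (forall k, (k < n)%nat -> f k = g k) -> Csumn f n = Csumn g n.
Proof.
  induction n as [|n IH]; intros H; [reflexivity|]. simpl. rewrite IH, H; auto.
Qed.

Lemma Csumn_minus (f g : nat -> C) (n : nat) :
  Csumn (fun k => f k - g k)%C n = (Csumn f n - Csumn g n)%C.
Proof. induction n as [|n IH]; simpl; [ring|rewrite IH; ring]. Qed.

Lemma Csumn_scal (c : C) (f : nat -> C) (n : nat) :
  Csumn (fun k => c * f k)%C n = (c * Csumn f n)%C.
Proof. induction n as [|n IH]; simpl; [ring|rewrite IH; ring]. Qed.

Lemma Csumn_shift (f : nat -> C) (n : nat) :
  Csumn f (S n) = (f O + Csumn (fun k => f (S k)) n)%C.
Proof.
  induction n as [|n IH]; [simpl; ring|].
  change (Csumn f (S (S n))) with (Csumn f (S n) + f (S n))%C. rewrite IH. simpl. ring.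
Qed.

Lemma Rsum_shift (f : nat -> R) (n : nat) :
  Rsum f (S n) = f O + Rsum (fun k => f (S k)) n.
Proof.
  induction n as [|n IH]; [simpl; ring|].
  change (Rsum f (S (S n))) with (Rsum f (S n) + f (S n)). rewrite IH. simpl. ring.
Qed.

Lemma Rsum_rev (f : nat -> R) (n : nat) :
  Rsum (fun j => f (n - j)%nat) (S n) = Rsum f (S n).
Proof.
  induction n as [|n IH]; [reflexivity|].
  rewrite Rsum_shift. change (Rsum f (S (S n))) with (Rsum f (S n) + f (S n)).
  rewrite <- IH, Rplus_comm. f_equal.
Qed.

Lemma Rsum_nonneg (f : nat -> R) (n : nat) : (forall k, 0 <= f k) -> 0 <= Rsum f n.
Proof.
  intros H. induction n as [|n IH]; simpl; [lra|]. specialize (H n). lra.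
Qed.

Lemma Csumn_cauchy_schwarz (u v : nat -> C) (n : nat) :
  Cmod (Csumn (fun k => u k * v k)%C n) ^ 2
    <= Rsum (fun k => Cmod (u k) ^ 2) n * Rsum (fun k => Cmod (v k) ^ 2) n.
Proof.
  induction n as [|n IH].
  - simpl Csumn. rewrite Cmod_0. simpl. lra.
  - cbn [Csumn Rsum].
    set (s := Csumn (fun k => u k * v k)%C n) in *.
    assert (HA : 0 <= Rsum (fun k => Cmod (u k) ^ 2) n)
      by (apply Rsum_nonneg; intros; apply pow2_ge_0).
    assert (HB : 0 <= Rsum (fun k => Cmod (v k) ^ 2) n)
      by (apply Rsum_nonneg; intros; apply pow2_ge_0).
    set (A := Rsum _ n) in *. set (B := Rsum (fun k => Cmod (v k) ^ 2) n) in *.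
    pose proof (Cmod_triangle s (u n * v n)%C) as T. rewrite Cmod_mult in T.
    pose proof (Cmod_ge_0 (s + u n * v n)%C). pose proof (Cmod_ge_0 s).
    pose proof (Cmod_ge_0 (u n)). pose proof (Cmod_ge_0 (v n)).
    set (S := Cmod s) in *. set (x := Cmod (u n)) in *. set (y := Cmod (v n)) in *.
    (* The cross term: (2 S x y)^2 <= 4 A B x^2 y^2 <= (A y^2 + B x^2)^2, by the induction
       hypothesis and the arithmetic-geometric mean inequality. *)
    assert (Hm : 2 * S * (x * y) <= A * y ^ 2 + B * x ^ 2).
    { apply Rsqr_incr_0_var.
      - unfold Rsqr.
        assert (S ^ 2 * (x * y) ^ 2 <= A * B * (x * y) ^ 2)
          by (apply Rmult_le_compat_r; [apply pow2_ge_0|exact IH]).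
        pose proof (pow2_ge_0 (A * y ^ 2 - B * x ^ 2)) as Hsq.
        replace ((A * y ^ 2 + B * x ^ 2) * (A * y ^ 2 + B * x ^ 2))
          with ((A * y ^ 2 - B * x ^ 2) ^ 2 + 4 * (A * B * (x * y) ^ 2)) by ring.
        replace (2 * S * (x * y) * (2 * S * (x * y))) with (4 * (S ^ 2 * (x * y) ^ 2)) by ring.
        lra.
      - apply Rplus_le_le_0_compat; apply Rmult_le_pos; auto; apply pow2_ge_0. }
    apply Rle_trans with ((S + x * y) ^ 2); [apply pow_incr; split; assumption|].
    replace ((S + x * y) ^ 2) with (S ^ 2 + 2 * S * (x * y) + x ^ 2 * y ^ 2) by ring.
    replace ((A + x ^ 2) * (B + y ^ 2))
      with (A * B + (A * y ^ 2 + B * x ^ 2) + x ^ 2 * y ^ 2) by ring. lra.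
Qed.

(** The recursion says that gam is the coefficient sequence of exp(sum kap_j z^(j+1) / (j+1)).
    Cauchy-Schwarz gives m^2 |gam_m|^2 <= A_m B_m, and 1 + x <= exp x turns the products into
    exponents. *)
Lemma lebedev_milin (gam kap : nat -> C) (n : nat) :
  gam O = 1%C ->
  (forall m, RtoC (INR (S m)) * gam (S m) = Csumn (fun j => kap j * gam (m - j)%nat) (S m))%C ->
  Cmod (gam n) ^ 2 <= exp (Rsum (fun j => (Cmod (kap j) ^ 2 - 1) / INR (S j)) n).
Proof.
  intros H0 Hrec.
  set (c := fun j => Cmod (kap j) ^ 2 - 1).
  set (E := Rsum (fun j => c j / INR (S j))).
  set (A := Rsum (fun j => Cmod (kap j) ^ 2)).
  set (B := Rsum (fun j => Cmod (gam j) ^ 2)).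
  assert (HA : forall m, Rsum c m = A m - INR m).
  { induction m as [|m IH]; [unfold A; simpl; ring|].
    change (Rsum c (S m)) with (Rsum c m + c m). rewrite IH, S_INR.
    unfold c, A; simpl. ring. }
  assert (HA0 : forall m, 0 <= A m) by (intros; apply Rsum_nonneg; intros; apply pow2_ge_0).
  assert (HCS : forall m, INR (S m) ^ 2 * Cmod (gam (S m)) ^ 2 <= A (S m) * B (S m)).
  { intros m. rewrite <- Rpow_mult_distr, <- (Cmod_Rpos (INR (S m))) by apply pos_INR.
    rewrite <- Cmod_mult, Hrec. eapply Rle_trans; [apply Csumn_cauchy_schwarz|].
    right. f_equal. exact (Rsum_rev (fun j => Cmod (gam j) ^ 2) m). }
  (* This is the second Lebedev-Milin inequality: the exponent equals the mean of the partial sums E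
     0, ..., E m. *)
  assert (HB : forall m, B (S m) <= INR (S m) * exp (E (S m) - Rsum c (S m) / INR (S m))).
  { induction m as [|m IH].
    - unfold B, E; simpl. rewrite H0, Cmod_1.
      replace (0 + c 0%nat / 1 - (0 + c 0%nat) / 1) with 0 by field. rewrite exp_0. lra.
    - specialize (HCS m). set (k := INR (S m)) in *.
      assert (Hk : 1 <= k) by (unfold k; rewrite S_INR; pose proof (pos_INR m); lra).
      set (X := exp (E (S m) - Rsum c (S m) / k)) in *.
      assert (HX : 0 < X) by apply exp_pos.
      assert (HE : E (S (S m)) - Rsum c (S (S m)) / INR (S (S m))
        = (E (S m) - Rsum c (S m) / k) + (A (S m) - k) / (k * (k + 1))).
      { change (E (S (S m))) with (E (S m) + c (S m) / INR (S (S m))).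
        change (Rsum c (S (S m))) with (Rsum c (S m) + c (S m)).
        rewrite (S_INR (S m)). fold k. rewrite (HA (S m)). fold k. field. lra. }
      rewrite HE, exp_plus. fold X. rewrite (S_INR (S m)). fold k.
      pose proof (exp_ineq1_le ((A (S m) - k) / (k * (k + 1)))) as He.
      change (B (S (S m))) with (B (S m) + Cmod (gam (S m)) ^ 2).
      specialize (HA0 (S m)).
      assert (HB0 : 0 <= B (S m)) by (apply Rsum_nonneg; intros; apply pow2_ge_0).
      apply Rle_trans with ((k + 1) * (X * (1 + (A (S m) - k) / (k * (k + 1))))).
      + replace ((k + 1) * (X * (1 + (A (S m) - k) / (k * (k + 1)))))
          with (k * X * (1 + A (S m) / k ^ 2)) by (field; lra).
        apply Rle_trans with (B (S m) * (1 + A (S m) / k ^ 2)).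
        * assert (Cmod (gam (S m)) ^ 2 <= B (S m) * (A (S m) / k ^ 2)); [|lra].
          apply Rmult_le_reg_l with (k ^ 2); [apply pow_lt; lra|].
          replace (k ^ 2 * (B (S m) * (A (S m) / k ^ 2))) with (A (S m) * B (S m))
            by (field; lra). exact HCS.
        * apply Rmult_le_compat_r; [|exact IH].
          assert (0 <= A (S m) / k ^ 2) by (apply Rdiv_le_0_compat; [lra|apply pow_lt; lra]). lra.
      + apply Rmult_le_compat_l; [lra|]. apply Rmult_le_compat_l; lra. }
  destruct n as [|n].
  - simpl. rewrite H0, Cmod_1, exp_0. lra.
  - specialize (HCS n). specialize (HB n). specialize (HA0 (S n)).
    change (Cmod (gam (S n)) ^ 2 <= exp (E (S n))).
    set (k := INR (S n)) in *.
    assert (Hk : 1 <= k) by (unfold k; rewrite S_INR; pose proof (pos_INR n); lra).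
    set (X := exp (E (S n) - Rsum c (S n) / k)) in *.
    assert (HX : 0 < X) by apply exp_pos.
    replace (E (S n)) with ((E (S n) - Rsum c (S n) / k) + (A (S n) / k - 1)).
    2:{ rewrite HA. fold k. field. lra. }
    rewrite exp_plus. fold X.
    pose proof (exp_ineq1_le (A (S n) / k - 1)) as He.
    apply Rle_trans with (X * (A (S n) / k)); [|apply Rmult_le_compat_l; lra].
    apply Rmult_le_reg_l with (k ^ 2); [apply pow_lt; lra|].
    replace (k ^ 2 * (X * (A (S n) / k))) with (A (S n) * (k * X)) by (field; lra).
    eapply Rle_trans; [exact HCS|]. apply Rmult_le_compat_l; assumption.
Qed.

(** * Successive coefficients of starlike functions *)

Lemma Rsum_lin (a b : R) (f g : nat -> R) (n : nat) :
  Rsum (fun k => a * f k + b * g k) n = a * Rsum f n + b * Rsum g n.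
Proof. induction n as [|n IH]; simpl; [ring|rewrite IH; ring]. Qed.

(* Leung's choice of direction: the average of the left-hand side against the
   representing measure of p vanishes. *)
Lemma leung_direction (p : nat -> C) (n : nat) (del : R) :
  positive_coefs p -> 0 < del -> exists t,
    Rsum (fun j => (Cmod (p (S j) - cis t ^ S j)%C ^ 2 - 1) / INR (S j)) n <= del.
Proof.
  intros Hp Hd. apply NNPP. intros Hn.
  assert (Hall : forall t, del <
    Rsum (fun j => (Cmod (p (S j) - cis t ^ S j)%C ^ 2 - 1) / INR (S j)) n).
  { intros t. apply Rnot_le_lt. intros Hle. apply Hn. now exists t. }
  set (w := fun j => Cmod (p (S j)) ^ 2 / INR (S j)).
  set (tau := fun j => (RtoC (-2 / INR (S j)) * Cconj (p (S j)))%C).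
  assert (HI : forall j, INR (S j) <> 0) by (intros; apply not_0_INR; lia).
  pose proof (Hp (Rsum w n - del) tau n) as H.
  assert (HT : forall t, 0 <= trigpoly (Rsum w n - del) tau n t).
  (* [trigpoly] carries its frequencies with a minus sign, so its value at t corresponds to the
     direction -t. *)
  { intros t. specialize (Hall (- t)).
    rewrite (Rsum_ext _ (fun j => 1 * w j + 1 * Re (tau j * cis (- (INR (S j) * t)))%C)) in Hall.
    - rewrite Rsum_lin in Hall. unfold trigpoly. lra.
    - intros j _. unfold w, tau. rewrite cis_pow.
      replace (INR (S j) * - t) with (- (INR (S j) * t)) by ring.
      set (z := cis (- (INR (S j) * t))).
      assert (Hz : Cmod z ^ 2 = 1) by (unfold z; rewrite Cmod_cis; ring).
      replace (p (S j) - z)%C with (p (S j) + - z)%C by ring.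
      rewrite Cmod_sqr_sum, Cmod_opp, Hz.
      rewrite <- Cmult_assoc, re_scal_l.
      replace (Cconj (p (S j)) * - z)%C with (- (Cconj (p (S j)) * z))%C by ring.
      rewrite re_opp. field. apply HI. }
  specialize (H HT).
  (* The pairing equals Rsum w n - del - Rsum w n = -del, a negative number. *)
  rewrite (Rsum_ext (fun k => Re (tau k * p (S k))%C) (fun j => -2 * w j + 0 * w j)), Rsum_lin in H.
  - lra.
  - intros j _. unfold tau, w. rewrite <- Cmult_assoc, re_scal_l.
    replace (Cconj (p (S j)) * p (S j))%C with (RtoC (Cmod (p (S j)) ^ 2))
      by (rewrite Cmod2_conj; ring).
    rewrite re_RtoC. field. apply HI.
Qed.

Definition log_deriv_coefs (p h : nat -> C) : Prop :=
  h O = 1%C /\ forall m,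
  (RtoC (INR (S m)) * h (S m) = Csumn (fun j => p (S j) * h (m - j)%nat) (S m))%C.

(** [gam] lists the coefficients of (1 - ze z) h, whose logarithmic derivative has the coefficients
    p_j - ze^j. The slack ln d allowed to the direction turns the Lebedev-Milin bound into d^2 <= d,
    impossible for d > 1. *)
Lemma starlike_successive (p h : nat -> C) (n : nat) :
  positive_coefs p -> log_deriv_coefs p h -> Cmod (h (S n)) - Cmod (h n) <= 1.
Proof.
  intros Hp [H0 Hrec]. apply Rnot_lt_le. intros Hlt.
  set (d := Cmod (h (S n)) - Cmod (h n)) in *.
  assert (Hln : 0 < ln d) by (rewrite <- ln_1; apply ln_increasing; lra).
  destruct (leung_direction p (S n) (ln d) Hp Hln) as [t Ht].
  set (ze := cis t) in *.
  set (gam := fun k => match k with O => RtoC 1 | S k => (h (S k) - ze * h k)%C end).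
  (* Multiplying gam by the geometric series of 1 / (1 - ze z) gives back h; the exponents start at
     1, whence the factor ze. *)
  assert (Htel : forall m, Csumn (fun j => ze ^ S j * gam (m - j)%nat)%C (S m) = (ze * h m)%C).
  { induction m as [|m IH].
    - simpl. rewrite H0. ring.
    - rewrite Csumn_shift.
      rewrite (Csumn_ext _ (fun j => ze * (ze ^ S j * gam (m - j)%nat))%C).
      + rewrite Csumn_scal, IH. simpl. ring.
      + intros j _. rewrite (Cpow_S _ (S j)). change (S m - S j)%nat with (m - j)%nat. ring. }
  assert (Hg : forall m, (RtoC (INR (S m)) * gam (S m)
    = Csumn (fun j => (p (S j) - ze ^ S j) * gam (m - j)%nat) (S m))%C).
  { intros m.
    rewrite (Csumn_ext _ (fun j => p (S j) * gam (m - j)%nat - ze ^ S j * gam (m - j)%nat)%C)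
      by (intros; ring).
    rewrite Csumn_minus, Htel.
    assert (E : Csumn (fun j => p (S j) * gam (m - j)%nat)%C (S m)
      = (RtoC (INR (S m)) * h (S m) - ze * (RtoC (INR m) * h m))%C).
    { destruct m as [|m].
      - rewrite Hrec. simpl. rewrite H0. ring.
      - rewrite (Hrec (S m)), (Hrec m), <- Csumn_scal, !(Csumn_S _ (S m)).
        rewrite Nat.sub_diag, H0. change (gam O) with (RtoC 1).
        rewrite (Csumn_ext (fun j => p (S j) * gam (S m - j)%nat)%C
          (fun j => p (S j) * h (S m - j)%nat - ze * (p (S j) * h (m - j)%nat))%C).
        + rewrite Csumn_minus. ring.
        + intros j Hj. replace (S m - j)%nat with (S (m - j)) by lia. simpl. ring. }
    rewrite E. simpl gam. rewrite RtoC_INR_S. ring. }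
  pose proof (lebedev_milin gam (fun j => p (S j) - ze ^ S j)%C (S n) eq_refl Hg) as HLM.
  assert (Hd : d <= Cmod (gam (S n))).
  { simpl gam. pose proof (Cmod_ge_sub (h (S n)) (ze * h n)%C) as T.
    rewrite Cmod_mult in T. unfold ze in T at 1. rewrite Cmod_cis in T. unfold d. lra. }
  assert (He : Cmod (gam (S n)) ^ 2 <= d).
  { eapply Rle_trans; [exact HLM|]. rewrite <- (exp_ln d) by lra.
    destruct Ht as [Ht| ->]; [left; now apply exp_increasing|right; reflexivity]. }
  nra.
Qed.

Lemma divseq_unfold (h N : nat -> C) (k j : nat) :
  divseq h N k j = (N (k + j)%nat - Csumn (fun i => divseq h N i O * h (k + j - i)%nat) k)%C.
Proof.
  revert j. induction k as [|k IH]; intros j; [simpl; ring|].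
  change (divseq h N (S k) j) with (divseq h N k (S j) - divseq h N k O * h (S j))%C.
  rewrite (IH (S j)), Csumn_S.
  replace (k + S j)%nat with (S k + j)%nat by lia.
  replace (S k + j - k)%nat with (S j) by lia. ring.
Qed.

(** The numerator is (z h)', so the quotient is 1 + z h' / h; moving the term p_0 h_{m+1} across
    lowers the factor m + 2 to m + 1. *)
Lemma log_deriv_coefs_divseq (h : nat -> C) :
  h O = 1%C -> log_deriv_coefs (fun k => divseq h (fun n => RtoC (INR (S n)) * h n)%C k O) h.
Proof.
  intros H0. set (N := (fun n => RtoC (INR (S n)) * h n)%C). split; [exact H0|]. intros m.
  pose proof (divseq_unfold h N (S m) O) as E.
  set (p := fun k => divseq h N k O) in *.
  change (divseq h N (S m) O) with (p (S m)) in E.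
  change (fun i => divseq h N i O * h (S m + 0 - i)%nat)%C
    with (fun i => p i * h (S m + 0 - i)%nat)%C in E.
  rewrite Nat.add_0_r, Csumn_shift, Nat.sub_0_r in E.
  assert (p0 : p O = 1%C) by (unfold p, N; simpl; rewrite H0; ring).
  assert (NS : N (S m) = ((RtoC (INR (S m)) + 1) * h (S m))%C)
    by (unfold N; now rewrite RtoC_INR_S).
  rewrite p0, NS in E.
  change (RtoC (INR (S m)) * h (S m) = Csumn (fun j => p (S j) * h (m - j)%nat) (S m))%C.
  rewrite Csumn_S, Nat.sub_diag, H0, E.
  change (fun k => p (S k) * h (S m - S k)%nat)%C with (fun k => p (S k) * h (m - k)%nat)%C.
  ring.
Qed.

(** * Coefficient regions of order two and three *)

(** Reduces a bound on a modulus to real-linear inequalities, each of which can be tested by one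
    trigonometric polynomial. *)
Lemma Cmod_le_of_Re (w : C) (B : R) :
  (forall lam, Cmod lam = 1 -> Re (lam * w)%C <= B) -> Cmod w <= B.
Proof.
  intros H. destruct (Ceq_dec w 0) as [->|Hw].
  - specialize (H 1%C Cmod_1). rewrite Cmult_0_r in H. rewrite Cmod_0. exact H.
  - pose proof (proj1 (Cmod_gt_0 _) Hw) as Hm.
    assert (Hmn : RtoC (Cmod w) <> 0%C) by (intros E; apply RtoC_inj in E; lra).
    specialize (H (Cconj w / Cmod w)%C).
    replace (Cconj w / Cmod w * w)%C with (RtoC (Cmod w)) in H.
    + apply H. rewrite Cmod_div, Cmod_conj, Cmod_R, Rabs_pos_eq by (auto; lra). field. lra.
    + replace (Cconj w / Cmod w * w)%C with (w * Cconj w / Cmod w)%C by (field; exact Hmn).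
      rewrite <- Cmod2_conj. rewrite RtoC_pow. field. exact Hmn.
Qed.

Lemma positive_coefs_3 (p : nat -> C) (t0 : R) (t1 t2 t3 : C) :
  positive_coefs p ->
  (forall z, Cmod z = 1 -> 0 <= t0 + Re (t1 * z + t2 * z ^ 2 + t3 * z ^ 3)%C) ->
  0 <= t0 + / 2 * Re (t1 * p 1%nat + t2 * p 2%nat + t3 * p 3%nat)%C.
Proof.
  intros Hp H.
  set (tau := fun k => match k with O => t1 | 1%nat => t2 | _ => t3 end).
  pose proof (Hp t0 tau 3%nat) as A. cbn [Rsum tau] in A.
  rewrite !re_plus. rewrite Rplus_0_l in A. apply A. intros t.
  specialize (H (cis (- t)) (Cmod_cis _)). unfold trigpoly. cbn [Rsum tau].
  rewrite !re_plus in H.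
  replace (cis (- (INR 1 * t))) with (cis (- t)) by (simpl; f_equal; ring).
  replace (cis (- (INR 2 * t))) with (cis (- t) ^ 2)%C by (rewrite cis_pow; f_equal; ring).
  replace (cis (- (INR 3 * t))) with (cis (- t) ^ 3)%C by (rewrite cis_pow; f_equal; ring).
  lra.
Qed.

(** For a measure with moments m and c2, the integral of (z - m)^2 is c2 - m^2 and that of |z - m|^2
    is 1 - |m|^2. *)
Lemma coef_region_2 (p : nat -> C) (m c2 : C) :
  positive_coefs p -> p 1%nat = (2 * m)%C -> p 2%nat = (2 * c2)%C ->
  Cmod (c2 - m * m)%C <= 1 - Cmod m ^ 2.
Proof.
  intros Hp H1 H2. apply Cmod_le_of_Re. intros lam Hlam.
  (* The integrand is |z - m|^2 - Re (lam (z - m)^2). *)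
  pose proof (positive_coefs_3 p (1 + Cmod m ^ 2 - Re (lam * (m * m))%C)
    (2 * (lam * m) - 2 * Cconj m)%C (- lam)%C 0%C Hp) as A.
  rewrite H1, H2 in A.
  assert (B : forall z, Cmod z = 1 -> 0 <= 1 + Cmod m ^ 2 - Re (lam * (m * m))%C +
    Re ((2 * (lam * m) - 2 * Cconj m) * z + - lam * z ^ 2 + 0 * z ^ 3)%C).
  { intros z Hz.
    pose proof (Re_le_Cmod (lam * ((z - m) * (z - m)))%C) as C1.
    rewrite !Cmod_mult, Hlam, Rmult_1_l in C1.
    replace (Cmod (z - m)%C * Cmod (z - m)%C) with (Cmod (z - m)%C ^ 2) in C1 by ring.
    assert (Hz2 : Cmod z ^ 2 = 1) by (rewrite Hz; ring).
    rewrite !Cmod_sqr in *. clear Hlam Hz A.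
    destruct z as [z1 z2], m as [m1 m2], lam as [l1 l2].
    unfold Re, Cconj, Cmult, Cplus, Cminus, Copp, Cpow, RtoC in *; simpl in *. nra. }
  specialize (A B). rewrite !Cmod_sqr in *. clear B Hlam.
  destruct m as [m1 m2], lam as [l1 l2], c2 as [u v].
  unfold Re, Cconj, Cmult, Cplus, Cminus, Copp, Cpow, RtoC in *; simpl in *. nra.
Qed.

(** Up to convention, x is the second Verblunsky parameter of the measure. On the left stands the
    modulus of the integral of F^2 / z, on the right the integral of |F|^2. *)
Lemma coef_region_3 (p : nat -> C) (m x c3 : C) (s : R) :
  positive_coefs p -> s = 1 - Cmod m ^ 2 ->
  p 1%nat = (2 * m)%C -> p 2%nat = (2 * (m * m + s * x))%C -> p 3%nat = (2 * c3)%C ->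
  Cmod (c3 - m * m * m - 2 * s * m * x + s * Cconj m * x * x)%C <= s * (1 - Cmod x ^ 2).
Proof.
  intros Hp Hs H1 H2 H3. apply Cmod_le_of_Re. intros lam Hlam.
  set (al := (x * Cconj m - m)%C). set (be := (- x)%C).
  (* The integrand is |F|^2 - Re (lam F^2 / z) with F = z^2 + al z + be the second
     orthogonal polynomial. *)
  pose proof (positive_coefs_3 p
    (1 + Cmod al ^ 2 + Cmod be ^ 2 - Re (2 * lam * al * be)%C)
    (2 * (Cconj al + al * Cconj be) - lam * (al * al + 2 * be) - Cconj (lam * be * be))%C
    (2 * Cconj be - 2 * lam * al)%C (- lam)%C Hp) as A.
  rewrite H1, H2, H3 in A.
  assert (B : forall z, Cmod z = 1 ->
    0 <= 1 + Cmod al ^ 2 + Cmod be ^ 2 - Re (2 * lam * al * be)%C +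
    Re ((2 * (Cconj al + al * Cconj be) - lam * (al * al + 2 * be) - Cconj (lam * be * be)) * z
      + (2 * Cconj be - 2 * lam * al) * z ^ 2 + - lam * z ^ 3)%C).
  { intros z Hz. clear A H1 H2 H3. clearbody al be.
    set (F := (z * z + al * z + be)%C).
    pose proof (Re_le_Cmod (lam * (F * F * Cconj z))%C) as C1.
    rewrite !Cmod_mult, Cmod_conj, Hlam, Hz, Rmult_1_l, Rmult_1_r in C1.
    replace (Cmod F * Cmod F) with (Cmod F ^ 2) in C1 by ring.
    (* On the circle 1 / z is the conjugate of z, which keeps F^2 / z polynomial in z and its
       conjugate. *)
    assert (Hzz : (z * Cconj z)%C = 1%C).
    { rewrite <- Cmod2_conj, Hz, pow1. reflexivity. }
    replace (F * F * Cconj z)%C with (z ^ 3 + 2 * al * z ^ 2 + (al * al + 2 * be) * z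
      + 2 * al * be + be * be * Cconj z)%C in C1.
    2:{ transitivity (z ^ 3 * (z * Cconj z) + 2 * al * z ^ 2 * (z * Cconj z)
          + (al * al + 2 * be) * z * (z * Cconj z) + 2 * al * be * (z * Cconj z)
          + be * be * Cconj z)%C; [rewrite Hzz; ring|unfold F; ring]. }
    assert (C2 : Cmod F ^ 2 = 1 + Cmod al ^ 2 + Cmod be ^ 2
      + Re (2 * (Cconj al + al * Cconj be) * z + 2 * Cconj be * z ^ 2)%C).
    { assert (RtoC (Cmod F ^ 2) = RtoC (1 + Cmod al ^ 2 + Cmod be ^ 2
        + Re (2 * (Cconj al + al * Cconj be) * z + 2 * Cconj be * z ^ 2)%C)) as E;
        [|now apply RtoC_inj in E].
      rewrite !RtoC_plus, !Cmod2_conj, re_alt.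
      unfold F. rewrite !Cplus_conj, !Cmult_conj, !Cplus_conj, !Cmult_conj, !Cconj_conj.
      replace (Cconj 2) with (RtoC 2) by (unfold Cconj, RtoC; simpl; f_equal; ring).
      rewrite Cpow_conj.
      transitivity ((z * Cconj z) * (z * Cconj z) + al * Cconj al * (z * Cconj z) + be * Cconj be
        + (Cconj al * z + al * Cconj z) * (z * Cconj z)
        + (al * z * Cconj be + Cconj al * Cconj z * be)
        + (Cconj be * z ^ 2 + be * Cconj z ^ 2))%C; [ring|].
      rewrite Hzz. field. }
    rewrite C2 in C1.
    replace (Re (lam * (z ^ 3 + 2 * al * z ^ 2 + (al * al + 2 * be) * z
      + 2 * al * be + be * be * Cconj z))%C) with
      (Re (lam * (z ^ 3 + 2 * al * z ^ 2 + (al * al + 2 * be) * z + 2 * al * be)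
        + Cconj (lam * be * be) * z)%C) in C1.
    2:{ rewrite re_plus. replace (Re (Cconj (lam * be * be) * z)%C)
        with (Re (lam * be * be * Cconj z)%C).
        - rewrite <- re_plus. f_equal. ring.
        - rewrite <- re_conj, !Cmult_conj, Cconj_conj. reflexivity. }
    apply Rle_trans with (1 + Cmod al ^ 2 + Cmod be ^ 2
      + Re (2 * (Cconj al + al * Cconj be) * z + 2 * Cconj be * z ^ 2)%C
      - Re (lam * (z ^ 3 + 2 * al * z ^ 2 + (al * al + 2 * be) * z + 2 * al * be)
        + Cconj (lam * be * be) * z)%C); [lra|]. right.
    unfold Rminus. rewrite <- !re_opp, !Rplus_assoc, <- !re_plus. do 4 f_equal. ring. }
  specialize (A B). clear B. unfold al, be in A.
  rewrite !Cmod_sqr in *. clear Hlam.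
  destruct m as [m1 m2], lam as [l1 l2], c3 as [u v], x as [x1 x2].
  unfold Re, Cconj, Cmult, Cplus, Cminus, Copp, RtoC in *; simpl in *. subst s.
  apply Rminus_le.
  match type of A with 0 <= ?e => apply Rle_trans with (- e); [right; field|lra] end.
Qed.

(* With w = 3 q + s x, A = |w| and u = Re w the claim reads K <= r P, where
   P = |w^2 - (5 + q) w + 9 q|, K = q (6 u - 2 A - 8 q) - (A - 1)^2.  For fixed A the
   difference q P^2 - K^2 is affine in u and nonincreasing, so the worst case is u = A. *)
Lemma third_coef_inequality (r q s : R) (x : C) :
  0 <= r <= 1 -> q = r ^ 2 -> s = 1 - q -> Cmod x <= 1 ->
  1 <= Cmod (3 * q + s * x)%C ->
  2 * (Cmod (3 * q + s * x)%C - 1) + s * (1 - Cmod x ^ 2)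
    <= r * Cmod (6 * q + 5 * s * x - s * x * x)%C.
Proof.
  intros Hr Hq Hs Hx HA1.
  set (w := (3 * q + s * x)%C) in *. set (A := Cmod w) in *. set (u := Re w).
  assert (Hq01 : 0 <= q <= 1) by (rewrite Hq; simpl; nra).
  (* Since |x| <= 1, w lies within s = 1 - q of 3 q, whence 4 q - 1 <= A <= 1 + 2 q. *)
  assert (HA3 : A <= 1 + 2 * q).
  { unfold A, w. eapply Rle_trans; [apply Cmod_triangle|].
    rewrite !Cmod_mult, !Cmod_Rpos by lra. nra. }
  assert (HA4 : 4 * q - 1 <= A).
  { unfold A, w. pose proof (Cmod_ge_sub (3 * q)%C (- (s * x))%C) as T.
    replace (3 * q - - (s * x))%C with (3 * q + s * x)%C in T by ring.
    rewrite Cmod_opp, !Cmod_mult, !Cmod_Rpos in T by lra. nra. }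
  assert (Hu : u <= A) by apply Re_le_Cmod.
  (* At q = 1 the factor s vanishes and w no longer determines x; there the claim is just 4 <= 6. *)
  destruct (Rle_lt_or_eq_dec q 1 (proj2 Hq01)) as [Hlt|Heq].
  2:{ assert (Er : r = 1) by (simpl in Hq; nra). assert (Es : s = 0) by lra.
      replace (6 * q + 5 * s * x - s * x * x)%C with (RtoC 6) by (rewrite Es, Heq; ring).
      rewrite Er, Es, Cmod_Rpos by lra. lra. }
  assert (Hs0 : 0 < s) by lra.
  assert (Hx2 : s ^ 2 * Cmod x ^ 2 = A ^ 2 - 6 * q * u + 9 * q ^ 2).
  { unfold A, u, w. rewrite !Cmod_sqr. destruct x as [x1 x2].
    unfold Re, Cmult, Cplus, RtoC; simpl. ring. }
  set (Y := Cmod (6 * q + 5 * s * x - s * x * x)%C).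
  set (P := s * Y).
  assert (HP0 : 0 <= P) by (apply Rmult_le_pos; [lra|apply Cmod_ge_0]).
  assert (HP : P ^ 2 = 36 * q * u ^ 2 - 2 * (A ^ 2 + 9 * q) * (5 + q) * u
    + (5 + q) ^ 2 * A ^ 2 + (A ^ 2 - 9 * q) ^ 2).
  { unfold P, Y. rewrite Rpow_mult_distr. unfold A, u, w.
    replace (Cmod (3 * q + s * x)%C ^ 2) with ((3 * q + s * fst x) ^ 2 + (s * snd x) ^ 2).
    2:{ rewrite Cmod_sqr. unfold Cmult, Cplus, RtoC; simpl. ring. }
    rewrite Cmod_sqr, Hs. destruct x as [x1 x2].
    unfold Re, Cminus, Copp, Cmult, Cplus, RtoC; simpl. ring. }
  set (K := q * (6 * u - 2 * A - 8 * q) - (A - 1) ^ 2).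
  assert (HK : K = s * (2 * (A - 1) + s * (1 - Cmod x ^ 2))).
  { replace (s * (2 * (A - 1) + s * (1 - Cmod x ^ 2)))
      with (2 * s * (A - 1) + s ^ 2 - s ^ 2 * Cmod x ^ 2) by ring.
    rewrite Hx2, Hs. unfold K. ring. }
  assert (Hmain : K <= r * P).
  { destruct (Rle_lt_dec K 0) as [HK0|HK0].
    - assert (0 <= r * P) by (apply Rmult_le_pos; lra). lra.
    - set (KA := q * (4 * A - 8 * q) - (A - 1) ^ 2).
      set (QA := (5 + q) * A - A ^ 2 - 9 * q).
      assert (HKA : K <= KA) by (unfold K, KA; nra).
      assert (HQK : KA <= r * QA).
      { set (d := A - 1).
        assert (E : r * QA - KA = (1 - r) * (r * (4 - 8 * q) + d * r * (3 - r) + d ^ 2)).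
        { unfold QA, KA, d. rewrite Hq. ring. }
        assert (0 <= r * (4 - 8 * q) + d * r * (3 - r) + d ^ 2).
        { assert (0 <= d) by (unfold d; lra).
          assert (0 <= d ^ 2) by apply pow2_ge_0.
          assert (0 <= r * (3 - r)) by nra.
          (* For q > 1/2 the negative term r (4 - 8 q) is offset by d >= 4 q - 2, which is the lower
             bound A >= 4 q - 1. *)
          destruct (Rle_lt_dec q (1 / 2)).
          - assert (0 <= r * (4 - 8 * q)) by (apply Rmult_le_pos; lra). nra.
          - assert (4 * q - 2 <= d) by (unfold d; lra).
            assert ((4 * q - 2) * (r * (3 - r)) <= d * (r * (3 - r)))
              by (apply Rmult_le_compat_r; lra).
            assert (0 <= (4 * q - 2) * (r * (1 - r))) by (apply Rmult_le_pos; nra). nra. }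
        assert (0 <= (1 - r) * (r * (4 - 8 * q) + d * r * (3 - r) + d ^ 2))
          by (apply Rmult_le_pos; lra). lra. }
      assert (HKA2 : KA ^ 2 <= q * QA ^ 2).
      { replace (q * QA ^ 2) with ((r * QA) ^ 2) by (rewrite Hq; ring).
        apply pow_incr. lra. }
      assert (Hdiff : q * P ^ 2 - K ^ 2 = q * QA ^ 2 - KA ^ 2
        + q * (1 - q) * (A - u) * (24 * A - 2 * A ^ 2 + 78 * q - 12)).
      { rewrite HP. unfold K, KA, QA. ring. }
      assert (0 <= q * (1 - q) * (A - u) * (24 * A - 2 * A ^ 2 + 78 * q - 12)).
      { apply Rmult_le_pos; [|nra].
        apply Rmult_le_pos; [apply Rmult_le_pos; lra|lra]. }
      apply Rsqr_incr_0_var; [|apply Rmult_le_pos; lra].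
      rewrite !Rsqr_pow2, Rpow_mult_distr, <- Hq. lra. }
  apply Rmult_le_reg_l with s; [exact Hs0|].
  rewrite <- HK. unfold P in Hmain. fold Y. lra.
Qed.

(** * Low-order coefficients in terms of p and the bounds for V_2 and V_3 *)

Lemma log_deriv_coef_1 (p h : nat -> C) : log_deriv_coefs p h -> h 1%nat = p 1%nat.
Proof.
  intros Hph. pose proof Hph as [H0 Hrec]. specialize (Hrec O). simpl in Hrec. rewrite H0 in Hrec.
  rewrite <- (Cmult_1_l (h 1%nat)), Hrec. ring.
Qed.

Lemma log_deriv_coef_2 (p h : nat -> C) :
  log_deriv_coefs p h -> (2 * h 2%nat = p 1%nat * p 1%nat + p 2%nat)%C.
Proof.
  intros Hph. pose proof Hph as [H0 Hrec]. specialize (Hrec 1%nat). simpl Csumn in Hrec.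
  rewrite H0, (log_deriv_coef_1 p h Hph) in Hrec. simpl INR in Hrec.
  rewrite RtoC_plus in Hrec. transitivity ((1 + 1) * h 2%nat)%C; [ring|]. rewrite Hrec. ring.
Qed.

Lemma log_deriv_coef_3 (p h : nat -> C) :
  log_deriv_coefs p h ->
  (6 * h 3%nat = p 1%nat * p 1%nat * p 1%nat + 3 * p 1%nat * p 2%nat + 2 * p 3%nat)%C.
Proof.
  intros Hph. pose proof (log_deriv_coef_2 p h Hph) as E2.
  pose proof Hph as [H0 Hrec]. specialize (Hrec 2%nat). simpl Csumn in Hrec.
  rewrite H0, (log_deriv_coef_1 p h Hph) in Hrec. simpl INR in Hrec.
  rewrite !RtoC_plus in Hrec. transitivity (2 * ((1 + 1 + 1) * h 3%nat))%C; [ring|]. rewrite Hrec.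
  transitivity (p 1%nat * (2 * h 2%nat) + 2 * p 2%nat * p 1%nat + 2 * p 3%nat)%C; [ring|].
  rewrite E2. ring.
Qed.

Lemma convex_coef_2_3 (p h : nat -> C) :
  positive_coefs p -> log_deriv_coefs p h -> Cmod (h 1%nat) / 2 - Cmod (h 2%nat) / 3 <= 1 / 2.
Proof.
  intros Hp Hph. set (m := (p 1%nat / 2)%C). set (c2 := (p 2%nat / 2)%C).
  assert (H1 : p 1%nat = (2 * m)%C) by (unfold m; field).
  assert (H2 : p 2%nat = (2 * c2)%C) by (unfold c2; field).
  pose proof (coef_region_2 p m c2 Hp H1 H2) as HX.
  assert (Eh1 : Cmod (h 1%nat) = 2 * Cmod m).
  { rewrite (log_deriv_coef_1 p h Hph), H1, Cmod_mult, Cmod_Rpos; lra. }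
  assert (Eh2 : h 2%nat = (3 * (m * m) + (c2 - m * m))%C).
  { transitivity (2 * h 2%nat / 2)%C; [field|]. rewrite (log_deriv_coef_2 p h Hph), H1, H2. field. }
  assert (Hge : 3 * Cmod m ^ 2 - (1 - Cmod m ^ 2) <= Cmod (h 2%nat)).
  { rewrite Eh2. pose proof (Cmod_ge_sub (3 * (m * m))%C (- (c2 - m * m))%C) as T.
    replace (3 * (m * m) - - (c2 - m * m))%C with (3 * (m * m) + (c2 - m * m))%C in T by ring.
    rewrite Cmod_opp, !Cmod_mult, Cmod_Rpos in T by lra. simpl. simpl in HX. lra. }
  rewrite Eh1. pose proof (Cmod_ge_0 (h 2%nat)). pose proof (Cmod_ge_0 m).
  (* With r = |m| and |h_2| >= 4 r^2 - 1, the case r > 1/2 reads (2 r - 1) (4 r - 1) >= 0; r = 1/2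
     is the value for L_{pi/3}. *)
  destruct (Rle_lt_dec (Cmod m) (1 / 2)); nra.
Qed.

Lemma convex_coef_3_4 (p h : nat -> C) :
  positive_coefs p -> log_deriv_coefs p h -> Cmod (h 2%nat) / 3 - Cmod (h 3%nat) / 4 <= 1 / 3.
Proof.
  intros Hp Hph. set (m := (p 1%nat / 2)%C). set (c2 := (p 2%nat / 2)%C). set (c3 := (p 3%nat / 2)%C).
  assert (H1 : p 1%nat = (2 * m)%C) by (unfold m; field).
  assert (H2 : p 2%nat = (2 * c2)%C) by (unfold c2; field).
  assert (H3 : p 3%nat = (2 * c3)%C) by (unfold c3; field).
  pose proof (coef_region_2 p m c2 Hp H1 H2) as HX.
  set (r := Cmod m) in *. set (q := r ^ 2) in *. set (s := 1 - q) in *.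
  assert (Hr0 : 0 <= r) by apply Cmod_ge_0.
  assert (Hs0 : 0 <= s) by (eapply Rle_trans; [apply Cmod_ge_0|exact HX]).
  assert (Hr1 : r <= 1) by (unfold s, q in Hs0; simpl in Hs0; nra).
  assert (Hx : exists x : C, Cmod x <= 1 /\ c2 = (m * m + s * x)%C).
  (* When s = 0, [HX] forces c2 = m^2 and any x of the disk would serve; 0 is chosen. *)
  { destruct (Req_dec s 0) as [E|N].
    - exists 0%C. split; [rewrite Cmod_0; lra|].
      rewrite E in HX |- *. apply Ceq_minus.
      replace (c2 - (m * m + 0 * 0))%C with (c2 - m * m)%C by ring.
      apply Cmod_eq_0, Rle_antisym; [exact HX|apply Cmod_ge_0].
    - assert (Hsn : RtoC s <> 0%C) by (intros E; apply RtoC_inj in E; lra).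
      exists ((c2 - m * m) / s)%C. split; [|field; exact Hsn].
      rewrite Cmod_div, Cmod_Rpos by (auto; lra).
      apply Rle_div_l; lra. }
  destruct Hx as [x [Hx1 Ec2]].
  rewrite Ec2 in H2.
  pose proof (coef_region_3 p m x c3 s Hp eq_refl H1 H2 H3) as HY.
  set (Y := (c3 - m * m * m - 2 * s * m * x + s * Cconj m * x * x)%C) in *.
  assert (Eh2 : h 2%nat = (3 * (m * m) + s * x)%C).
  { transitivity (2 * h 2%nat / 2)%C; [field|]. rewrite (log_deriv_coef_2 p h Hph), H1, H2. field. }
  assert (Eh3 : (3 * h 3%nat = 2 * (6 * (m * m * m) + 5 * s * m * x - s * Cconj m * x * x + Y))%C).
  { transitivity (6 * h 3%nat / 2)%C; [field|]. rewrite (log_deriv_coef_3 p h Hph), H1, H2, H3.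
    unfold Y. field. }
  set (Z := (6 * (m * m * m) + 5 * s * m * x - s * Cconj m * x * x)%C) in *.
  assert (Hh3 : Cmod Z - s * (1 - Cmod x ^ 2) <= 3 / 2 * Cmod (h 3%nat)).
  { apply (f_equal Cmod) in Eh3. rewrite !Cmod_mult, !Cmod_Rpos in Eh3 by lra.
    pose proof (Cmod_ge_sub Z (- Y)%C) as T. rewrite Cmod_opp in T.
    replace (Z - - Y)%C with (Z + Y)%C in T by ring. lra. }
  pose proof (Cmod_ge_0 (h 3%nat)) as Hh30.
  (* Multiplied by 6 the claim is 2 (|h_2| - 1) <= (3/2) |h_3|: immediate for |h_2| <= 1, and
     otherwise reduced by [Hh3] to a lower bound for |Z|. *)
  destruct (Rle_lt_dec (Cmod (h 2%nat)) 1) as [Hle|Hgt]; [lra|].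
  assert (Hkey : 2 * (Cmod (h 2%nat) - 1) + s * (1 - Cmod x ^ 2) <= Cmod Z); [|lra].
  destruct (Ceq_dec m 0) as [Em|Nm].
  { exfalso. revert Hgt. rewrite Eh2, Em.
    replace (3 * (0 * 0) + s * x)%C with (s * x)%C by ring.
    rewrite Cmod_mult, Cmod_Rpos by lra.
    assert (s <= 1) by (unfold s, q; pose proof (pow2_ge_0 r); lra).
    pose proof (Cmod_ge_0 x). nra. }
  pose proof (proj1 (Cmod_gt_0 _) Nm) as Hrp. fold r in Hrp.
  (* Rotating by e = conj(m)^2 / |m|^2 reduces to the case m > 0. *)
  set (e := (Cconj m * Cconj m / q)%C).
  assert (Hqp : 0 < q) by (apply pow_lt; exact Hrp).
  assert (Hqn : RtoC q <> 0%C) by (intros E; apply RtoC_inj in E; lra).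
  assert (Emm : (m * Cconj m)%C = RtoC q) by (rewrite <- Cmod2_conj; reflexivity).
  assert (He : Cmod e = 1).
  { unfold e. rewrite Cmod_div, Cmod_mult, Cmod_conj, Cmod_Rpos by (auto; lra).
    fold r. unfold q. field. lra. }
  assert (Eme : (m * m * e)%C = RtoC q).
  { unfold e. replace (m * m * (Cconj m * Cconj m / q))%C
      with ((m * Cconj m) * (m * Cconj m) / q)%C by (field; exact Hqn).
    rewrite Emm. field. exact Hqn. }
  pose proof (third_coef_inequality r q s (x * e)%C (conj Hr0 Hr1) eq_refl eq_refl) as T.
  rewrite (Cmod_mult x e), He, Rmult_1_r in T.
  replace (3 * q + s * (x * e))%C with (h 2%nat * e)%C in T by (rewrite Eh2, <- Eme; ring).
  rewrite (Cmod_mult (h 2%nat)), He, Rmult_1_r in T.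
  assert (EZ : Cmod Z = r * Cmod (6 * q + 5 * s * (x * e) - s * (x * e) * (x * e))%C).
  { unfold r at 1. rewrite <- Cmod_mult. rewrite <- (Rmult_1_r (Cmod Z)), <- He, <- Cmod_mult.
    f_equal. unfold Z.
    transitivity (6 * m * (m * m * e) + 5 * s * m * (x * e) - s * x * x * (Cconj m * e))%C; [ring|].
    assert (E1 : (Cconj m * e)%C = (m * e * e)%C).
    { unfold e at 2 3.
      replace (m * (Cconj m * Cconj m / q) * (Cconj m * Cconj m / q))%C
        with ((m * Cconj m) * Cconj m * (Cconj m * Cconj m / q) / q)%C by (field; exact Hqn).
      rewrite Emm. unfold e. field. exact Hqn. }
    rewrite E1, Eme. ring. }
  rewrite EZ. apply T; lra.
Qed.

(** * The extremal functions *)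

Lemma rderiv_mult (f g : R -> C) (t : R) (l m : C) :
  rderiv f t l -> rderiv g t m -> rderiv (fun s => f s * g s)%C t (l * g t + f t * m)%C.
Proof.
  intros Hf Hg.
  pose proof (rderiv_Re _ _ _ Hf) as F1. pose proof (rderiv_Im _ _ _ Hf) as F2.
  pose proof (rderiv_Re _ _ _ Hg) as G1. pose proof (rderiv_Im _ _ _ Hg) as G2.
  assert (Hm : forall (u v : R -> R) du dv, is_derive u t du -> is_derive v t dv ->
    is_derive (fun s => u s * v s) t (du * v t + u t * dv)).
  { intros u v du dv Hu Hv. apply (is_derive_mult u v t du dv Hu Hv). apply Rmult_comm. }
  apply rderiv_intro.
  - apply (is_derive_ext (fun s => Re (f s) * Re (g s) - Im (f s) * Im (g s))).
    + intros s. now rewrite re_mult.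
    + rewrite re_plus, !re_mult.
      replace (Re l * Re (g t) - Im l * Im (g t) + (Re (f t) * Re m - Im (f t) * Im m))
        with ((Re l * Re (g t) + Re (f t) * Re m) - (Im l * Im (g t) + Im (f t) * Im m)) by ring.
      apply (is_derive_minus (V := R_NormedModule) (fun s => Re (f s) * Re (g s))
        (fun s => Im (f s) * Im (g s))); auto.
  - apply (is_derive_ext (fun s => Re (f s) * Im (g s) + Im (f s) * Re (g s))).
    + intros s. now rewrite im_mult.
    + rewrite im_plus, !im_mult.
      replace (Re l * Im (g t) + Im l * Re (g t) + (Re (f t) * Im m + Im (f t) * Re m))
        with ((Re l * Im (g t) + Re (f t) * Im m) + (Im l * Re (g t) + Im (f t) * Re m)) by ring.
      apply (is_derive_plus (V := R_NormedModule) (fun s => Re (f s) * Im (g s))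
        (fun s => Im (f s) * Re (g s))); auto.
Qed.

Definition cexp (z : C) : C := (exp (Re z) * cis (Im z))%C.

Lemma Re_cexp (z : C) : Re (cexp z) = exp (Re z) * cos (Im z).
Proof. unfold cexp. now rewrite re_scal_l. Qed.

Lemma Im_cexp (z : C) : Im (cexp z) = exp (Re z) * sin (Im z).
Proof. unfold cexp. now rewrite im_scal_l. Qed.

Lemma rderiv_cexp (f : R -> C) (t : R) (l : C) :
  rderiv f t l -> rderiv (fun s => cexp (f s)) t (l * cexp (f t))%C.
Proof.
  intros H. pose proof (rderiv_Re _ _ _ H) as F1. pose proof (rderiv_Im _ _ _ H) as F2.
  set (X := fun s => Re (f s)) in *. set (Y := fun s => Im (f s)) in *.
  assert (EX : ex_derive X t) by (eexists; exact F1).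
  assert (EY : ex_derive Y t) by (eexists; exact F2).
  assert (DX : Derive X t = Re l) by now apply is_derive_unique.
  assert (DY : Derive Y t = Im l) by now apply is_derive_unique.
  apply rderiv_intro.
  - apply (is_derive_ext (fun s => exp (X s) * cos (Y s))).
    + intros s. now rewrite Re_cexp.
    + auto_derive; [auto|].
      change (fun x => X x) with X. change (fun x => Y x) with Y. rewrite DX, DY.
      rewrite re_mult, Re_cexp, Im_cexp. fold (X t) (Y t). ring.
  - apply (is_derive_ext (fun s => exp (X s) * sin (Y s))).
    + intros s. now rewrite Im_cexp.
    + auto_derive; [auto|].
      change (fun x => X x) with X. change (fun x => Y x) with Y. rewrite DX, DY.
      rewrite im_mult, Re_cexp, Im_cexp. fold (X t) (Y t). ring.
Qed.

Lemma Cmod_L_coef (phi : R) (n : nat) :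
  Cmod (L_coef phi n) = Rabs (sin (INR n * phi) / (INR n * sin phi)).
Proof. exact (Cmod_R _). Qed.

Section Extremal.
Variable phi : R.
Hypothesis Hphi : 0 < phi < PI.
Local Notation Lphi := (psf (L_coef phi)).

Lemma sin_phi_pos : 0 < sin phi.
Proof. apply sin_gt_0; lra. Qed.

Lemma disk_coef_L : disk_coef (L_coef phi).
Proof.
  pose proof sin_phi_pos as HS. intros rho Hr. exists (/ sin phi). intros n.
  rewrite Cmod_L_coef.
  assert (Hp : 0 <= rho ^ n <= 1).
  { split; [apply pow_le; lra|]. rewrite <- (pow1 n). apply pow_incr. lra. }
  assert (0 < / sin phi) by now apply Rinv_0_lt_compat.
  assert (Rabs (sin (INR n * phi) / (INR n * sin phi)) <= / sin phi).
  { destruct n as [|n].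
    - simpl INR. rewrite Rmult_0_l, sin_0. unfold Rdiv. rewrite Rmult_0_l, Rabs_R0. lra.
    - assert (Hn : 1 <= INR (S n)) by (rewrite S_INR; pose proof (pos_INR n); lra).
      rewrite Rabs_div, (Rabs_pos_eq (_ * _)) by nra.
      apply Rle_div_l; [nra|].
      replace (/ sin phi * (INR (S n) * sin phi)) with (INR (S n)) by (field; lra).
      apply Rle_trans with 1; [|exact Hn]. apply Rabs_le, SIN_bound. }
  pose proof (Rabs_pos (sin (INR n * phi) / (INR n * sin phi))). nra.
Qed.

Lemma dcoef_L (n : nat) :
  dcoef (L_coef phi) n = RtoC (sin (INR (S n) * phi) / sin phi).
Proof.
  pose proof sin_phi_pos as HS. unfold dcoef, L_coef.
  change Defs.RtoC with RtoC. rewrite <- RtoC_mult. f_equal. field.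
  split; [lra|]. apply not_0_INR. lia.
Qed.

Lemma cis_phi_conj_mult : (cis phi * cis (- phi) = 1)%C.
Proof. rewrite <- cis_plus, Rplus_opp_r. apply cis_0. Qed.

Lemma cis_phi_sqr_neq_1 : (1 - cis phi * cis phi <> 0)%C.
Proof.
  pose proof sin_phi_pos as HS. intros E. rewrite <- cis_plus in E. apply (f_equal Re) in E.
  change (1 + - cos (phi + phi) = 0) in E.
  replace (phi + phi) with (2 * phi) in E by ring. rewrite cos_2a_sin in E. nra.
Qed.

(** The coefficients u_n = sin((n+1) phi) / sin phi obey the Chebyshev recurrence u_{n+2} = 2 cos
    phi u_{n+1} - u_n, whose characteristic factors are the two linear ones. *)
Lemma psf_dcoef_L (z : C) : Cmod z < 1 ->
  (psf (dcoef (L_coef phi)) z * ((1 - cis phi * z) * (1 - cis (- phi) * z)) = 1)%C.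
Proof.
  intros Hz. pose proof sin_phi_pos as HS. pose proof disk_coef_L as HL.
  set (u := dcoef (L_coef phi)).
  assert (Hu : disk_coef u) by now apply disk_coef_dcoef.
  pose proof (disk_coef_incr _ Hu) as Hu1.
  assert (u0 : u O = 1%C).
  { unfold u. rewrite dcoef_L. simpl INR. rewrite Rmult_1_l. f_equal. field. lra. }
  assert (u1 : u 1%nat = RtoC (2 * cos phi)).
  { unfold u. rewrite dcoef_L. f_equal. simpl INR.
    replace ((1 + 1) * phi) with (2 * phi) by ring. rewrite sin_2a. field. lra. }
  assert (u2 : forall n, u (S (S n)) = (RtoC (2 * cos phi) * u (S n) + -1 * u n)%C).
  { intros n. unfold u. rewrite !dcoef_L. rewrite <- !RtoC_mult, <- RtoC_plus. f_equal.
    rewrite (S_INR (S (S n))), (S_INR (S n)).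
    set (x := (INR (S n)) * phi).
    replace ((INR (S n) + 1 + 1) * phi) with ((x + phi) + phi) by (unfold x; ring).
    replace ((INR (S n) + 1) * phi) with (x + phi) by (unfold x; ring).
    replace (sin x) with (sin ((x + phi) - phi)) by (f_equal; ring).
    rewrite sin_plus, sin_minus. field. lra. }
  pose proof (psf_incr u z Hu Hz) as E1. rewrite u0 in E1.
  pose proof (psf_incr (fun n => u (S n)) z Hu1 Hz) as E2.
  cbv beta in E2. rewrite u1 in E2.
  rewrite (psf_ext (fun n => u (S (S n))) _ z u2) in E2.
  rewrite psf_plus, !psf_scal in E2 by auto using disk_coef_scal.
  set (D := psf u z) in *. set (V := psf (fun n => u (S n)) z) in *.
  assert (Ec : (cis phi + cis (- phi))%C = RtoC (2 * cos phi)).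
  { unfold cis, Cplus, RtoC; simpl. rewrite cos_neg, sin_neg. f_equal; ring. }
  replace ((1 - cis phi * z) * (1 - cis (- phi) * z))%C
    with (1 - (cis phi + cis (- phi)) * z + cis phi * cis (- phi) * z * z)%C by ring.
  rewrite Ec, cis_phi_conj_mult.
  assert (E3 : (V = RtoC (2 * cos phi) * D - z * D)%C).
  { transitivity (RtoC (2 * cos phi) * (1 + z * V) - z * D)%C; [|now rewrite <- E1].
    rewrite E2 at 1. ring. }
  transitivity (D - z * (RtoC (2 * cos phi) * D - z * D))%C; [ring|].
  rewrite <- E3, E1. ring.
Qed.

Lemma one_sub_cis_neq_0 (s : R) (z : C) : Cmod z < 1 -> (1 - cis s * z <> 0)%C.
Proof.
  intros Hz E. assert (E1 : (cis s * z)%C = 1%C).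
  { transitivity (1 - (1 - cis s * z))%C; [ring|]. rewrite E. ring. }
  apply (f_equal Cmod) in E1. rewrite Cmod_cis_mult, Cmod_1 in E1. lra.
Qed.

Definition Lexp (w : C) : C := cexp (Ci * (phi + 2 * sin phi * w))%C.

(** Proved without a complex logarithm: along the segment t z the product of [Lexp] of L_phi with (1
    - cis phi w) / (1 - cis (-phi) w) has derivative 0, and at t = 0 it equals cis phi. *)
Lemma Lexp_psf (z : C) : Cmod z < 1 ->
  (Lexp (Lphi z) * (1 - cis phi * z) = cis phi - z)%C.
Proof.
  intros Hz. pose proof disk_coef_L as HL.
  set (Q := fun w => ((1 - cis phi * w) / (1 - cis (- phi) * w))%C).
  set (G := fun t : R => (Lexp (Lphi (t * z)) * Q (t * z))%C).
  assert (HG : forall t, 0 <= t <= 1 -> rderiv G t 0).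
  { intros t Ht. assert (Htz : Cmod (t * z)%C < 1).
    { rewrite Cmod_mult, Cmod_Rpos by lra. pose proof (Cmod_ge_0 z). nra. }
    pose proof (one_sub_cis_neq_0 phi _ Htz) as N1.
    pose proof (one_sub_cis_neq_0 (- phi) _ Htz) as N2.
    assert (D1 : rderiv (fun s => Lexp (Lphi (s * z))) t
      (Ci * (2 * sin phi) * psf (dcoef (L_coef phi)) (t * z) * z
        * Lexp (Lphi (t * z)))%C).
    { apply (rderiv_cexp (fun s => Ci * (phi + 2 * sin phi * Lphi (s * z)))%C).
      apply (rderiv_comp (fun w => Ci * (phi + 2 * sin phi * Lphi w))%C
        (fun s => s * z)%C); [apply rderiv_line|].
      eapply cderiv_eq.
      - apply cderiv_scal, cderiv_plus; [apply cderiv_const|].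
        apply cderiv_scal, psf_cderiv; assumption.
      - ring. }
    assert (D2 : rderiv (fun s => Q (s * z)%C) t
      ((- cis phi * (1 - cis (- phi) * (t * z)) - (1 - cis phi * (t * z)) * - cis (- phi))
        / ((1 - cis (- phi) * (t * z)) * (1 - cis (- phi) * (t * z))) * z)%C).
    { apply (rderiv_comp Q (fun s => s * z)%C); [apply rderiv_line|].
      assert (Hlin : forall s w, cderiv (fun w => 1 - cis s * w)%C w (- cis s)%C).
      { intros s w. eapply cderiv_eq.
        - apply cderiv_minus; [apply cderiv_const|apply cderiv_scal, cderiv_id].
        - ring. }
      apply (cderiv_div (fun w => 1 - cis phi * w)%C (fun w => 1 - cis (- phi) * w)%C); auto. }
    pose proof (rderiv_mult _ _ _ _ _ D1 D2) as D.
    replace (RtoC 0) with (Ci * (2 * sin phi) * psf (dcoef (L_coef phi)) (t * z) * z *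
       Lexp (Lphi (t * z)) * Q (t * z) +
       Lexp (Lphi (t * z)) *
       ((- cis phi * (1 - cis (- phi) * (t * z)) - (1 - cis phi * (t * z)) * - cis (- phi)) /
        ((1 - cis (- phi) * (t * z)) * (1 - cis (- phi) * (t * z))) * z))%C; [exact D|].
    assert (Ed : psf (dcoef (L_coef phi)) (t * z)
      = (/ ((1 - cis phi * (t * z)) * (1 - cis (- phi) * (t * z))))%C).
    { pose proof (psf_dcoef_L _ Htz) as E.
      transitivity (psf (dcoef (L_coef phi)) (t * z) *
        ((1 - cis phi * (t * z)) * (1 - cis (- phi) * (t * z)))
        / ((1 - cis phi * (t * z)) * (1 - cis (- phi) * (t * z))))%C.
      - field. auto.
      - rewrite E. field. auto. }
    rewrite Ed.
    assert (Es : (Ci * (2 * sin phi))%C = (cis phi - cis (- phi))%C).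
    { unfold cis, Ci, Cminus, Cplus, Copp, Cmult, RtoC; simpl. rewrite cos_neg, sin_neg.
      f_equal; ring. }
    rewrite Es. unfold Q. field. auto. }
  assert (E : G 1 = G 0).
  { assert (E1 : Re (G 0) = Re (G 1)).
    { apply (eq_is_derive (V := R_NormedModule) (fun t => Re (G t))); [|lra].
      intros t Ht. exact (rderiv_Re _ _ _ (HG t Ht)). }
    assert (E2 : Im (G 0) = Im (G 1)).
    { apply (eq_is_derive (V := R_NormedModule) (fun t => Im (G t))); [|lra].
      intros t Ht. exact (rderiv_Im _ _ _ (HG t Ht)). }
    unfold Re, Im in *. destruct (G 0), (G 1). simpl in *. congruence. }
  unfold G in E. rewrite Cmult_1_l, Cmult_0_l, psf_0 in E by assumption.
  assert (E0 : (Lexp (L_coef phi 0) * Q 0)%C = cis phi).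
  { unfold Lexp, Q, cexp, L_coef. simpl INR. rewrite Rmult_0_l, sin_0.
    unfold Rdiv. rewrite Rmult_0_l. change (Defs.RtoC 0) with (RtoC 0).
    replace (Ci * (phi + 2 * sin phi * 0))%C with (Ci * phi)%C by ring.
    replace (Re (Ci * phi)%C) with 0 by (unfold Re, Ci, Cmult, RtoC; simpl; ring).
    replace (Im (Ci * phi)%C) with phi by (unfold Im, Ci, Cmult, RtoC; simpl; ring).
    rewrite exp_0. replace (1 - cis (- phi) * 0)%C with (RtoC 1) by ring. field. }
  rewrite E0 in E. unfold Q in E.
  pose proof (one_sub_cis_neq_0 (- phi) z Hz) as N2.
  transitivity (Lexp (Lphi z) * ((1 - cis phi * z) / (1 - cis (- phi) * z))
    * (1 - cis (- phi) * z))%C; [field; exact N2|].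
  rewrite E. transitivity (cis phi - cis phi * cis (- phi) * z)%C; [ring|].
  rewrite cis_phi_conj_mult. ring.
Qed.

Lemma Lexp_polar (w : C) :
  Lexp w = (exp (- (2 * sin phi * Im w)) * cis (phi + 2 * sin phi * Re w))%C.
Proof.
  unfold Lexp, cexp. f_equal.
  - do 2 f_equal. destruct w. unfold Re, Im, Ci, Cmult, Cplus, RtoC; simpl. ring.
  - f_equal. destruct w. unfold Re, Im, Ci, Cmult, Cplus, RtoC; simpl. ring.
Qed.

(** It shows that Im W > 0 exactly when |z| < 1, for the Moebius map W = (cis phi - z) / (1 - cis
    phi z). One direction serves the strip bound, the other surjectivity. *)
Lemma half_plane_identity (W z : C) :
  (W * (1 - cis phi * z) = cis phi - z)%C ->
  Im W * Cmod (1 - cis phi * z)%C ^ 2 = sin phi * (1 - Cmod z ^ 2).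
Proof.
  intros E. rewrite <- im_scal_r. rewrite Cmod2_conj, Cmult_assoc, E.
  rewrite Cmod_sqr. pose proof (sin2_cos2 phi) as T. unfold Rsqr in T.
  destruct z as [x y]. unfold Im, cis, Cconj, Cminus, Cplus, Copp, Cmult, RtoC; simpl.
  transitivity (sin phi - y + y * (sin phi * sin phi + cos phi * cos phi)
    - sin phi * (x * x + y * y)); [ring|rewrite T; ring].
Qed.

Lemma one_sub_neq_0_of (W z : C) :
  (W * (1 - cis phi * z) = cis phi - z)%C -> (1 - cis phi * z <> 0)%C.
Proof.
  intros E E0. rewrite E0, Cmult_0_r in E. pose proof sin_phi_pos as HS.
  assert (Ez : z = cis phi).
  { transitivity (cis phi - (cis phi - z))%C; [ring|]. rewrite <- E. ring. }
  rewrite Ez in E0. exact (cis_phi_sqr_neq_1 E0).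
Qed.

(** The quantity is an argument of [Lexp] of L_phi, so its sine is positive on the whole disk. It
    equals phi at 0, and by continuity along the segment from 0 to z it can reach neither 0 nor
    PI. *)
Lemma Lstrip (z : C) : Cmod z < 1 ->
  0 < phi + 2 * sin phi * Re (Lphi z) < PI.
Proof.
  intros Hz. pose proof sin_phi_pos as HS. pose proof disk_coef_L as HL.
  assert (Hsin : forall z, Cmod z < 1 -> 0 < sin (phi + 2 * sin phi * Re (Lphi z))).
  { intros w Hw. pose proof (half_plane_identity _ w (Lexp_psf w Hw)) as E.
    rewrite Lexp_polar, im_scal_l in E. change (Im (cis ?a)) with (sin a) in E.
    set (X := sin (phi + 2 * sin phi * Re (Lphi w))) in *.
    assert (0 < sin phi * (1 - Cmod w ^ 2)).
    { apply Rmult_lt_0_compat; [lra|]. pose proof (Cmod_ge_0 w). nra. }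
    rewrite <- E in H. pose proof (exp_pos (- (2 * sin phi * Im (Lphi w)))) as He.
    pose proof (pow2_ge_0 (Cmod (1 - cis phi * w)%C)) as Hsq.
    apply Rnot_le_lt. intros HX. apply (Rmult_le_compat_l _ _ _ (Rlt_le _ _ He)) in HX.
    rewrite Rmult_0_r in HX. apply (Rmult_le_compat_r _ _ _ Hsq) in HX. lra. }
  set (g := fun t => phi + 2 * sin phi * Re (Lphi (RtoC t * z))).
  assert (Htz : forall t, 0 <= t <= 1 -> Cmod (RtoC t * z)%C < 1).
  { intros t Ht. rewrite Cmod_mult, Cmod_Rpos by lra. pose proof (Cmod_ge_0 z). nra. }
  assert (Hg : forall t, 0 <= t <= 1 -> continuity_pt g t).
  { intros t Ht. apply continuity_pt_plus; [apply continuity_pt_const; intros a b; reflexivity|].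
    apply (continuity_pt_scal (fun t => Re (Lphi (RtoC t * z)))).
    apply continuity_pt_filterlim, (ex_derive_continuous (V := R_NormedModule)
      (fun t => Re (Lphi (RtoC t * z)))).
    eexists. apply (rderiv_Re (fun t => Lphi (RtoC t * z))).
    apply (rderiv_comp (Lphi) (fun t => RtoC t * z)%C); [apply rderiv_line|].
    apply psf_cderiv; auto. }
  assert (g0 : g 0 = phi).
  { unfold g. rewrite Cmult_0_l, psf_0 by assumption. unfold L_coef. simpl INR.
    rewrite Rmult_0_l, sin_0. unfold Rdiv. rewrite Rmult_0_l.
    change (phi + 2 * sin phi * 0 = phi). ring. }
  assert (g1 : g 1 = phi + 2 * sin phi * Re (Lphi z))
    by (unfold g; now rewrite Cmult_1_l).
  rewrite <- g1.
  assert (Hgs : forall t, 0 <= t <= 1 -> 0 < sin (g t)) by (intros t Ht; apply Hsin, Htz, Ht).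
  split; apply Rnot_le_lt; intros Hle.
  - destruct (Req_dec (g 1) 0) as [E|N].
    { specialize (Hgs 1 ltac:(lra)). rewrite E, sin_0 in Hgs. lra. }
    destruct (IVT_interv (fun t => - g t) 0 1) as [t [Ht E]]; try lra.
    { intros t Ht. apply (continuity_pt_opp g), Hg, Ht. }
    specialize (Hgs t Ht). replace (g t) with 0 in Hgs by lra. rewrite sin_0 in Hgs. lra.
  - destruct (Req_dec (g 1) PI) as [E|N].
    { specialize (Hgs 1 ltac:(lra)). rewrite E, sin_PI in Hgs. lra. }
    destruct (IVT_interv (fun t => g t - PI) 0 1) as [t [Ht E]]; try lra.
    { intros t Ht. apply (continuity_pt_minus g (fun _ => PI)); [apply Hg, Ht|].
      apply continuity_pt_const. intros a b. reflexivity. }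
    specialize (Hgs t Ht). replace (g t) with PI in Hgs by lra. rewrite sin_PI in Hgs. lra.
Qed.

(** [Lexp] of L_phi is a Moebius map whose determinant 1 - cis phi^2, up to sign, is nonzero. *)
Lemma inj_psf_L : inj_psf (L_coef phi).
Proof.
  intros z w Hz Hw E. pose proof sin_phi_pos as HS.
  pose proof (Lexp_psf z Hz) as Ez. pose proof (Lexp_psf w Hw) as Ew. rewrite <- E in Ew.
  set (W := Lexp (Lphi z)) in *.
  assert (H : ((1 - cis phi * cis phi) * (w - z) = 0)%C).
  { transitivity ((cis phi - z) * (1 - cis phi * w) - (cis phi - w) * (1 - cis phi * z))%C;
      [ring|]. rewrite <- Ez, <- Ew. ring. }
  destruct (Ceq_dec (w - z) 0) as [E0|N0]; [symmetry; now apply Ceq_minus|].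
  exfalso. exact (Cmult_neq_0 _ _ cis_phi_sqr_neq_1 N0 H).
Qed.

(** The Moebius map is its own inverse, which gives z. The values L_phi(z) and w then have the same
    [Lexp]: equal moduli give equal imaginary parts, and since both arguments lie in (0, PI), equal
    cosines give equal real parts. *)
Lemma L_surjective (w : C) :
  0 < phi + 2 * sin phi * Re w < PI -> exists z, Cmod z < 1 /\ Lphi z = w.
Proof.
  intros Hw. pose proof sin_phi_pos as HS.
  set (W := Lexp w). set (th := phi + 2 * sin phi * Re w) in *.
  set (ew := exp (- (2 * sin phi * Im w))).
  assert (EW : W = (ew * cis th)%C) by apply Lexp_polar.
  assert (HImW : 0 < Im W).
  { rewrite EW, im_scal_l. change (Im (cis th)) with (sin th).
    apply Rmult_lt_0_compat; [apply exp_pos|apply sin_gt_0; lra]. }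
  (* The pole cis (-phi) lies in the lower half-plane, whereas Im W > 0. *)
  assert (Hden : (1 - cis phi * W <> 0)%C).
  { intros E0. assert (E1 : W = cis (- phi)).
    { transitivity (cis (- phi) * (1 - (1 - cis phi * W)))%C.
      - transitivity (cis phi * cis (- phi) * W)%C; [rewrite cis_phi_conj_mult|]; ring.
      - rewrite E0. ring. }
    rewrite E1 in HImW. change (Im (cis (- phi))) with (sin (- phi)) in HImW.
    rewrite sin_neg in HImW. lra. }
  set (z := ((cis phi - W) / (1 - cis phi * W))%C).
  assert (Ez : (W * (1 - cis phi * z) = cis phi - z)%C).
  { unfold z. field. exact Hden. }
  pose proof (one_sub_neq_0_of W z Ez) as Hnz.
  pose proof (half_plane_identity W z Ez) as E.
  assert (Hz : Cmod z < 1).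
  { apply Cmod_gt_0 in Hnz. assert (0 < Cmod (1 - cis phi * z)%C ^ 2) by now apply pow_lt.
    assert (0 < sin phi * (1 - Cmod z ^ 2)) by (rewrite <- E; now apply Rmult_lt_0_compat).
    pose proof (Cmod_ge_0 z). apply Rnot_le_lt. intros Hge.
    assert (1 <= Cmod z ^ 2) by (simpl; nra). nra. }
  exists z. split; [exact Hz|].
  set (v := Lphi z). pose proof (Lexp_psf z Hz) as Ev. fold v in Ev.
  assert (EvW : Lexp v = W).
  { transitivity (Lexp v * (1 - cis phi * z) / (1 - cis phi * z))%C; [field; exact Hnz|].
    rewrite Ev, <- Ez. field. exact Hnz. }
  pose proof (Lstrip z Hz) as Hs. fold v in Hs.
  rewrite EW, Lexp_polar in EvW. set (ev := exp (- (2 * sin phi * Im v))) in *.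
  set (tv := phi + 2 * sin phi * Re v) in *.
  assert (Eexp : ev = ew).
  { apply (f_equal Cmod) in EvW. rewrite !Cmod_mult, !Cmod_cis, !Cmod_R, !Rmult_1_r in EvW.
    rewrite !Rabs_pos_eq in EvW by (left; apply exp_pos). exact EvW. }
  assert (EIm : Im v = Im w).
  { apply exp_inv in Eexp. apply Rmult_eq_reg_l with (2 * sin phi); [lra|apply Rgt_not_eq; lra]. }
  assert (ERe : Re v = Re w).
  { rewrite Eexp in EvW. apply (f_equal Re) in EvW. rewrite !re_scal_l in EvW.
    change (Re (cis tv)) with (cos tv) in EvW. change (Re (cis th)) with (cos th) in EvW.
    apply Rmult_eq_reg_l in EvW; [|apply Rgt_not_eq, exp_pos].
    assert (Et : tv = th) by (apply cos_inj; lra).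
    unfold tv, th in Et. apply Rmult_eq_reg_l with (2 * sin phi); [lra|apply Rgt_not_eq; lra]. }
  destruct v, w. unfold Re, Im in *. simpl in *. congruence.
Qed.

Lemma L_convex (z1 z2 : C) (t : R) :
  Cmod z1 < 1 -> Cmod z2 < 1 -> 0 <= t <= 1 ->
  exists z3, Cmod z3 < 1 /\ Lphi z3
    = (RtoC (1 - t) * Lphi z1 + RtoC t * Lphi z2)%C.
Proof.
  intros H1 H2 Ht. apply L_surjective.
  pose proof (Lstrip z1 H1) as S1. pose proof (Lstrip z2 H2) as S2.
  rewrite re_plus, !re_scal_l.
  set (a := Re (Lphi z1)) in *. set (b := Re (Lphi z2)) in *.
  replace (phi + 2 * sin phi * ((1 - t) * a + t * b))
    with ((1 - t) * (phi + 2 * sin phi * a) + t * (phi + 2 * sin phi * b)) by ring.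
  set (A := phi + 2 * sin phi * a) in *. set (B := phi + 2 * sin phi * b) in *.
  clearbody A B. split; destruct (Rle_lt_dec A B); nra.
Qed.
End Extremal.

(** * Convex functions as power series *)

Lemma Defs_Cpow_eq (z : C) (n : nat) : Defs.Cpow z n = (z ^ n)%C.
Proof. induction n as [|n IH]; [reflexivity|]. simpl. rewrite IH. reflexivity. Qed.

Lemma psum_eq (a : nat -> C) (z : C) (N : nat) :
  psum a z N = (sum_f_R0 (fun n => Re (a n * z ^ n)%C) N, sum_f_R0 (fun n => Im (a n * z ^ n)%C) N).
Proof.
  induction N as [|N IH]; [reflexivity|]. simpl. rewrite IH, Defs_Cpow_eq. reflexivity.
Qed.

Lemma has_sum_psf (a : nat -> C) (z : C) :
  disk_coef a -> Cmod z < 1 -> has_sum a z (psf a z).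
Proof.
  intros Ha Hz. pose proof (psf_summable a z Ha Hz) as Hs. split.
  - apply Un_cv_ext with (sum_f_R0 (fun n => Re (a n * z ^ n)%C));
      [intros n; now rewrite psum_eq|].
    apply is_series_Reals, Series_correct, Csummable_Re, Hs.
  - apply Un_cv_ext with (sum_f_R0 (fun n => Im (a n * z ^ n)%C));
      [intros n; now rewrite psum_eq|].
    apply is_series_Reals, Series_correct, Csummable_Im, Hs.
Qed.

Lemma has_sum_unique (a : nat -> C) (z w : C) :
  disk_coef a -> Cmod z < 1 -> has_sum a z w -> w = psf a z.
Proof.
  intros Ha Hz [H1 H2]. destruct (has_sum_psf a z Ha Hz) as [H3 H4].
  pose proof (UL_sequence _ _ _ H1 H3). pose proof (UL_sequence _ _ _ H2 H4).
  destruct w, (psf a z). simpl in *. congruence.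
Qed.

Lemma Un_cv_increment_bounded (u : nat -> R) (l : R) :
  Un_cv u l -> exists M, forall n, Rabs (u (S n) - u n) <= M.
Proof.
  intros H. destruct (maj_by_pos u (exist _ l H)) as [M [HM0 HM]].
  exists (2 * M). intros n. pose proof (HM n). pose proof (HM (S n)).
  eapply Rle_trans; [apply Rabs_triang|]. rewrite Rabs_Ropp. lra.
Qed.

(** Convergence at the real point rho bounds the terms, which are differences of consecutive partial
    sums, and the moduli of these terms are the |a_n| rho^n. *)
Lemma analytic_disk_coef (a : nat -> C) : analytic_on_D a -> disk_coef a.
Proof.
  intros Ha. apply disk_coef_decr. intros rho Hr.
  destruct (Req_dec rho 0) as [->|Hr0].
  { exists (Cmod (a 1%nat)). intros [|n]; simpl.
    - lra.
    - rewrite Rmult_0_l, Rmult_0_r. apply Cmod_ge_0. }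
  assert (HD : inD (RtoC rho)).
  { unfold inD. change (Cmod (RtoC rho) < 1). rewrite Cmod_Rpos; lra. }
  destruct (Ha _ HD) as [w [H1 H2]].
  destruct (Un_cv_increment_bounded _ _ H1) as [M1 HM1].
  destruct (Un_cv_increment_bounded _ _ H2) as [M2 HM2].
  exists ((M1 + M2) / rho). intros n. specialize (HM1 n). specialize (HM2 n).
  cbv beta in HM1, HM2. rewrite !psum_eq in HM1, HM2. cbn [fst snd] in HM1, HM2.
  rewrite tech5 in HM1, HM2.
  replace (sum_f_R0 (fun n => Re (a n * RtoC rho ^ n)%C) n + Re (a (S n) * RtoC rho ^ S n)%C
    - sum_f_R0 (fun n => Re (a n * RtoC rho ^ n)%C) n) with (Re (a (S n) * RtoC rho ^ S n)%C)
    in HM1 by ring.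
  replace (sum_f_R0 (fun n => Im (a n * RtoC rho ^ n)%C) n + Im (a (S n) * RtoC rho ^ S n)%C
    - sum_f_R0 (fun n => Im (a n * RtoC rho ^ n)%C) n) with (Im (a (S n) * RtoC rho ^ S n)%C)
    in HM2 by ring.
  pose proof (Cmod_le_Re_Im (a (S n) * RtoC rho ^ S n)%C) as H.
  rewrite Cmod_mult, Cmod_pow, Cmod_Rpos in H by lra. simpl pow in H.
  apply Rmult_le_reg_r with rho; [lra|]. unfold Rdiv.
  rewrite (Rmult_assoc (M1 + M2)), Rinv_l by lra. lra.
Qed.

Lemma inK_starlike_coefs (a : nat -> C) :
  inK a -> exists p, positive_coefs p /\ log_deriv_coefs p (dcoef a).
Proof.
  intros [[H0 [H1 [Han Huni]]] Hconv].
  pose proof (analytic_disk_coef a Han) as Ha.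
  assert (Hinj : inj_psf a).
  { intros z w Hz Hw E. apply (Huni z w (psf a z)); auto.
    - now apply has_sum_psf.
    - rewrite E. now apply has_sum_psf. }
  assert (Hmid : forall z1 z2, Cmod z1 < 1 -> Cmod z2 < 1 ->
    exists z3, Cmod z3 < 1 /\ psf a z3 = (/ 2 * (psf a z1 + psf a z2))%C).
  { intros z1 z2 Hz1 Hz2.
    (* Weight 1/2, because the cosine mean is the midpoint of the values of f at two rotations of
       z. *)
    destruct (Hconv z1 z2 _ _ (1 / 2) Hz1 Hz2 (has_sum_psf a z1 Ha Hz1) (has_sum_psf a z2 Ha Hz2))
      as [z3 [Hz3 E]]; [lra|].
    exists z3. split; [exact Hz3|]. rewrite <- (has_sum_unique a z3 _ Ha Hz3 E).
    rewrite <- RtoC_inv by lra. destruct (psf a z1), (psf a z2).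
    unfold Cadd, Cscal, Cmult, Cplus, RtoC; simpl. f_equal; field. }
  set (h := dcoef a). set (N := (fun n => RtoC (INR (S n)) * h n)%C).
  assert (Hh : disk_coef h) by now apply disk_coef_dcoef.
  assert (HN : disk_coef N) by exact (disk_coef_incr _ (disk_coef_INR _ (disk_coef_INR a Ha))).
  assert (h0 : h O = 1%C).
  { unfold h, dcoef. rewrite H1. simpl INR. apply Cmult_1_l. }
  exists (fun k => divseq h N k O). split; [|now apply log_deriv_coefs_divseq].
  apply positive_coefs_quotient; auto.
  - intros z Hz. now apply inj_deriv_neq_0.
  - unfold N. rewrite h0. simpl INR. ring.
  - intros z Hz. now apply convex_Re_pos.
Qed.

Lemma inK_L_coef (phi : R) : 0 < phi < PI -> inK (L_coef phi).
Proof.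
  intros Hphi. pose proof (disk_coef_L phi Hphi) as HL. pose proof (sin_phi_pos phi Hphi) as HS.
  split; [split; [|split; [|split]]|].
  - unfold L_coef. simpl INR. rewrite Rmult_0_l, sin_0. unfold Rdiv. now rewrite Rmult_0_l.
  - unfold L_coef. simpl INR. rewrite !Rmult_1_l. unfold Rdiv. now rewrite Rinv_r by lra.
  - intros z Hz. exists (psf (L_coef phi) z). now apply has_sum_psf.
  - intros z1 z2 w Hz1 Hz2 E1 E2. apply (inj_psf_L phi Hphi); auto.
    transitivity w; [symmetry|]; now apply has_sum_unique.
  - intros z1 z2 w1 w2 t Hz1 Hz2 E1 E2 Ht.
    rewrite (has_sum_unique _ _ _ HL Hz1 E1), (has_sum_unique _ _ _ HL Hz2 E2).
    destruct (L_convex phi Hphi z1 z2 t Hz1 Hz2 Ht) as [z3 [Hz3 E]].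
    exists z3. split; [exact Hz3|].
    replace (Cadd _ _) with (psf (L_coef phi) z3); [now apply has_sum_psf|].
    rewrite E. destruct (psf (L_coef phi) z1), (psf (L_coef phi) z2).
    unfold Cadd, Cscal, Cmult, Cplus, RtoC; simpl. f_equal; ring.
Qed.

(** * Extremal coefficients and the final bounds *)

(** The angle pi / k annihilates the k-th coefficient, so that in each extremal difference a single
    modulus survives. *)
Lemma L_coef_vanish (k : nat) : (2 <= k)%nat -> Cmod (L_coef (PI / INR k) k) = 0.
Proof.
  intros Hk. assert (INR k <> 0) by (apply not_0_INR; lia).
  rewrite Cmod_L_coef. replace (INR k * (PI / INR k)) with PI by (now field).
  rewrite sin_PI. unfold Rdiv. rewrite Rmult_0_l. apply Rabs_R0.
Qed.

Lemma PI_div_bounds (k : nat) : (2 <= k)%nat -> 0 < PI / INR k < PI.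
Proof.
  intros Hk. pose proof PI_RGT_0. apply le_INR in Hk. simpl INR in Hk.
  split; [apply Rdiv_lt_0_compat; lra|].
  apply Rlt_div_l; nra.
Qed.

Lemma L_coef_succ (k : nat) : (2 <= k)%nat -> Cmod (L_coef (PI / INR k) (S k)) = 1 / INR (S k).
Proof.
  intros Hk. pose proof (PI_div_bounds k Hk) as Hb.
  pose proof (sin_gt_0 _ (proj1 Hb) (proj2 Hb)) as HS.
  assert (Hk0 : INR k <> 0) by (apply not_0_INR; lia).
  assert (Hk1 : 0 < INR (S k)) by (apply lt_0_INR; lia).
  rewrite Cmod_L_coef.
  replace (INR (S k) * (PI / INR k)) with (PI / INR k + PI) by (rewrite S_INR; field; auto).
  rewrite neg_sin.
  replace (- sin (PI / INR k) / (INR (S k) * sin (PI / INR k))) with (- (1 / INR (S k)))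
    by (field; lra).
  rewrite Rabs_Ropp, Rabs_pos_eq; [reflexivity|]. apply Rdiv_le_0_compat; lra.
Qed.

Lemma L_coef_pred (k : nat) : (1 <= k)%nat -> Cmod (L_coef (PI / INR (S k)) k) = 1 / INR k.
Proof.
  intros Hk. pose proof (PI_div_bounds (S k) ltac:(lia)) as Hb.
  pose proof (sin_gt_0 _ (proj1 Hb) (proj2 Hb)) as HS.
  assert (Hk0 : 0 < INR k) by (apply lt_0_INR; lia).
  assert (Hk1 : 0 < INR (S k)) by (apply lt_0_INR; lia).
  rewrite Cmod_L_coef.
  replace (INR k * (PI / INR (S k))) with (PI - PI / INR (S k)) by (rewrite S_INR in *; field; lra).
  rewrite sin_PI_x.
  replace (sin (PI / INR (S k)) / (INR k * sin (PI / INR (S k)))) with (1 / INR k)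
    by (field; lra).
  apply Rabs_pos_eq. apply Rdiv_le_0_compat; lra.
Qed.

Lemma Cmod_dcoef (a : nat -> C) (n : nat) : Cmod (dcoef a n) = INR (S n) * Cmod (a (S n)).
Proof. unfold dcoef. rewrite Cmod_mult, Cmod_Rpos by apply pos_INR. reflexivity. Qed.

(** From (n+1) |a_{n+1}| - n |a_n| <= 1 the difference is at most (1 - |a_n|) / (n+1). Dropping
    |a_n| keeps the bound sharp, since the n-th coefficient of L_{pi/n} vanishes for n >= 2. *)
Lemma inK_upper_bound (a : nat -> C) (n : nat) :
  (1 <= n)%nat -> inK a -> Cmod (a (S n)) - Cmod (a n) <= 1 / INR (S n).
Proof.
  intros Hn Ha. destruct (inK_starlike_coefs a Ha) as [p [Hp Hph]].
  destruct n as [|n]; [lia|].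
  pose proof (starlike_successive p (dcoef a) n Hp Hph) as H.
  rewrite !Cmod_dcoef in H. rewrite (S_INR (S n)) in *.
  assert (0 < INR (S n)) by (apply lt_0_INR; lia).
  pose proof (Cmod_ge_0 (a (S n))).
  apply Rmult_le_reg_l with (INR (S n) + 1); [lra|].
  replace ((INR (S n) + 1) * (1 / (INR (S n) + 1))) with 1 by (field; lra). nra.
Qed.

(* Coquelicot shadowed C and Cmod. *)
Import Pilot.Defs.

Theorem theorem1 :
  (forall n : nat, (2 <= n)%nat ->
     is_lub (Uset n) (1 / INR (S n)) /\
     inK (L_coef (PI / INR n)) /\
     Cmod (L_coef (PI / INR n) (S n)) - Cmod (L_coef (PI / INR n) n) = 1 / INR (S n))
  /\
  (is_lub (Vset 2) (1 / 2) /\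
   inK (L_coef (PI / 3)) /\
   Cmod (L_coef (PI / 3) 2) - Cmod (L_coef (PI / 3) 3) = 1 / 2)
  /\
  (is_lub (Vset 3) (1 / 3) /\
   inK (L_coef (PI / 4)) /\
   Cmod (L_coef (PI / 4) 3) - Cmod (L_coef (PI / 4) 4) = 1 / 3).
Proof.
  assert (Hlub : forall (E : R -> Prop) (m : R),
    E m -> (forall x, E x -> x <= m) -> is_lub E m).
  { intros E m Hm Hub. split; [exact Hub|]. intros b Hb. now apply Hb. }
  assert (I3 : INR 3 = 3) by (simpl; ring). assert (I4 : INR 4 = 4) by (simpl; ring).
  split; [|split].
  - intros n Hn. pose proof (inK_L_coef _ (PI_div_bounds n Hn)) as HK.
    assert (Hval : Cmod (L_coef (PI / INR n) (S n)) - Cmod (L_coef (PI / INR n) n) = 1 / INR (S n)).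
    { change Cmod with Complex.Cmod. rewrite (L_coef_succ n Hn), (L_coef_vanish n Hn). ring. }
    split; [|split; assumption]. apply Hlub.
    + exists (L_coef (PI / INR n)). now split.
    + intros x [a [Ha ->]]. apply inK_upper_bound; [lia|exact Ha].
  - pose proof (inK_L_coef _ (PI_div_bounds 3 ltac:(lia))) as HK.
    pose proof (L_coef_pred 2 ltac:(lia)) as E1. pose proof (L_coef_vanish 3 ltac:(lia)) as E2.
    rewrite I3 in HK, E1, E2. replace (INR 2) with 2 in E1 by (simpl; ring).
    assert (Hval : Cmod (L_coef (PI / 3) 2) - Cmod (L_coef (PI / 3) 3) = 1 / 2).
    { change Cmod with Complex.Cmod. rewrite E1, E2. ring. }
    split; [|split; assumption]. apply Hlub.
    + exists (L_coef (PI / 3)). now split.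
    + intros x [a [Ha ->]]. destruct (inK_starlike_coefs a Ha) as [p [Hp Hph]].
      pose proof (convex_coef_2_3 p _ Hp Hph) as H. rewrite !Cmod_dcoef in H.
      change Cmod with Complex.Cmod. rewrite I3 in H. replace (INR 2) with 2 in H by (simpl; ring). lra.
  - pose proof (inK_L_coef _ (PI_div_bounds 4 ltac:(lia))) as HK.
    pose proof (L_coef_pred 3 ltac:(lia)) as E1. pose proof (L_coef_vanish 4 ltac:(lia)) as E2.
    rewrite I4 in HK, E1, E2. rewrite I3 in E1.
    assert (Hval : Cmod (L_coef (PI / 4) 3) - Cmod (L_coef (PI / 4) 4) = 1 / 3).
    { change Cmod with Complex.Cmod. rewrite E1, E2. ring. }
    split; [|split; assumption]. apply Hlub.
    + exists (L_coef (PI / 4)). now split.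
    + intros x [a [Ha ->]]. destruct (inK_starlike_coefs a Ha) as [p [Hp Hph]].
      pose proof (convex_coef_3_4 p _ Hp Hph) as H. rewrite !Cmod_dcoef in H.
      change Cmod with Complex.Cmod. rewrite I3, I4 in H. lra.
Qed.
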